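(* Let $C$ be a longest cycle in a $(\delta-\lambda+1)$-connected graph $G$ of order $n$, where $\lambda$ is an integer with $1\le\lambda\le\delta$. If $\delta\geq \frac{n+2}{\lambda+1}+\lambda-2$, then $\overline{c}\leq \delta-\lambda$.
   Context: All graphs are finite, undirected, without loops or multiple edges. For a graph $G$ on $n$ vertices, $\delta$ denotes its minimum degree and $\kappa$ its connectivity. A cycle of order $t$ is a sequence $v_1\dots v_tv_1$ of distinct vertices with consecutive vertices adjacent; a single vertex is a cycle of order 1 and an edge a cycle of order 2. $C$ is a longest cycle of $G$, $c=|C|$ is the circumference, and $\overline{c}$ denotes the order of a longest cycle in $G-C$ (the subgraph obtained by deleting the vertices of $C$); $\overline{c}\le 0$ if $G-C$ is empty. *)

(* Defs.v *)
From mathcomp Require Import all_boot all_order all_algebra.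

Set Implicit Arguments.
Unset Strict Implicit.
Unset Printing Implicit Defensive.

Record sgraph := SGraph {
  vertex :> finType;
  adj : rel vertex;
  adj_sym : symmetric adj;
  adj_irrefl : irreflexive adj
}.

Section Induced.
Variables (G : sgraph) (A : {set G}).

Definition induced_adj : rel {x : G | x \in A} :=
  fun x y => adj (val x) (val y).

Lemma induced_adj_sym : symmetric induced_adj.
Proof. by move=> x y; apply: adj_sym. Qed.

Lemma induced_adj_irrefl : irreflexive induced_adj.
Proof. by move=> x; apply: adj_irrefl. Qed.

Definition induced : sgraph := SGraph induced_adj_sym induced_adj_irrefl.
End Induced.

Definition del_vertices (G : sgraph) (S : {set G}) : sgraph := induced (~: S).

Definition degree (G : sgraph) (v : G) : nat := #|[set w | adj v w]|.

(* Degrees are < #|G|, so the default value #|G| only matters, harmlessly,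
   for the graph without vertices. *)
Definition min_degree (G : sgraph) : nat :=
  \big[minn/#|G|]_(v : G) degree v.

Definition connected (G : sgraph) : Prop :=
  forall x y : G, connect (@adj G) x y.

Definition k_connected (k : nat) (G : sgraph) : Prop :=
  k < #|G| /\
  forall S : {set G}, #|S| < k -> connected (del_vertices S).

(* The sequence v_1 ... v_t stands for the cycle v_1 ... v_t v_1. A single
   vertex counts as a cycle of order 1, which [path.cycle] rejects since adj is
   irreflexive; on two vertices [path.cycle] amounts to adjacency, so an edge is
   a cycle of order 2. *)
Definition is_cycle (G : sgraph) (c : seq G) : bool :=
  [&& 0 < size c, uniq c & (size c == 1) || cycle (@adj G) c].

Definition longest_cycle (G : sgraph) (c : seq G) : Prop :=
  is_cycle c /\ forall d : seq G, is_cycle d -> size d <= size c.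

(* Order of a longest cycle; it is 0 for the graph without vertices. *)
Definition circumference (G : sgraph) : nat :=
  \max_(k < #|G|.+1 | [exists t : k.-tuple G, is_cycle t]) k.

(* The order of a longest cycle in G - C. *)
Definition c_bar (G : sgraph) (C : seq G) : nat :=
  circumference (del_vertices [set x in C]).

(* Main.v *)
Require Import Defs.
From mathcomp Require Import all_boot all_order all_algebra.
From mathcomp Require Import zify ring.

Set Implicit Arguments.
Unset Strict Implicit.
Unset Printing Implicit Defensive.

(* Put mu = delta - lambda + 1 and B = V \ C, and suppose that a longest cycle H of B has order
   h >= mu; we show n >= (mu + 1)(lambda + 1) - 1, against the hypothesis on delta.

   Call a vertex of B low if it has fewer than min(h, lambda) neighbours in B; it then has many
   neighbours on C. If more than half of min(h, lambda) disjoint paths of B join H to low vertices,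
   the paths extended to C form branches of a connected subgraph rooted at H, and comparing
   consecutive attachments on the longest cycle C with long arcs of H bounds |C| from below. (When
   h > lambda, B is first replaced by the block D containing H, and the vertices of D with
   neighbours in B \ D also count as ends: by connectivity, the part of B \ D behind such a vertex
   has many neighbours on C.) Otherwise Menger's theorem confines H to a set W whose boundary has at
   most half of min(h, lambda) vertices. Either any two vertices of W are joined inside W by a path
   on lambda vertices, and mu disjoint paths from W to C give |C| >= mu (lambda + 1), or there is a
   longest path P of W, between two fixed ends, that is too short (P = H with one edge removed when
   h <= lambda). This is impossible: after shrinking W, every vertex of W off P lies on its
   boundary, because a non-boundary vertex off P would yield a long path rooted in a detour of P by
   an Erdos-Gallai argument; and then the vertices of P have so many neighbours in so few places
   that P can be rerouted to a longer path. *)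

(** * Finite sets and families *)

Section FiniteSets.
Variable T : finType.
Implicit Types (A B : {set T}) (a : T) (s : seq T).

Lemma card_set_seq s : uniq s -> #|[set z in s]| = size s.
Proof. by move=> us; rewrite cardsE; apply/card_uniqP. Qed.

Lemma cardsU_le A B : #|A :|: B| <= #|A| + #|B|.
Proof. exact: (leq_card_setU A B).1. Qed.

Lemma cardsU1_le a A : #|a |: A| <= #|A|.+1.
Proof. by rewrite cardsU1 -add1n leq_add2r leq_b1. Qed.

Lemma cardsU_disjoint A B : A :&: B = set0 -> #|A :|: B| = #|A| + #|B|.
Proof. by move=> dAB; rewrite cardsU dAB cards0 subn0. Qed.

End FiniteSets.

Section DisjointFamilies.
Variables (T U : finType).
Implicit Type I : {set U}.

Definition disjoint_on (pT : predType T) I (g : U -> pT) :=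
  forall i j z, i \in I -> j \in I -> z \in g i -> z \in g j -> i = j.

Lemma disjoint_onI I (g : U -> {set T}) i j :
  disjoint_on I g -> i \in I -> j \in I -> i != j -> g i :&: g j = set0.
Proof.
move=> dg iI jI nij; apply/setP => z; rewrite in_setI in_set0; apply/negP => /andP[zi zj].
by rewrite (dg i j z) ?eqxx in nij.
Qed.

Lemma card_bigcup_disjoint_on I (g : U -> {set T}) :
  disjoint_on I g -> #|\bigcup_(i in I) g i| = \sum_(i in I) #|g i|.
Proof.
move=> dg; pose h i := if i \in I then g i else set0.
have dh i j : i != j -> [disjoint h i & h j].
  rewrite /h -setI_eq0 => nij; case: ifP => iI; rewrite ?set0I //.
  by case: ifP => jI; rewrite ?setI0 // (disjoint_onI dg iI jI nij).
rewrite (big_mkcond [in I]) (eq_bigr h) // -sum1_card partition_disjoint_bigcup //.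
rewrite [RHS]big_mkcond; apply: eq_bigr => i _; rewrite sum1_card /h.
by case: ifP; rewrite ?cards0.
Qed.

Lemma disjoint_on_inj I (g : U -> seq T) (r : U -> T) :
  disjoint_on I g -> {in I, forall i, r i \in g i} -> {in I &, injective r}.
Proof.
by move=> dg rg i j iI jI rij; apply: (dg i j (r i)); rewrite ?rg // rij rg.
Qed.

Lemma disjoint_on_set_seq I (g : U -> seq T) :
  disjoint_on I g -> disjoint_on I (fun i => [set z in g i]).
Proof. by move=> dg i j z iI jI; rewrite !in_set; apply: dg. Qed.

End DisjointFamilies.

(** * Paths inside a vertex set *)

Section Paths.
Variables (T : finType) (e : rel T).
Implicit Types (A B X : {set T}) (x y z : T) (p q : seq T).

Definition rel_on A : rel T := fun x y => [&& x \in A, y \in A & e x y].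

Definition connected_on A := [forall x in A, forall y in A, connect (rel_on A) x y].

Definition upath A x p y :=
  [&& path e x p, uniq (x :: p), all [in A] (x :: p) & last x p == y].

Definition long_upath A x y n := exists2 p, upath A x p y & n <= (size p).+1.

Definition longest_upath A x p y :=
  upath A x p y /\ forall q, upath A x q y -> size q <= size p.

Definition nbhd A x := [set y in A | e x y].

Definition nbrs A X := [set y in A | [exists x in X, e x y]].

Lemma in_nbhd A x y : (y \in nbhd A x) = (y \in A) && e x y. Proof. by rewrite inE. Qed.

Lemma nbrsP A X y : reflect (y \in A /\ exists2 x, x \in X & e x y) (y \in nbrs A X).
Proof. by rewrite inE; apply: (iffP andP) => -[yA /exists_inP]. Qed.

Lemma nbrsS A X X' : X \subset X' -> nbrs A X \subset nbrs A X'.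
Proof.
move=> /subsetP sX; apply/subsetP => y /nbrsP[yA [x xX exy]].
by apply/nbrsP; split=> //; exists x; first exact: sX.
Qed.

Lemma nbrs1 A x : nbrs A [set x] = nbhd A x.
Proof.
apply/setP => y; rewrite in_nbhd; apply/nbrsP/andP => [[yA [_ /set1P-> exy]]|[yA exy]] //.
by split=> //; exists x; rewrite ?set11.
Qed.

Lemma path_rel_on A x p : path e x p -> all [in A] (x :: p) -> path (rel_on A) x p.
Proof.
elim: p x => //= z p IH x /andP[exz pp] /and3P[xA zA pA].
by rewrite /rel_on xA zA exz IH //= zA.
Qed.

Lemma rel_on_path A x p :
  x \in A -> path (rel_on A) x p -> path e x p /\ all [in A] (x :: p).
Proof.
elim: p x => [|z p IH] x xA //=; first by rewrite xA.
by case/andP=> /and3P[_ zA ->] /(IH _ zA)[-> /=]; rewrite xA.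
Qed.

Lemma path_connect_rel_on A x p :
  path e x p -> all [in A] (x :: p) -> connect (rel_on A) x (last x p).
Proof. by move=> pp pA; apply/connectP; exists p => //; apply: path_rel_on. Qed.

Lemma connect_upath A x y :
  x \in A -> connect (rel_on A) x y -> exists p, upath A x p y.
Proof.
move=> xA /connectP[p pp ->]; case/shortenP: pp => q pq uq _.
have [pe qA] := rel_on_path xA pq.
by exists q; rewrite /upath pe uq qA eqxx.
Qed.

Lemma upath_connect A x p y : upath A x p y -> connect (rel_on A) x y.
Proof. by case/and4P=> pp _ pA /eqP<-; apply: path_connect_rel_on. Qed.

Lemma connect_rel_onS A B x y :
  A \subset B -> connect (rel_on A) x y -> connect (rel_on B) x y.
Proof.
move=> /subsetP sAB; apply: connect_sub => u v /and3P[uA vA euv].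
by apply: connect1; rewrite /rel_on euv !sAB.
Qed.

Lemma connect_rel_on_mem A x y : connect (rel_on A) x y -> x \in A -> y \in A.
Proof.
move=> cxy xA; have [p /and4P[_ _ /allP pA /eqP<-]] := connect_upath xA cxy.
exact/pA/mem_last.
Qed.

Lemma connect_rel_on_closed A X x y :
  (forall z w, z \in X -> w \in A -> e z w -> w \in X) -> x \in X ->
  connect (rel_on A) x y -> y \in X.
Proof.
move=> closedX xX /connectP[p pp ->]; elim: p x xX pp => //= z p IH x xX.
by move=> /andP[/and3P[_ zA exz]]; apply: IH; apply: closedX exz.
Qed.

Lemma connected_onP A :
  reflect {in A &, forall x y, connect (rel_on A) x y} (connected_on A).
Proof.
apply: (iffP forall_inP) => [cA x y xA yA|cA x xA]; first exact: (forall_inP (cA x xA)).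
by apply/forall_inP => y yA; apply: cA.
Qed.

Lemma upathS A B x p y : A \subset B -> upath A x p y -> upath B x p y.
Proof.
move=> /subsetP sAB /and4P[pp up pA lp]; apply/and4P; split=> //.
by apply: sub_all pA => z; apply: sAB.
Qed.

Lemma upath_set_sub A x p y : upath A x p y -> [set z in x :: p] \subset A.
Proof. by case/and4P=> _ _ /allP pA _; apply/subsetP => z; rewrite inE; apply: pA. Qed.

Lemma longest_upath_sub A B x p y : B \subset A -> [set z in x :: p] \subset B ->
  longest_upath A x p y -> longest_upath B x p y.
Proof.
move=> sBA /subsetP spB [/and4P[pp up _ lp] max_p].
split=> [|q uq]; last by apply: max_p; apply: upathS uq.
by apply/and4P; split=> //; apply/allP => z zp; apply: spB; rewrite inE.
Qed.

Lemma long_upathW A B x y m n :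
  A \subset B -> n <= m -> long_upath A x y m -> long_upath B x y n.
Proof.
move=> sAB nm [p up mp]; exists p; first exact: upathS up.
exact: leq_trans mp.
Qed.

Lemma long_upath_refl A x : x \in A -> long_upath A x x 1.
Proof. by move=> xA; exists [::]; rewrite // /upath /= xA eqxx. Qed.

Lemma long_upath_max1 A x y n : long_upath A x y n -> long_upath A x y (maxn n 1).
Proof. by case=> p up np; exists p => //; rewrite geq_max np. Qed.

Lemma connected_on_upath A x y :
  connected_on A -> x \in A -> y \in A -> long_upath A x y 1.
Proof.
by move=> /connected_onP cA xA yA; have [p] := connect_upath xA (cA _ _ xA yA); exists p.
Qed.

Lemma connected_on_upath2 A x y :
  connected_on A -> x \in A -> y \in A -> x != y -> long_upath A x y 2.
Proof.
move=> cA xA yA nxy; have [p up _] := connected_on_upath cA xA yA; exists p => //.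
by case: p up => // /and4P[_ _ _ /=]; rewrite (negbTE nxy).
Qed.

Lemma longest_upath_exists A x y :
  x \in A -> connect (rel_on A) x y -> exists p, longest_upath A x p y.
Proof.
move=> xA /(connect_upath xA)[p0 up0].
pose has_size k := [exists t : k.-tuple T, upath A x t y].
have upath_has p : upath A x p y -> has_size (size p).
  by move=> up; apply/existsP; exists (in_tuple p).
have bounded k : has_size k -> k <= #|T|.
  case/existsP=> t /and4P[_ /andP[_ ut] _ _].
  by rewrite -(size_tuple t) -(card_uniqP ut) max_card.
have some_size : exists k, has_size k by exists (size p0); apply: upath_has.
case: (ex_maxnP some_size bounded) => k /existsP[t ut] maxk.
by exists t; split=> // q /upath_has; rewrite size_tuple; apply: maxk.
Qed.

Lemma long_upath_cat A B x y y' z m n :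
  long_upath A x y m -> long_upath B y' z n -> e y y' -> [disjoint A & B] ->
  long_upath (A :|: B) x z (m + n).
Proof.
move=> [p /and4P[pp up pA /eqP lpy] mp] [q /and4P[pq uq qB /eqP lqz] nq] eyy dAB.
exists (p ++ y' :: q); last by rewrite size_cat /=; lia.
apply/and4P; split.
- by rewrite cat_path pp lpy /= eyy.
- rewrite -cat_cons cat_uniq up uq andbT.
  by apply/hasPn => w /(allP qB) wB; apply/negP => /(allP pA) /(disjointFr dAB); rewrite wB.
- rewrite -cat_cons all_cat; apply/andP; split; apply/allP => w wp; rewrite inE.
    by rewrite (allP pA).
  by rewrite (allP qB) // orbT.
- by rewrite last_cat /= lqz.
Qed.

Lemma long_upath_join A B x y z m n :
  long_upath A x y m -> long_upath B y z n -> A :&: B \subset [set y] -> 0 < m ->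
  long_upath (A :|: B) x z (m + n).-1.
Proof.
move=> [p /and4P[pp up pA /eqP lpy] mp] [q /and4P[pq uq qB /eqP lqz] nq] /subsetP sAB m0.
exists (p ++ q); last by rewrite size_cat /=; lia.
move: (uq) (qB) => /= /andP[yq uq'] /andP[yB qB'].
apply/and4P; split.
- by rewrite cat_path pp lpy.
- rewrite -cat_cons cat_uniq up uq' andbT; apply/hasPn => w wq; apply/negP => /(allP pA) wA.
  have /set1P wy : w \in [set y] by rewrite sAB // inE; apply/andP; split=> //; apply: (allP qB').
  by rewrite -wy wq in yq.
- rewrite -cat_cons all_cat; apply/andP; split; apply/allP => w wp; rewrite inE.
    by rewrite (allP pA).
  by rewrite (allP qB') ?orbT.
- by rewrite last_cat lpy lqz.
Qed.

Section Symmetric.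
Hypothesis es : symmetric e.

Lemma rel_on_sym A : symmetric (rel_on A).
Proof. by move=> x y; rewrite /rel_on es andbCA. Qed.

Lemma connect_rel_on_sym A : connect_sym (rel_on A).
Proof. exact/sym_connect_sym/rel_on_sym. Qed.

Lemma rev_path_sym x p : path e (last x p) (rev (belast x p)) = path e x p.
Proof. by rewrite rev_path; apply: eq_path => y z; rewrite es. Qed.

Lemma long_upath_sym A x y n : long_upath A x y n -> long_upath A y x n.
Proof.
move=> [p /and4P[pp up pA /eqP<-] np]; exists (rev (belast x p)); last first.
  by rewrite size_rev size_belast.
have E : last x p :: rev (belast x p) = rev (x :: p) by rewrite [x :: p]lastI rev_rcons.
rewrite /upath E rev_uniq up all_rev pA rev_path_sym pp /=.
by case: p {pp up pA np E} => [|z p] /=; rewrite ?rev_cons ?last_rcons eqxx.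
Qed.

Lemma connected_on_root A r :
  (forall x, x \in A -> connect (rel_on A) r x) -> connected_on A.
Proof.
move=> rA; apply/connected_onP => x y xA yA; apply: connect_trans (rA y yA).
by rewrite connect_rel_on_sym; apply: rA.
Qed.

Lemma connected_on_path x p : path e x p -> connected_on [set z in x :: p].
Proof.
move=> pp; apply: (@connected_on_root _ x) => z; rewrite inE => zp.
case/splitPl: zp pp => p1 p2 <-; rewrite cat_path => /andP[pp1 _].
apply: path_connect_rel_on => //; apply/allP => w wp.
by rewrite inE -cat_cons mem_cat wp.
Qed.

Lemma connected_onU1 A x y : connected_on A -> y \in A -> e x y -> connected_on (x |: A).
Proof.
move=> cA yA exy; apply: (@connected_on_root _ y) => z; rewrite in_setU1 => /orP[/eqP->|zA].
  by apply: connect1; rewrite /rel_on !inE eqxx yA es exy orbT.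
by apply: (@connect_rel_onS A); [apply: subsetUr | apply: (connected_onP _ cA)].
Qed.

Lemma connected_onU A B z :
  connected_on A -> connected_on B -> z \in A -> z \in B -> connected_on (A :|: B).
Proof.
move=> cA cB zA zB; apply: (@connected_on_root _ z) => y; rewrite inE => /orP[yA|yB].
  by apply: (@connect_rel_onS A); [apply: subsetUl | apply: (connected_onP _ cA)].
by apply: (@connect_rel_onS B); [apply: subsetUr | apply: (connected_onP _ cB)].
Qed.

End Symmetric.

Definition component A x := [set y in A | connect (rel_on A) x y].

Lemma component_sub A x : component A x \subset A.
Proof. by apply/subsetP => y; rewrite inE => /andP[]. Qed.

Lemma mem_component A x : x \in A -> x \in component A x.
Proof. by move=> xA; rewrite inE xA connect0. Qed.

Lemma component_closed A x y z :
  y \in component A x -> z \in A -> e y z -> z \in component A x.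
Proof.
rewrite !inE => /andP[yA cxy] zA eyz; rewrite zA; apply: connect_trans cxy _.
by apply: connect1; rewrite /rel_on yA zA eyz.
Qed.

Lemma component_connected A x : symmetric e -> x \in A -> connected_on (component A x).
Proof.
move=> es xA; apply: (@connected_on_root es _ x) => y; rewrite inE => /andP[yA cxy].
have [p /and4P[pp _ pA /eqP<-]] := connect_upath xA cxy.
apply: path_connect_rel_on => //; apply/allP => z zp.
case/splitPl: zp pp pA => p1 p2 lz; rewrite cat_path -cat_cons all_cat.
case/andP=> pp1 _ /andP[p1A _]; rewrite inE -lz path_connect_rel_on // andbT.
by apply: (allP p1A); rewrite mem_last.
Qed.

End Paths.

(** * Menger's theorem *)

Section Linkages.
Variable T : finType.
Implicit Types (e : rel T) (A B S U X Y Z : {set T}) (a b s t u x y z : T) (p q : seq T).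
Implicit Type g : T -> seq T.

Definition separates e X Y S := [forall x in X, forall y in Y,
  ~~ [&& x \notin S, y \notin S & connect (rel_on e (~: S)) x y]].

Lemma separatesP e X Y S :
  reflect (forall x p, x \in X -> path e x p -> last x p \in Y -> has [in S] (x :: p))
          (separates e X Y S).
Proof.
apply: (iffP forall_inP) => [sepS x p xX pp lY|hitS x xX].
  move: (forall_inP (sepS x xX) _ lY); apply: contraNT => np.
  have pS : all [in ~: S] (x :: p).
    by rewrite -all_predC in np; apply: sub_all np => z /=; rewrite inE.
  rewrite path_connect_rel_on // andbT; apply/andP; split.
    by move: pS => /= /andP[]; rewrite inE.
  by have := allP pS _ (mem_last x p); rewrite inE.
apply/forall_inP => y yY; apply/negP => /and3P[xS yS cxy].
have [|p /and4P[pp _ pA /eqP lpy]] := connect_upath _ cxy; first by rewrite inE.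
have /hasP[z zp zS] : has [in S] (x :: p) by apply: hitS; rewrite ?lpy.
by have := allP pA _ zp; rewrite inE zS.
Qed.

Definition link e X Y p :=
  if p is x :: q then [&& x \in X, last x q \in Y, path e x q & uniq p] else false.

(* The elements of I only label the paths: g i need not contain i. *)
Definition linkage e X Y k := exists (I : {set T}) g,
  [/\ #|I| = k, {in I, forall i, link e X Y (g i)} & disjoint_on I g].

Lemma linkP e X Y p : reflect
  (exists x q, [/\ p = x :: q, x \in X, last x q \in Y, path e x q & uniq (x :: q)])
  (link e X Y p).
Proof.
case: p => [|x q]; first by constructor=> -[? [? []]].
apply: (iffP and4P) => [[xX lY pq uq]|[_ [_ [[<- <-] xX lY pq uq]]]] //.
by exists x, q.
Qed.

Lemma sub_link e e' X Y p : subrel e e' -> link e X Y p -> link e' X Y p.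
Proof.
move=> se /linkP[x [q [-> xX lY pq uq]]]; apply/linkP.
by exists x, q; split=> //; apply: sub_path pq.
Qed.

Lemma sub_linkage e e' X Y k : subrel e e' -> linkage e X Y k -> linkage e' X Y k.
Proof.
by move=> se [I [g [cI gI dI]]]; exists I, g; split=> // i /gI; apply: sub_link.
Qed.

Lemma link_cat e X Y s t p q : link e X [set s] p -> link e [set t] Y q -> e s t ->
  (forall z, z \in p -> z \notin q) -> link e X Y (p ++ q).
Proof.
move=> /linkP[x [p' [-> xX /set1P lp pp up]]] /linkP[t' [q' [-> /set1P-> lY pq uq]]] est disj.
apply/linkP; exists x, (p' ++ t :: q'); split=> //; first by rewrite last_cat.
  by rewrite cat_path pp lp /= est.
by rewrite -cat_cons cat_uniq up uq andbT; apply/hasPn => z zq; apply: contraL zq => /disj.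
Qed.

Lemma link_join e X Y s p q : link e X [set s] p -> link e [set s] Y q ->
  (forall z, z \in p -> z \in q -> z = s) -> link e X Y (p ++ behead q).
Proof.
move=> /linkP[x [p' [-> xX /set1P lp pp up]]] /linkP[s' [q' [-> /set1P-> lY pq uq]]] meet.
apply/linkP; exists x, (p' ++ q'); split=> //; first by rewrite last_cat lp.
  by rewrite cat_path pp lp.
move: (uq); rewrite cons_uniq => /andP[sq uq']; rewrite -cat_cons cat_uniq up uq' andbT.
apply/hasPn => z zq; apply: contra sq => zp.
by rewrite -(meet z zp (mem_behead (s := s :: q') zq)).
Qed.

Lemma linkage_relabel e X Y k (r : T -> seq T -> T) :
  (forall i p, link e X Y p -> r i p \in p) -> linkage e X Y k ->
  exists Z g, [/\ #|Z| = k, {in Z, forall z, link e X Y (g z)},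
    {in Z, forall z, exists i, r i (g z) = z} & disjoint_on Z g].
Proof.
move=> r_mem [I [g [cI gI dI]]]; pose f i := r i (g i).
have fg : {in I, forall i, f i \in g i} by move=> i /gI; apply: r_mem.
have f_inj := disjoint_on_inj dI fg.
pose f' z := odflt z [pick i in I | f i == z].
have f'P z : z \in f @: I -> f' z \in I /\ f (f' z) = z.
  case/imsetP=> i iI ->; rewrite /f'; case: pickP => [j /andP[jI /eqP]|] //=.
  by move=> /(_ i); rewrite iI eqxx.
exists (f @: I), (g \o f'); split.
- by rewrite card_in_imset.
- by move=> z /f'P[fI _] /=; apply: gI.
- by move=> z /f'P[_ fz]; exists (f' z).
- move=> y z t /f'P[yI fy] /f'P[zI fz] /= ty tz.
  by rewrite -fy -fz (dI _ _ t yI zI ty tz).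
Qed.

Lemma linkage_ends e X Z k : #|Z| = k -> linkage e X Z k ->
  exists g, {in Z, forall z, link e X [set z] (g z)} /\ disjoint_on Z g.
Proof.
move=> cZ /(linkage_relabel (r := last)) [|Z' [g [cZ' gZ' lZ' dg]]].
  by move=> i p /linkP[x [q [-> _ _ _ _]]]; rewrite /= mem_last.
have lastP z : z \in Z' -> z \in Z /\ link e X [set z] (g z).
  move=> zZ'; have /linkP[x [q [Eg xX lZ pq uq]]] := gZ' z zZ'.
  have [i lz] := lZ' z zZ'; rewrite Eg /= in lz; rewrite lz in lZ; split=> //.
  by apply/linkP; exists x, q; rewrite lz set11.
have EZ : Z' = Z.
  by apply/eqP; rewrite eqEcard cZ cZ' leqnn andbT; apply/subsetP => z /lastP[].
by rewrite -EZ; exists g; split=> // z /lastP[].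
Qed.

Lemma linkage_starts e Z Y k : #|Z| = k -> linkage e Z Y k ->
  exists g, {in Z, forall z, link e [set z] Y (g z)} /\ disjoint_on Z g.
Proof.
move=> cZ /(linkage_relabel (r := head)) [|Z' [g [cZ' gZ' hZ' dg]]].
  by move=> i p /linkP[x [q [-> _ _ _ _]]]; apply: mem_head.
have headP z : z \in Z' -> z \in Z /\ link e [set z] Y (g z).
  move=> zZ'; have /linkP[x [q [Eg xZ lY pq uq]]] := gZ' z zZ'.
  have [i xz] := hZ' z zZ'; rewrite Eg /= in xz; rewrite xz in xZ lY pq uq Eg; split=> //.
  by apply/linkP; exists z, q; rewrite set11.
have EZ : Z' = Z.
  by apply/eqP; rewrite eqEcard cZ cZ' leqnn andbT; apply/subsetP => z /headP[].
by rewrite -EZ; exists g; split=> // z /headP[].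
Qed.

Lemma link_crossing e X Y S A B (P Q : T -> seq T) s t z :
  separates e X Y S -> S \subset A -> S \subset B ->
  {in A, forall s, link e X [set s] (P s)} -> disjoint_on A P ->
  {in B, forall t, link e [set t] Y (Q t)} -> disjoint_on B Q ->
  s \in A -> t \in B -> z \in P s -> z \in Q t -> [/\ z \in S, z = s & z = t].
Proof.
move=> /separatesP sepS /subsetP sSA /subsetP sSB PA dP QB dQ sA tB zP zQ.
have Pself r : r \in S -> r \in P r.
  move=> rS; have /linkP[x [p [-> _ /set1P lr _ _]]] := PA r (sSA r rS).
  by rewrite -{1}lr mem_last.
have Qself r : r \in S -> r \in Q r.
  move=> rS; have /linkP[x [q [-> /set1P-> _ _ _]]] := QB r (sSB r rS).
  exact: mem_head.
have /linkP[x [p [EP xX /set1P lp pp up]]] := PA s sA.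
have /linkP[t' [q [EQ /set1P Et lqY pq uq]]] := QB t tB.
subst t'; have zp := zP; have zq := zQ; rewrite EP in zp; rewrite EQ in zq.
case/splitPl: zp EP lp pp up => p1 p2 lp1 EP lp pp up.
case/splitPl: zq EQ lqY pq uq => q1 q2 lq1 EQ lqY pq uq.
have /hasP[w wpq wS] : has [in S] (x :: p1 ++ q2).
  apply: sepS => //; last by move: lqY; rewrite !last_cat lp1 lq1.
  by move: pp pq; rewrite !cat_path lp1 lq1 => /andP[-> _] /andP[_ ->].
move: wpq; rewrite -cat_cons mem_cat => /orP[wp1|wq2].
  have ws : w = s.
    by apply: (dP w s w (sSA w wS) sA (Pself w wS)); rewrite EP -cat_cons mem_cat wp1.
  have zs : z = s.
    case: p2 EP lp pp up => [|b p2] _ lp _ up; first by rewrite -lp1 -lp cats0.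
    have : s \in b :: p2 by rewrite -lp last_cat /= mem_last.
    move: up; rewrite -cat_cons cat_uniq => /and3P[_ /hasPn/(_ s) sp1 _] /sp1.
    by rewrite -ws wp1.
  have zS : z \in S by rewrite zs -ws.
  by split=> //; apply: (dQ z t z (sSB z zS) tB (Qself z zS)).
have wt : w = t.
  by apply: (dQ w t w (sSB w wS) tB (Qself w wS)); rewrite EQ -cat_cons mem_cat wq2 orbT.
by move: uq; rewrite /= -wt mem_cat wq2 orbT.
Qed.

Section EdgeDeletion.
Variables (e : rel T) (a b : T).

Definition del_edge : rel T := fun x y => e x y && ((x, y) != (a, b)).

Lemma sub_del_edge : subrel del_edge e.
Proof. by move=> x y /andP[]. Qed.

Lemma path_del_edge x p :
  path e x p -> (a \notin belast x p) || (b \notin p) -> path del_edge x p.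
Proof.
elim: p x => //= z p IH x /andP[exz pp]; rewrite !inE !negb_or => avoid.
rewrite /del_edge exz xpair_eqE negb_and /=.
case/orP: avoid => /andP[nab np]; rewrite IH ?np ?orbT // [_ == a]eq_sym [z == b]eq_sym.
  by rewrite nab.
by rewrite nab orbT.
Qed.

Lemma separates_del_edge X Y S z :
  z \in [:: a; b] -> separates del_edge X Y S -> separates e X Y (z |: S).
Proof.
move=> zab /separatesP sepS; apply/separatesP => x p xX pp lY.
have [zp|zp] := boolP (z \in x :: p); first by apply/hasP; exists z => //=; rewrite setU11.
suff pe : path del_edge x p.
  by apply: sub_has (sepS x p xX pe lY) => y /=; rewrite in_setU1 => ->; rewrite orbT.
apply: path_del_edge pp _; move: zab zp; rewrite !inE => /orP[]/eqP->.
  by move=> ap; rewrite (contra _ ap) // => /mem_belast.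
by rewrite negb_or => /andP[_ ->]; rewrite orbT.
Qed.

Lemma path_del_edge_prefix S x p : a \in S -> path e x p -> has [in S] (x :: p) ->
  exists p1 p2, [/\ p = p1 ++ p2, path del_edge x p1 & last x p1 \in S].
Proof.
move=> aS; elim: p x => [|z p IH] x /=; first by rewrite orbF => _ xS; exists [::], [::].
case/andP=> exz pp; have [xS _|xS /= hasS] := boolP (x \in S); first by exists [::], (z :: p).
have [p1 [p2 [-> pp1 lS]]] := IH z pp hasS.
exists (z :: p1), p2; split=> //=; rewrite pp1 andbT /del_edge exz xpair_eqE.
by apply: contra xS => /andP[/eqP-> _].
Qed.

Lemma path_del_edge_suffix S x p : b \in S -> path e x p -> has [in S] (x :: p) ->
  exists p1 p2, [/\ p = p1 ++ p2, path del_edge (last x p1) p2 & last x p1 \in S].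
Proof.
move=> bS; elim: p x => [|z p IH] x; first by rewrite /= orbF => _ xS; exists [::], [::].
have [hasS /andP[_ pp] _|noS pzp] := boolP (has [in S] (z :: p)).
  by have [p1 [p2 [-> pp2 lS]]] := IH z pp hasS; exists (z :: p1), p2.
rewrite -[x :: _]cat1s has_cat (negbTE noS) orbF has_seq1 => xS.
exists [::], (z :: p); split=> //; apply: path_del_edge pzp _; rewrite orbC.
by rewrite (contra _ noS) // => bzp; apply/hasP; exists b.
Qed.

Lemma separates_del_edge_prefix X Y S Z :
  a \in S -> separates e X Y S -> separates del_edge X S Z -> separates e X Y Z.
Proof.
move=> aS /separatesP sepS /separatesP sepZ; apply/separatesP => x p xX pp lY.
have [p1 [p2 [-> pp1 lS]]] := path_del_edge_prefix aS pp (sepS x p xX pp lY).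
by rewrite -cat_cons has_cat sepZ.
Qed.

Lemma separates_del_edge_suffix X Y S Z :
  b \in S -> separates e X Y S -> separates del_edge S Y Z -> separates e X Y Z.
Proof.
move=> bS /separatesP sepS /separatesP sepZ; apply/separatesP => x p xX pp lY.
have [p1 [p2 [Ep pp2 lS]]] := path_del_edge_suffix bS pp (sepS x p xX pp lY).
have /hasP[w wp wZ] : has [in Z] (last x p1 :: p2) by apply: sepZ => //; rewrite Ep last_cat in lY.
apply/hasP; exists w => //; rewrite Ep -cat_cons mem_cat.
by move: wp; rewrite inE => /orP[/eqP->|->]; rewrite ?mem_last ?orbT.
Qed.

Lemma linkage_glue X Y S k : e a b -> a \notin S -> b \notin S ->
  #|a |: S| = k -> #|b |: S| = k -> separates del_edge X Y S ->
  linkage del_edge X (a |: S) k -> linkage del_edge (b |: S) Y k -> linkage e X Y k.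
Proof.
move=> eab aS bS ca cb sepS /(linkage_ends ca)[P [PA dP]] /(linkage_starts cb)[Q [QB dQ]].
have crossing := link_crossing sepS (subsetUr [set a] S) (subsetUr [set b] S) PA dP QB dQ.
pose f s := if s == a then b else s.
have fB s : s \in a |: S -> f s \in b |: S.
  by rewrite /f !in_setU1; case: eqVneq => [_|_ /= ->]; rewrite ?eqxx ?orbT.
have f_inj : {in a |: S &, injective f}.
  move=> s t; rewrite /f !in_setU1.
  case: (eqVneq s a) => [->|_]; case: (eqVneq t a) => [->|_] //= sS tS E.
    by rewrite -E (negbTE bS) in tS.
  by rewrite E (negbTE bS) in sS.
have f_fixed s : f s \in S -> f s = s by rewrite /f; case: eqVneq => //; rewrite (negbTE bS).
pose g s := P s ++ (if s == a then Q b else behead (Q s)).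
have gPQ s z : z \in g s -> z \in P s \/ z \in Q (f s).
  rewrite /g /f mem_cat => /orP[->|]; [by left|case: eqVneq => _ zQ; right => //].
  exact: mem_behead.
have clash s t z : s \in a |: S -> t \in a |: S -> z \in P s -> z \in Q (f t) -> s = t.
  move=> sA tA zP zQ; have [zS <- zt] := crossing s (f t) z sA (fB t tA) zP zQ.
  by rewrite zt f_fixed // -zt.
exists (a |: S), g; split=> // [s sA|s t z sA tA /gPQ[zs|zs] /gPQ[zt|zt]].
- have Ps := sub_link sub_del_edge (PA s sA); have Qs := sub_link sub_del_edge (QB _ (fB s sA)).
  have meet z : z \in P s -> z \in Q (f s) -> [/\ z \in S, z = s & z = f s].
    exact: crossing sA (fB s sA).
  move: Qs meet; rewrite /g /f; case: eqVneq => [sa|_] Qs meet.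
    apply: link_cat Ps Qs _ _ => [|z zP]; first by rewrite sa.
    by apply/negP => /(meet z zP)[zS _ zb]; rewrite zb (negbTE bS) in zS.
  by apply: link_join Ps Qs _ => z zP /(meet z zP)[].
- exact: dP sA tA zs zt.
- exact: clash sA tA zs zt.
- by apply/esym/(clash t s z).
- exact: f_inj sA tA (dQ _ _ z (fB s sA) (fB t tA) zs zt).
Qed.

End EdgeDeletion.

Lemma linkage_setI e X Y k : k <= #|X :&: Y| -> linkage e X Y k.
Proof.
case/card_geqP=> s [us ss sXY]; exists [set x in s], (fun x => [:: x]); split=> [|i|i j z].
- by rewrite cardsE (card_uniqP us).
- by rewrite inE => /sXY; rewrite inE /= => /andP[-> ->].
- by rewrite !inE => _ _ /eqP-> /eqP.
Qed.

(* Goering's induction on the number of edges: if deleting ab creates a separator S that is too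
   small, then S + a and S + b are minimum separators, and linkages at both glue along ab. *)
Theorem menger e X Y k : (forall S, separates e X Y S -> k <= #|S|) -> linkage e X Y k.
Proof.
have [n] := ubnP #|[set q : T * T | e q.1 q.2]|.
elim: n e X Y => // n IH e X Y; rewrite ltnS => le_n sepk.
have [/eqP no_edge|] := boolP ([set q : T * T | e q.1 q.2] == set0).
  apply/linkage_setI/sepk/separatesP => x [|z p] xX /=; first by rewrite inE xX => _ ->.
  by case/andP=> exz; move/setP/(_ (x, z)): no_edge; rewrite !inE /= exz.
case/set0Pn=> -[a b]; rewrite inE /= => eab; pose e' := del_edge e a b.
have IH' X' Y' : (forall S, separates e' X' Y' S -> k <= #|S|) -> linkage e' X' Y' k.
  apply: IH; apply: leq_trans le_n; apply: proper_card; apply/properP; split.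
    by apply/subsetP => q; rewrite !inE => /sub_del_edge.
  by exists (a, b); rewrite inE ?eab //= /e' /del_edge eqxx andbF.
have [/forallP sepk'|] := boolP [forall S, separates e' X Y S ==> (k <= #|S|)].
  by apply: sub_linkage (@sub_del_edge e a b) (IH' X Y _) => S; apply/implyP.
case/forallPn=> S; rewrite negb_imply -ltnNge => /andP[sepS Sk].
have sep_add z : z \in [:: a; b] -> separates e X Y (z |: S) by move/separates_del_edge; apply.
have card_add z : z \in [:: a; b] -> #|z |: S| = k /\ z \notin S.
  by move=> zab; have := sepk _ (sep_add z zab); rewrite cardsU1; case: (z \in S) => /=; lia.
have aab := mem_head a [:: b]; have bab : b \in [:: a; b] by rewrite !inE eqxx orbT.
have [[ca aS] [cb bS]] := (card_add a aab, card_add b bab).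
apply: (linkage_glue eab aS bS ca cb sepS).
  by apply: IH' => Z; move/(separates_del_edge_prefix (setU11 a S) (sep_add a aab))/sepk.
by apply: IH' => Z; move/(separates_del_edge_suffix (setU11 b S) (sep_add b bab))/sepk.
Qed.

(* Paths along [crossing e X Y] meet X only in their first vertex and Y only in their last. *)
Definition crossing e X Y : rel T := fun x y => [&& x \notin Y, y \notin X & e x y].

Lemma crossing_path e X Y x p : path (crossing e X Y) x p ->
  [/\ path e x p, {in p, forall z, z \notin X} & {in belast x p, forall z, z \notin Y}].
Proof.
elim: p x => //= y p IH x /andP[/and3P[xY yX exy] /IH[pp pX pY]]; split.
- by rewrite exy.
- by move=> z; rewrite in_cons => /orP[/eqP->|/pX].
- by move=> z; rewrite in_cons => /orP[/eqP->|/pY].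
Qed.

Lemma crossing_subpath e X Y x p : x \in X -> path e x p -> last x p \in Y ->
  exists y q, [/\ y \in X, path (crossing e X Y) y q, last y q \in Y & {subset y :: q <= x :: p}].
Proof.
move=> xX pp lY.
suff [//|[q [pq lqY sq]]] :
    (exists y q, [/\ y \in X, path (crossing e X Y) y q, last y q \in Y &
                     {subset y :: q <= x :: p}]) \/
    (exists q, [/\ path (crossing e X Y) x q, last x q \in Y & {subset q <= p}]).
  by exists x, q; split=> // z; rewrite !in_cons => /orP[->|/sq->]; rewrite ?orbT.
elim: p x pp lY {xX} => [|z p IH] x /=; first by move=> _ xY; right; exists [::].
case/andP=> exz pp lY; have [[y [q [yX pq lq sq]]]|[q [pq lq sq]]] := IH z pp lY.
  by left; exists y, q; split=> // t /sq; apply: (mem_behead (s := x :: z :: p)).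
have sub : {subset z :: q <= z :: p}.
  by move=> t; rewrite !in_cons => /orP[->|/sq->]; rewrite ?orbT.
have [zX|zX] := boolP (z \in X).
  by left; exists z, q; split=> // t /sub; apply: (mem_behead (s := x :: z :: p)).
have [xY|xY] := boolP (x \in Y); first by right; exists [::].
by right; exists (z :: q); split=> //=; rewrite /crossing xY zX exz.
Qed.

Definition crossing_linkage e X Y (U : {set T}) g := [/\ U \subset X,
  {in U, forall u, [/\ path e u (g u), uniq (u :: g u), last u (g u) \in Y,
     {in g u, forall z, z \notin X} & {in belast u (g u), forall z, z \notin Y}]} &
  disjoint_on U (fun u => u :: g u)].

Lemma crossing_linkage_meet e X Y U g u : crossing_linkage e X Y U g -> u \in U ->
  [set z in u :: g u] :&: X = [set u] /\ [set z in u :: g u] :&: Y \subset [set last u (g u)].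
Proof.
move=> [sUX gP _] uU; have [_ _ _ gX gY] := gP u uU; split.
  apply/setP => z; rewrite in_setI in_set in_cons in_set1; case: eqVneq => [->|_] /=.
    exact: (subsetP sUX).
  by apply/andP => -[/gX/negbTE->].
apply/subsetP => z /setIP[]; rewrite in_set lastI mem_rcons in_cons in_set1.
by case/orP=> [->//|/gY/negbTE->].
Qed.

Theorem menger_crossing e X Y k :
  (exists U g, #|U| = k /\ crossing_linkage e X Y U g) \/
  (exists2 S, separates e X Y S & #|S| < k).
Proof.
have [/forallP sepk|] := boolP [forall S, separates e X Y S ==> (k <= #|S|)]; last first.
  by case/forallPn=> S; rewrite negb_imply -ltnNge => /andP[sepS Sk]; right; exists S.
left; have /menger : forall S, separates (crossing e X Y) X Y S -> k <= #|S|.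
  move=> S /separatesP sepS; apply: (implyP (sepk S)); apply/separatesP => x p xX pp lY.
  have [y [q [yX pq lq sq]]] := crossing_subpath xX pp lY.
  by have /hasP[z /sq zp zS] := sepS y q yX pq lq; apply/hasP; exists z.
case/(linkage_relabel (r := head)) => [i p /linkP[x [q [-> _ _ _ _]]]|U [g [cU gU hU dU]]].
  exact: mem_head.
have gE u : u \in U -> exists q, [/\ g u = u :: q, u \in X, last u q \in Y,
    path (crossing e X Y) u q & uniq (u :: q)].
  move=> uU; have /linkP[x [q [Eg xX lY pq uq]]] := gU u uU.
  by have [i] := hU u uU; rewrite Eg /= => <-; exists q.
exists U, (behead \o g); split=> //.
split=> [|u /gE[q [Eg uX lY /crossing_path[pq qX qY] uq]]|].
- by apply/subsetP => u /gE[q []].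
- by rewrite /= Eg.
- move=> u v z uU vU /=; have [q [Eu _ _ _ _]] := gE u uU; have [r [Ev _ _ _ _]] := gE v vU.
  by move: (dU u v z uU vU); rewrite Eu Ev.
Qed.

End Linkages.

(** * Rooted paths in graphs of large degree *)

Section Lobes.
Variables (T : finType) (e : rel T).
Hypothesis es : symmetric e.
Implicit Types (B F J : {set T}) (u v w x y z : T) (p : seq T).

Definition lobe F v J :=
  [&& J \subset F :\ v, connected_on e J & nbrs e (F :\: J) J \subset [set v]].

Lemma lobeP F v J : reflect [/\ J \subset F :\ v, connected_on e J &
    forall x y, x \in J -> y \in F -> e x y -> y \in v |: J] (lobe F v J).
Proof.
apply: (iffP and3P) => -[sJ cJ closedJ]; split=> //.
  move=> x y xJ yF exy; rewrite in_setU1 orbC; have [//|yJ] := boolP (y \in J).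
  rewrite -in_set1 (subsetP closedJ) //; apply/nbrsP.
  by rewrite in_setD yJ; split=> //; exists x.
apply/subsetP => y /nbrsP[/setDP[yF yJ] [x xJ exy]].
by have := closedJ x y xJ yF exy; rewrite in_setU1 (negbTE yJ) orbF in_set1.
Qed.

Lemma lobe_notin F v J : lobe F v J -> v \notin J.
Proof.
by move=> /lobeP[/subsetP sJ _ _]; apply/negP => /sJ; rewrite in_setD1 eqxx.
Qed.

Lemma lobe_component F v x : x \in F :\ v -> lobe F v (component e (F :\ v) x).
Proof.
move=> xF; apply/lobeP; split; [exact: component_sub | exact: component_connected |].
move=> y z yC zF eyz; rewrite in_setU1; case: eqVneq => //= nzv.
by apply: component_closed eyz => //; rewrite in_setD1 nzv.
Qed.

Lemma lobe_trans B v F u J :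
  lobe B v F -> lobe (v |: F) u J -> v \notin J -> lobe B u J.
Proof.
move=> /lobeP[sF _ closedF] /lobeP[sJ cJ closedJ] vJ.
have sJF : J \subset F.
  apply/subsetP => z zJ; have := subsetP sJ z zJ; rewrite in_setD1 in_setU1 => /andP[_].
  by case/orP => // /eqP zv; rewrite -zv zJ in vJ.
apply/lobeP; split=> // [|x y xJ yB exy].
  apply/subsetP => z zJ; rewrite in_setD1; apply/andP; split.
    by have := subsetP sJ z zJ; rewrite in_setD1 => /andP[].
  by have /setD1P[] := subsetP sF z (subsetP sJF z zJ).
by apply: (closedJ x) => //; apply: closedF (subsetP sJF x xJ) yB exy.
Qed.

Lemma lobe_path F v J x p :
  lobe F v J -> x \in J -> path e x p -> v \notin p -> all [in F] p -> all [in J] p.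
Proof.
move/lobeP=> [_ _ closedJ]; elim: p x => //= z p IH x xJ /andP[exz pp].
rewrite inE negb_or => /andP[nvz vp] /andP[zF pF].
have zJ : z \in J by have := closedJ x z xJ zF exz; rewrite in_setU1 eq_sym (negbTE nvz).
by rewrite zJ (IH z).
Qed.

Lemma lobe_attached F v J z :
  connected_on e F -> v \in F -> lobe F v J -> z \in J -> exists2 w, w \in J & e v w.
Proof.
move=> /connected_onP cF vF lJ zJ; have /lobeP[sJ _ _] := lJ.
have /setD1P[zv zF] := subsetP sJ z zJ.
have [p /and4P[pp up pF /eqP lv]] := connect_upath zF (cF z v zF vF).
case/lastP: p pp up pF lv => [|p w] pp up pF lv; first by rewrite -lv eqxx in zv.
rewrite last_rcons in lv; subst w.
move: pp; rewrite rcons_path => /andP[pp elv].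
have vp : v \notin p by move: up; rewrite /= rcons_uniq => /and3P[].
have pF' : all [in F] p by move: pF; rewrite /= all_rcons => /and3P[].
have pJ := lobe_path lJ zJ pp vp pF'.
exists (last z p); last by rewrite es.
by have := mem_last z p; rewrite inE => /orP[/eqP->//|/(allP pJ)].
Qed.

Lemma lobe_avoiding_path F v J y : connected_on e F -> v \in F -> y \in F -> lobe F v J ->
  y \notin J -> long_upath e (F :\: J) v y 1.
Proof.
move=> /connected_onP cF vF yF lJ yJ.
have [p /and4P[pp up pF /eqP ly]] := connect_upath vF (cF v y vF yF).
exists p => //; rewrite /upath pp up ly eqxx andbT /=; apply/andP; split.
  by rewrite in_setD vF (lobe_notin lJ).
apply/allP => z zp; rewrite in_setD (allP pF) ?inE ?zp ?orbT // andbT; apply/negP => zJ.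
case/splitPr: zp pp up pF ly => p1 p2; rewrite cat_path /= last_cat /=.
move=> /and3P[_ _ pp2] /andP[vp _] /andP[_]; rewrite all_cat /= => /and3P[_ _ p2F] ly.
have p2J : all [in J] p2.
  apply: (lobe_path lJ zJ pp2 _ p2F).
  by apply: contra vp; rewrite mem_cat inE => ->; rewrite !orbT.
move: yJ; rewrite -ly; have := mem_last z p2.
by rewrite inE => /orP[/eqP->|/(allP p2J)->]; rewrite ?zJ.
Qed.

End Lobes.

Section RootedPaths.
Variables (T : finType) (e : rel T).
Hypotheses (es : symmetric e) (ei : irreflexive e).
Implicit Types (F J K M : {set T}) (k m u v w y z : T) (d : nat).

Definition minimal_lobe K F y v J := [/\ v \in F, lobe e F v J, y \notin J, J :&: K != set0 &
  forall u J', u \in F -> lobe e F u J' -> y \notin J' -> J' :&: K != set0 -> #|J| <= #|J'|].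

Lemma minimal_lobe_exists K F y k :
  y \in F -> k \in F :&: K -> k != y -> exists v J, minimal_lobe K F y v J.
Proof.
move=> yF /setIP[kF kK] ky.
pose P (q : T * {set T}) :=
  [&& q.1 \in F, lobe e F q.1 q.2, y \notin q.2 & q.2 :&: K != set0].
have P0 : P (y, component e (F :\ y) k).
  have kFy : k \in F :\ y by rewrite in_setD1 ky.
  have lC := lobe_component es kFy.
  rewrite /P /= yF lC (lobe_notin lC) /=.
  by apply/set0Pn; exists k; rewrite inE mem_component.
case: (arg_minnP (fun r : T * {set T} => #|r.2|) P0) => -[v J] /= /and4P[/= vF lJ yJ JK] minJ.
exists v, J; split=> // u J' uF lJ' yJ' J'K.
by apply: (minJ (u, J')); rewrite /P /= uF lJ' yJ'.
Qed.

Section LobeCore.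
Variables (K F J : {set T}) (y v m : T) (d : nat).
Hypothesis minJ : minimal_lobe K F y v J.
Hypotheses (yF : y \in F) (mJ : m \in J).
Hypothesis deg : forall u, u \in F :&: K -> u != y -> d <= #|nbhd e (y |: (F :&: K)) u|.

Definition lobe_core := component e ((v |: J) :\ m) v.

Let lJ : lobe e F v J. Proof. by case: minJ. Qed.
Let vF : v \in F. Proof. by case: minJ. Qed.
Let yJ : y \notin J. Proof. by case: minJ. Qed.

Let sJF : J \subset F.
Proof. by have /lobeP[sJ _ _] := lJ; apply: subset_trans sJ (subD1set _ _). Qed.

Let closedJ u w : u \in J -> w \in F -> e u w -> w \in v |: J.
Proof. by have /lobeP[_ _] := lJ; apply. Qed.

Let mv : m != v. Proof. by apply: contraTneq mJ => ->; apply: lobe_notin lJ. Qed.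

Lemma mem_lobe_core : v \in lobe_core.
Proof. by apply: mem_component; rewrite in_setD1 eq_sym mv setU11. Qed.

Lemma lobe_core_connected : connected_on e lobe_core.
Proof. by apply: component_connected => //; rewrite in_setD1 eq_sym mv setU11. Qed.

Lemma lobe_core_sub : lobe_core \subset (v |: J) :\ m. Proof. exact: component_sub. Qed.

Lemma lobe_core_sub_lobe : lobe_core \subset v |: J.
Proof. exact: subset_trans lobe_core_sub (subD1set _ _). Qed.

Lemma lobe_core_proper : #|lobe_core| < #|F|.
Proof.
apply: proper_card; apply/properP; split; last first.
  exists m; first exact: (subsetP sJF).
  by apply/negP => /(subsetP lobe_core_sub); rewrite in_setD1 eqxx.
by apply: subset_trans lobe_core_sub_lobe _; rewrite subUset sub1set vF.
Qed.

Lemma lobe_core_mem_lobe u : u \in lobe_core -> u != v -> u \in J.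
Proof. by move=> /(subsetP lobe_core_sub_lobe); rewrite in_setU1 => /orP[->|]. Qed.

Lemma lobe_core_closed u w :
  u \in lobe_core -> u != v -> w \in F -> e u w -> w != m -> w \in lobe_core.
Proof.
move=> uC uv wF euw wm; apply: (component_closed uC _ euw).
by rewrite in_setD1 wm (closedJ (lobe_core_mem_lobe uC uv) wF euw).
Qed.

Lemma no_smaller_lobe u J' : u \in v |: J -> lobe e (v |: J) u J' -> v \notin J' ->
  m \notin J' -> J' :&: K = set0.
Proof.
move=> uJ lJ' vJ' mJ'; apply/eqP; apply: contraT => J'K.
have sJ' : J' \subset J :\ m.
  apply/subsetP => z zJ'; have /lobeP[/subsetP/(_ z zJ') + _ _] := lJ'.
  rewrite !in_setD1 in_setU1 => /andP[_ /orP[/eqP zv|->]]; first by rewrite -zv zJ' in vJ'.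
  by rewrite andbT; apply: contraNneq mJ' => <-.
have [_ _ _ _ min] := minJ; have : #|J| <= #|J'|.
  apply: (min u J') => //; last by apply: contra yJ => /(subsetP sJ')/setD1P[].
    by move: uJ; rewrite in_setU1 => /orP[/eqP->|/(subsetP sJF)].
  exact: lobe_trans lJ lJ' vJ'.
by rewrite (cardsD1 m J) mJ add1n ltnNge (subset_leq_card sJ').
Qed.

Lemma mem_lobe_core_kernel k : k \in J :&: K -> k != m -> k \in lobe_core.
Proof.
case/setIP=> kJ kK km; have kA : k \in (v |: J) :\ m by rewrite in_setD1 km in_setU1 kJ orbT.
apply: contraT => nk; have vC : v \notin component e ((v |: J) :\ m) k.
  apply: contra nk; rewrite /lobe_core ![_ \in component _ _ _]inE => /andP[_ ckv].
  by rewrite kA connect_rel_on_sym.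
have lC := lobe_component es kA.
have /setP/(_ k) := no_smaller_lobe (setU1r v mJ) lC vC (lobe_notin lC).
by rewrite in_setI kK mem_component // in_set0.
Qed.

Lemma lobe_core_degree u :
  u \in lobe_core :&: K -> u != v -> d.-1 <= #|nbhd e (v |: (lobe_core :&: K)) u|.
Proof.
case/setIP=> uC uK uv; have uJ := lobe_core_mem_lobe uC uv.
have uy : u != y by apply: contraNneq yJ => <-.
have uFK : u \in F :&: K by rewrite in_setI uK (subsetP sJF).
suff sub : nbhd e (y |: (F :&: K)) u \subset m |: nbhd e (v |: (lobe_core :&: K)) u.
  have := leq_trans (deg uFK uy) (subset_leq_card sub).
  by rewrite -subn1 leq_subLR => le_d; apply: leq_trans le_d (cardsU1_le _ _).
apply/subsetP => w; rewrite in_nbhd in_setU1 in_setI => /andP[wyK euw].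
have wF : w \in F by case/orP: wyK => [/eqP->|/andP[]].
rewrite in_setU1 in_nbhd in_setU1 in_setI euw andbT; case: eqVneq => //= wm.
have := closedJ uJ wF euw; rewrite in_setU1 => /orP[->//|wJ].
have -> : w \in lobe_core by apply: lobe_core_closed euw wm.
by case/orP: wyK => [/eqP wy|/andP[_ ->]]; [move: yJ; rewrite -wy wJ | rewrite orbT].
Qed.

Lemma lobe_core_marked u J' : u \in lobe_core -> lobe e lobe_core u J' -> v \notin J' ->
  J' :&: K != set0 -> J' :&: nbhd e lobe_core m != set0.
Proof.
move=> uC /lobeP[sJ' cJ' closedJ'] vJ'; apply: contra => /eqP noM.
have sJ'C z : z \in J' -> z \in lobe_core by move=> /(subsetP sJ')/setD1P[].
have mJ' : m \notin J'.
  by apply/negP => /sJ'C /(subsetP lobe_core_sub); rewrite in_setD1 eqxx.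
apply/eqP/(no_smaller_lobe (subsetP lobe_core_sub_lobe u uC)) => //.
apply/lobeP; split=> //.
  by apply: subset_trans sJ' _; apply: setSD lobe_core_sub_lobe.
move=> x w xJ' wF exw; have wm : w != m.
  apply/eqP => wm; have /setP/(_ x) := noM.
  by rewrite in_setI xJ' inE sJ'C //= -wm es exw in_set0.
have xv : x != v by apply: contraNneq vJ' => <-.
have wF' : w \in F by move: wF; rewrite in_setU1 => /orP[/eqP->|/(subsetP sJF)].
by apply: (closedJ' x) => //; apply: lobe_core_closed exw wm => //; apply: sJ'C.
Qed.

Lemma single_kernel_degree : J :&: K = [set m] -> d <= 1.
Proof.
move=> EJK; have /setIP[_ mK] : m \in J :&: K by rewrite EJK set11.
have mFK : m \in F :&: K by rewrite in_setI mK (subsetP sJF).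
have my : m != y by apply: contraNneq yJ => <-.
apply: leq_trans (deg mFK my) _; rewrite -(cards1 v); apply: subset_leq_card.
apply/subsetP => w; rewrite in_nbhd in_setU1 in_setI => /andP[wyK emw].
have wF : w \in F by case/orP: wyK => [/eqP->|/andP[]].
have := closedJ mJ wF emw; rewrite in_setU1 in_set1 => /orP[//|wJ].
case/orP: wyK => [/eqP wy|/andP[_ wK]]; first by move: yJ; rewrite -wy wJ.
have /set1P wm : w \in [set m] by rewrite -EJK in_setI wJ.
by rewrite wm ei in emw.
Qed.

End LobeCore.

(* The Erdos-Gallai argument: walk from a mark into a minimal lobe, delete the current vertex, and
   continue towards the cut vertex of the lobe. Vertices outside K only serve as connectors. *)
Theorem rooted_long_upath K d F M y :
  y \in F -> connected_on e F -> (exists2 k, k \in F :&: K & k != y) ->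
  (forall u, u \in F :&: K -> u != y -> d <= #|nbhd e (y |: (F :&: K)) u|) ->
  (forall u J, u \in F -> lobe e F u J -> y \notin J -> J :&: K != set0 -> J :&: M != set0) ->
  exists2 m, m \in M & long_upath e F m y d.+1.
Proof.
have [n] := ubnP #|F|; elim: n F M y d => // n IH F M y d; rewrite ltnS => Fn.
move=> yF cF [k kK ky] deg mark.
have [v [J minJ]] := minimal_lobe_exists yF kK ky; have [vF lJ yJ JK _] := minJ.
have /set0Pn[m /setIP[mJ mM]] := mark v J vF lJ yJ JK; exists m => //.
have vJ := lobe_notin lJ; have [j jJ evj] := lobe_attached es cF vF lJ mJ.
have /lobeP[/subset_trans/(_ (subD1set _ _)) sJF cJ _] := lJ.
suff lobe_upath : long_upath e (v |: J) m v d.+1.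
  have meet_v : (v |: J) :&: (F :\: J) \subset [set v].
    by apply/subsetP => z; rewrite !inE; case: eqP => //= _ /and3P[zJ]; rewrite zJ.
  have L := long_upath_join lobe_upath (lobe_avoiding_path cF vF yF lJ yJ) meet_v isT.
  by apply: long_upathW L; rewrite ?addn1 // !subUset subsetDl sJF sub1set vF.
have [k' /andP[k'JK k'm]|none] := pickP [pred k | (k \in J :&: K) && (k != m)]; last first.
  have EJK : J :&: K = [set m].
    have single z : z \in J :&: K -> z = m.
      by move=> zJK; have := none z; rewrite /= zJK => /negbFE/eqP.
    case/set0Pn: JK => z zJK; apply/setP => w; rewrite in_set1.
    by apply/idP/eqP => [/single|->] //; rewrite -(single z zJK).
  apply: (@long_upathW _ _ (v |: J) _ _ _ 2) => //.
    by rewrite ltnS (single_kernel_degree minJ yF mJ deg EJK).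
  apply: connected_on_upath2; rewrite ?setU11 ?setU1r //; first exact: connected_onU1 cJ jJ evj.
  by apply: contraNneq vJ => <-.
have [||||w /[!inE] /andP[wC emw] Lw] :=
    IH (lobe_core J v m) (nbhd e (lobe_core J v m) m) v d.-1 _
       (mem_lobe_core minJ mJ) (lobe_core_connected minJ mJ).
- exact: leq_trans (lobe_core_proper minJ mJ) Fn.
- exists k'; last by apply: contraNneq vJ => <-; case/setIP: k'JK.
  by rewrite in_setI (mem_lobe_core_kernel minJ mJ k'JK k'm); case/setIP: k'JK.
- exact: (lobe_core_degree minJ yF deg).
- exact: (lobe_core_marked minJ mJ).
apply: long_upathW (long_upath_cat (long_upath_refl e (set11 m)) Lw emw _).
- by rewrite subUset sub1set setU1r ?lobe_core_sub_lobe.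
- by rewrite add1n ltnS leqSpred.
- by rewrite disjoints1; apply/negP => /(subsetP (lobe_core_sub _ _ _)); rewrite in_setD1 eqxx.
Qed.

End RootedPaths.

(** * Counting *)

Section PairCounting.
Import Order.TTheory GRing.Theory Num.Theory.
Local Open Scope ring_scope.
Variables (I U : finType) (J : {set I}) (Z : {set U}).

Lemma sum_card_div_mult_le (A : I -> {set U}) (b : I -> nat) :
  (forall i, i \in J -> A i \subset Z) ->
  (forall i u, i \in J -> u \in A i -> (#|[set j in J | u \in A j]| <= b i)%N) ->
  \sum_(i in J) (#|A i|%:R / (b i)%:R : rat) <= #|Z|%:R.
Proof.
move=> sA mult_le; pose mult u : rat := #|[set j in J | u \in A j]|%:R.
apply: (@le_trans _ _ (\sum_(i in J) \sum_(u in A i) (mult u)^-1)).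
  apply: ler_sum => i iJ; rewrite mulr_natl -sumr_const; apply: ler_sum => u uA.
  have mult_gt0 : (0 < #|[set j in J | u \in A j]|)%N.
    by apply/card_gt0P; exists i; rewrite inE iJ.
  have le_b := mult_le i u iJ uA.
  by rewrite lef_pV2 ?posrE ?ltr0n ?ler_nat //; apply: leq_trans le_b.
rewrite (exchange_big_dep (mem Z)) /=; last by move=> i u iJ; apply: (subsetP (sA i iJ)).
rewrite -[X in _ <= X%:R](sum1_card (mem Z)) natr_sum; apply: ler_sum => u uZ.
rewrite sumr_const -[X in X <= _]mulr_natl.
have -> : #|[pred i | (i \in J) && (u \in A i)]| = #|[set j in J | u \in A j]|.
  by apply: eq_card => j; rewrite !inE.
rewrite -/(mult u) /=; have [->|mult_neq0] := eqVneq (mult u) 0.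
  by rewrite mul0r ler01.
by rewrite divff.
Qed.

Lemma add_inv_ratio_ge2 (a b : rat) : 0 < a -> 0 < b -> 2%:R <= a / b + b / a.
Proof.
move=> a0 b0; have -> : a / b + b / a = 2%:R + (a - b) ^+ 2 / (a * b).
  by field; rewrite !gt_eqF.
by rewrite lerDl divr_ge0 ?sqr_ge0 // mulr_ge0 // ltW.
Qed.

(* Weighting the points of A i by 1/#|B i| and those of B i by 1/#|A i|, each index gets weight at
   least 2 while no point of Z gets more than 2. *)
Lemma card_pairs_le (A B : I -> {set U}) :
  (forall i, i \in J -> [/\ A i \subset Z, B i \subset Z, A i != set0 & B i != set0]) ->
  (forall i u, i \in J -> u \in A i -> (#|[set j in J | u \in A j]| <= #|B i|)%N) ->
  (forall i u, i \in J -> u \in B i -> (#|[set j in J | u \in B j]| <= #|A i|)%N) ->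
  (#|J| <= #|Z|)%N.
Proof.
move=> sAB multA multB.
have sumA := @sum_card_div_mult_le A _ (fun i iJ => let: And4 sA _ _ _ := sAB i iJ in sA) multA.
have sumB := @sum_card_div_mult_le B _ (fun i iJ => let: And4 _ sB _ _ := sAB i iJ in sB) multB.
suff : (#|J| * 2)%:R <= #|Z|%:R + #|Z|%:R :> rat.
  by rewrite -natrD ler_nat addnn -muln2 leq_pmul2r.
apply: le_trans (lerD sumA sumB); rewrite -big_split mulnC natrM mulr_natr -sumr_const /=.
apply: ler_sum => i /sAB[_ _ A0 B0].
by apply: add_inv_ratio_ge2; rewrite ltr0n card_gt0.
Qed.

End PairCounting.

Section Spacing.
Variable T : finType.
Implicit Types (N : {set T}) (pos : T -> nat).

Definition spaced N pos :=
  forall n n', n \in N -> n' \in N -> n != n' -> pos n <= pos n' -> (pos n).+1 < pos n'.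

Lemma spacedS N N' pos : N' \subset N -> spaced N pos -> spaced N' pos.
Proof. by move=> /subsetP sN sp n n' nN n'N; apply: sp; apply: sN. Qed.

Lemma spaced_inj N pos : spaced N pos -> {in N &, injective pos}.
Proof.
move=> sp n n' nN n'N E; apply/eqP; apply: contraT => nn'.
by have := sp n n' nN n'N nn'; rewrite E leqnn ltnNge leqnSn => /(_ isT).
Qed.

(* Each position pos n also blocks pos n + 1. *)
Lemma card_spaced_le N pos lo hi :
  spaced N pos -> {in N, forall n, lo <= pos n <= hi} -> 2 * #|N| <= hi.+2 - lo.
Proof.
move=> sp bounds; have pos_inj := spaced_inj sp.
pose s := [seq pos n | n <- enum N] ++ [seq (pos n).+1 | n <- enum N].
have us : uniq s.
  rewrite cat_uniq map_inj_in_uniq ?enum_uniq /=; last first.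
    by move=> n n'; rewrite !mem_enum; apply: pos_inj.
  rewrite map_inj_in_uniq ?enum_uniq ?andbT; last first.
    by move=> n n'; rewrite !mem_enum => nN n'N [] /pos_inj; apply.
  apply/hasPn => _ /mapP[n + ->]; rewrite mem_enum => nN.
  apply/negP => /mapP[n' + E]; rewrite mem_enum => n'N.
  have nn' : n != n' by apply: contra_eqN E => /eqP->; rewrite neq_ltn ltnSn orbT.
  by have := sp n n' nN n'N nn'; rewrite -E leqnSn ltnn => /(_ isT).
have <- : size s = 2 * #|N| by rewrite size_cat !size_map -cardE mul2n addnn.
rewrite -(size_iota lo (hi.+2 - lo)); apply: uniq_leq_size => // k.
by rewrite mem_cat => /orP[] /mapP[n]; rewrite mem_enum => /bounds; rewrite mem_iota; lia.
Qed.

End Spacing.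

Section CyclicSums.
Variables (T : eqType) (att : pred T) (w : T -> nat) (r : nat).
Implicit Types (a b : T) (c l s pre post : seq T).

Lemma linear_sum_gap_le z l a s : att z -> att a -> all (predC att) s ->
  (forall pre b t b' post, a :: s ++ rcons l z = pre ++ b :: t ++ b' :: post ->
     att b -> all (predC att) t -> att b' -> w b + w b' <= r * (size t).+1) ->
  2 * (\sum_(b <- l | att b) w b) + w a + w z <= r * (size s + size l).+1.
Proof.
move=> az; elim: l a s => [|b l IH] a s aa fs gap_le; rewrite ?big_nil ?big_cons.
  by rewrite muln0 add0n addn0; apply: (gap_le [::] a s z [::]); rewrite ?cats1.
case: (boolP (att b)) => ab; last first.
  rewrite /= addnS -addSn -(size_rcons s b); apply: IH; rewrite ?all_rcons ?fs ?andbT //.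
  by move=> pre b1 t b2 post E; apply: (gap_le pre b1 t b2 post); rewrite -E cat_rcons.
have gap_ab : w a + w b <= r * (size s).+1 by apply: (gap_le [::] a s b (rcons l z)).
have := IH b [::] ab isT; rewrite /= add0n => /(_ _) rest_le.
have {}rest_le : 2 * (\sum_(b <- l | att b) w b) + w b + w z <= r * (size l).+1.
  apply: rest_le => pre b1 t b2 post E; apply: (gap_le (a :: s ++ pre) b1 t b2 post).
  by rewrite rcons_cons E cat_cons catA.
by move: gap_ab rest_le; move: (\sum_(_ <- _ | _) _); lia.
Qed.

(* Summing w over the two ends of each gap counts every marked point twice. *)
Lemma cyclic_sum_gap_le c :
  (forall j a s rest, rot j c = (a :: s) ++ rest -> att a -> all (predC att) s ->
     att (head a rest) -> w a + w (head a rest) <= r * (size s).+1) ->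
  2 * \sum_(a <- c | att a) w a <= r * size c.
Proof.
move=> gap_le; have [/hasP[z zc az]|noc] := boolP (has att c); last by rewrite big_hasC.
have [i l E] := rot_to zc.
rewrite -(size_rot i c) (perm_big (rot i c)) /=; last by rewrite perm_sym perm_rot.
rewrite E big_cons az mulnDr addnC [2 * w z]mul2n -addnn addnA.
apply: (@linear_sum_gap_le z l z [::]) => // pre b t b' post El ab ft ab'.
have rotE k l1 l2 : rot k c = l1 ++ l2 -> exists k', rot k' c = l2 ++ l1.
  by move=> Ek; have := rot_size_cat l1 l2; rewrite -Ek rot_rot_add => <-; eexists.
case/lastP: post El => [|post z'] El.
  have [Ez Eb] : rot i c = pre ++ b :: t /\ b' = z.
    suff /rcons_inj[<- <-] : rcons (z :: l) z = rcons (pre ++ b :: t) b' by rewrite E.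
    by rewrite -[RHS]cats1 -catA -El.
  have [k Ek] := rotE _ _ _ Ez; subst b'.
  have Eh : head b pre = z by move: Ez; rewrite E; case: (pre) => [|? ?] [].
  by rewrite -{1}Eh; apply: gap_le Ek _ _ _; rewrite ?Eh.
have Ez : rot i c = pre ++ b :: t ++ b' :: post.
  suff /rcons_inj[<- _] : rcons (z :: l) z = rcons (pre ++ b :: t ++ b' :: post) z' by rewrite E.
  by rewrite rcons_cat /= rcons_cat -El.
have [k Ek] := rotE _ _ _ Ez; apply: (gap_le k b t (b' :: post ++ pre)) => //.
by rewrite Ek /= -!catA.
Qed.

End CyclicSums.

(** * Branches attached to a longest cycle *)

Section NextInSequence.
Variable T : eqType.
Implicit Types (c x y z : T) (p r s : seq T).

Lemma rot_cat_swap s s1 s2 i : rot i s = s1 ++ s2 -> exists j, rot j s = s2 ++ s1.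
Proof. by move=> E; have := rot_size_cat s1 s2; rewrite -E rot_rot_add => <-; eexists. Qed.

Lemma next_split x p1 c p2 : uniq (x :: p1 ++ c :: p2) ->
  next (x :: p1 ++ c :: p2) (last x p1) = c.
Proof.
rewrite -cat_cons cat_uniq => /andP[up1 _].
have index_p1 : index (last x p1) ((x :: p1) ++ c :: p2) = size p1.
  by rewrite index_cat mem_last index_last.
by rewrite next_nth index_p1 mem_cat mem_last /= nth_cat ltnn subnn.
Qed.

Lemma next_in_arc s i x t y r z :
  uniq s -> rot i s = x :: t ++ y :: r -> z \in y :: r -> next s z \in rcons r x.
Proof.
move=> us E zr; have /hasPn/(_ z zr) zt : ~~ has [in x :: t] (y :: r).
  by move: us; rewrite -(rot_uniq i) E -cat_cons cat_uniq => /and3P[].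
have index_r : index z (x :: t ++ y :: r) = (size t + (index z (y :: r)).+1)%N.
  by rewrite -cat_cons index_cat (negbTE zt) addnS.
rewrite -(next_rot i us) E next_nth index_r in_cons mem_cat zr !orbT.
move: (index z (y :: r)) => k; rewrite /= nth_cat ltnNge leq_addr addKn /=.
rewrite mem_rcons in_cons; case: (ltnP k (size r)) => kr; first by rewrite mem_nth ?orbT.
by rewrite nth_default ?eqxx.
Qed.

Lemma rot_to_next s z : 1 < size s -> uniq s -> z \in s ->
  exists i r, rot i s = [:: z, next s z & r].
Proof.
move=> s1 us zs; have [i [|y r] E] := rot_to zs; first by rewrite -(size_rot i) E in s1.
by exists i, r; rewrite -(next_rot i us) E /= eqxx.
Qed.

End NextInSequence.

Section LongestCycles.
Variables (T : finType) (e : rel T).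
Hypothesis es : symmetric e.
Implicit Types (A B X Y : {set T}) (a x y z : T) (c d p q r s : seq T).

(* [cycle_seq (@adj G)] is [is_cycle] for the adjacency relation of a graph G. *)
Definition cycle_seq c := [&& 0 < size c, uniq c & (size c == 1) || cycle e c].

Definition longest_cycle_in A c := [/\ cycle_seq c, {subset c <= A} &
  forall d, cycle_seq d -> {subset d <= A} -> size d <= size c].

Lemma cycle_seq_uniq c : cycle_seq c -> uniq c.
Proof. by case/and3P. Qed.

Lemma cycle_seq_cycle c : 1 < size c -> cycle_seq c -> cycle e c.
Proof. by move=> c1 /and3P[_ _ /orP[/eqP E|//]]; rewrite E in c1. Qed.

Lemma upath_cycle_seq A x q y :
  upath e A x q y -> e y x -> cycle_seq (x :: q) /\ {subset x :: q <= A}.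
Proof.
case/and4P=> pq uq /allP qA /eqP lq eyx; split=> //.
by rewrite /cycle_seq uq /= rcons_path pq lq eyx orbT.
Qed.

Lemma longest_cycle_gap A C j a s rest B z z' n :
  longest_cycle_in A C -> rot j C = (a :: s) ++ rest -> B \subset A ->
  B \subset ~: [set z in C] -> long_upath e B z z' n -> e a z -> e z' (head a rest) ->
  n <= size s.
Proof.
move=> [cC sCA maxC] E /subsetP sBA /subsetP sBC [q /and4P[pq uq qB /eqP lq] nq] eaz ez'.
apply: leq_trans nq _; have sizeC : size C = size s + (size rest).+1.
  by rewrite -(size_rot j) E size_cat /= addSnnS.
have memC y : y \in (a :: s) ++ rest -> y \in C by rewrite -E mem_rot.
have qC y : y \in z :: q -> y \notin C by move=> /(allP qB)/sBC; rewrite !inE.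
have aR y : y \in a :: rest -> y \in (a :: s) ++ rest.
  by rewrite mem_cat !in_cons => /orP[->|->]; rewrite ?orbT.
suff: size ((a :: z :: q) ++ rest) <= size C by rewrite sizeC size_cat /=; lia.
apply: maxC => [|y]; last first.
  rewrite mem_cat in_cons orbAC -in_cons => /orP[/aR/memC/sCA //|/(allP qB)/sBA //].
have uC : uniq ((a :: s) ++ rest) by rewrite -E rot_uniq cycle_seq_uniq.
apply/and3P; split=> //.
  rewrite cat_cons cons_uniq cat_uniq uq mem_cat negb_or -!andbA; apply/and5P; split=> //.
  - by apply: contraL (mem_head a rest) => /qC; apply: contra => /aR/memC.
  - by move: uC; rewrite cat_cons cons_uniq mem_cat negb_or => /andP[/andP[]].
  - apply/hasPn => y yr; apply: contraL (memC y _) => [/qC //|].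
    by apply: aR; rewrite in_cons yr orbT.
  - by move: uC; rewrite cat_uniq => /and3P[].
rewrite /= eaz rcons_cat cat_path pq lq /=.
case: rest ez' E sizeC {memC aR uC} => [|b rest] /= ez' E sizeC; first by rewrite ez'.
have C1 : 1 < size C by rewrite sizeC; lia.
have := cycle_seq_cycle C1 cC; rewrite -(rot_cycle j) E /= rcons_cat cat_path /=.
by rewrite ez' => /and3P[].
Qed.

Lemma longest_cycle_gap_via A C j a s rest M X X' u u' n :
  longest_cycle_in A C -> rot j C = (a :: s) ++ rest ->
  connected_on e X -> connected_on e X' -> u \in X -> u' \in X' ->
  X :&: M \subset [set u] -> X' :&: M \subset [set u'] -> X :&: X' = set0 ->
  X :|: M :|: X' \subset A -> X :|: M :|: X' \subset ~: [set z in C] ->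
  long_upath e M u u' n -> 0 < n ->
  a \in nbrs e [set z in C] X -> head a rest \in nbrs e [set z in C] X' -> n <= size s.
Proof.
move=> lC E cX cX' uX uX' XM XM' dX sA sC L n0 /nbrsP[_ [z zX eza]] /nbrsP[_ [z' zX' ez'a]].
have to_u := long_upath_join (connected_on_upath cX zX uX) L XM isT.
have meet_u' : (X :|: M) :&: X' \subset [set u'].
  by rewrite setIUl dX set0U setIC.
have to_end := long_upath_join to_u (connected_on_upath cX' uX' zX') meet_u' n0.
apply: (longest_cycle_gap lC E sA sC _ _ ez'a); last by rewrite es; exact: eza.
by apply: long_upathW to_end; rewrite // addn1.
Qed.

End LongestCycles.

Section Arcs.
Variables (T : finType) (e : rel T) (H : seq T).
Hypotheses (es : symmetric e) (uH : uniq H) (cH : cycle e H).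
Implicit Types (x y z : T) (r s : seq T).

Lemma long_upath_arc j x s y r :
  rot j H = x :: s ++ y :: r -> long_upath e [set z in H] y x (size H - size s).
Proof.
move=> E; have ur : uniq (x :: s ++ y :: r) by rewrite -E rot_uniq.
have cr : cycle e (x :: s ++ y :: r) by rewrite -E rot_cycle.
have sizeH : size H = (size s + (size r).+1).+1 by rewrite -(size_rot j) E /= size_cat.
exists (rcons r x); last by rewrite size_rcons sizeH; lia.
apply/and4P; split; last by rewrite last_rcons.
- by move: cr; rewrite /= rcons_cat cat_path => /= /and3P[].
- rewrite -rcons_cons rcons_uniq.
  move: ur; rewrite cons_uniq mem_cat negb_or cat_uniq.
  by case/andP=> /andP[_ ->] /and3P[].
- apply/allP => z; rewrite -rcons_cons mem_rcons => zr; rewrite inE -(mem_rot j) E.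
  by move: zr; rewrite !inE mem_cat !inE => /or3P[] ->; rewrite ?orbT.
Qed.

Lemma arc_between x y : x \in H -> y \in H -> x != y -> exists j s r, rot j H = x :: s ++ y :: r.
Proof.
move=> xH yH nxy; have [j t E] := rot_to xH.
have yt : y \in t by move: yH; rewrite -(mem_rot j) E in_cons eq_sym (negbTE nxy).
by case/splitPr: yt E => s r E; exists j, s, r.
Qed.

Lemma long_upath_half x y : x \in H -> y \in H -> x != y ->
  long_upath e [set z in H] x y (size H)./2.+1.
Proof.
move=> xH yH nxy; have [j [s [r E]]] := arc_between xH yH nxy.
have sizeH : size H = (size s + (size r).+1).+1 by rewrite -(size_rot j) E /= size_cat.
have [i E'] := rot_cat_swap (s1 := x :: s) (s2 := y :: r) E.
have Lxy := long_upath_sym es (long_upath_arc E); have Lyx := long_upath_arc E'.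
by case: (leqP (size s) (size r)) => le; [apply: long_upathW Lxy|apply: long_upathW Lyx] => //; lia.
Qed.

Section TwoSets.
Variables X Y : {set T}.
Hypotheses (sX : X \subset H) (sY : Y \subset H).

Let joins x y := (x \in X) && (y \in Y) || (x \in Y) && (y \in X).

Let joins_split x y z : joins x y -> z \in X :|: Y -> joins x z || joins z y.
Proof.
by rewrite /joins inE => /orP[/andP[-> ->]|/andP[-> ->]] /orP[->|->]; rewrite ?orbT.
Qed.

Lemma tight_arc j x s y r : rot j H = x :: s ++ y :: r -> joins x y ->
  exists i x' s' y' r', [/\ rot i H = x' :: s' ++ y' :: r', joins x' y' &
    {in s', forall z, z \notin X :|: Y}].
Proof.
have [n] := ubnP (size s); elim: n j x s y r => // n IH j x s y r; rewrite ltnS => sn E jxy.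
have [/hasP[z zs zXY]|none] := boolP (has [in X :|: Y] s); last first.
  by exists j, x, s, y, r; split=> // z zs; apply: (hasPn none).
case/splitPr: zs E sn => s1 s2 E; rewrite size_cat /= => sn.
case/orP: (joins_split jxy zXY) => [jxz|jzy].
  apply: (IH j x s1 z (s2 ++ y :: r)) => //; first by lia.
  by rewrite E -catA.
have [|k Ek] := @rot_cat_swap _ H (x :: s1) (z :: s2 ++ y :: r) j; first by rewrite E /= -catA.
apply: (IH k z s2 y (r ++ x :: s1)) => //; first by lia.
by rewrite Ek /= -catA.
Qed.

(* The successor of a point of X :&: Y lies outside X :|: Y and, but for that of x, off s. *)
Lemma card_tight_arc j x s y r :
  rot j H = x :: s ++ y :: r -> {in s, forall z, z \notin X :|: Y} ->
  {in H, forall z, ~~ joins z (next H z)} -> #|X| + #|Y| - 1 <= size H - size s.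
Proof.
move=> E free_s no_joins; have sizeH : size H = (size s + (size r).+1).+1.
  by rewrite -(size_rot j) E /= size_cat.
have ur : uniq (x :: s ++ y :: r) by rewrite -E rot_uniq.
have memH z : (z \in H) = (z \in x :: s ++ y :: r) by rewrite -E mem_rot.
pose D := (X :&: Y) :\ x.
have inR z : z \in X :|: Y -> z \in x :: y :: r.
  move=> zXY; have : z \in H by move: zXY; rewrite inE => /orP[/(subsetP sX)|/(subsetP sY)].
  rewrite memH in_cons mem_cat [z \in [:: x, y & r]]in_cons.
  by case/or3P=> [->//|/free_s|->]; rewrite ?zXY ?orbT.
have sub : (X :|: Y) :|: next H @: D \subset [set z in x :: y :: r].
  apply/subsetP => t /setUP[/inR|/imsetP[z /setD1P[zx zXY] ->]]; rewrite inE //.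
  have zR : z \in y :: r.
    have := inR z; rewrite in_cons (negbTE zx) /= => -> //.
    by move: zXY; rewrite !inE => /andP[->].
  by have := next_in_arc uH E zR; rewrite mem_rcons !in_cons => /orP[->|->]; rewrite ?orbT.
have dis : (X :|: Y) :&: next H @: D = set0.
  apply/setP => t; rewrite in_set0 in_setI; apply/negP => /andP[tXY /imsetP[z zD Et]].
  move: zD; rewrite !inE => /and3P[_ zX zY].
  have := no_joins z (subsetP sX z zX); rewrite -Et /joins zX zY /= orbC.
  by move: tXY; rewrite inE => ->.
have := subset_leq_card sub; rewrite cardsU_disjoint // card_imset; last first.
  exact: can_inj (prev_next uH).
rewrite card_set_seq; last first.
  move: ur; rewrite cons_uniq mem_cat negb_or cat_uniq.
  by case/andP=> /andP[_ xr] /and3P[_ _ uyr]; rewrite cons_uniq xr.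
have := cardsUI X Y; have := cardsD1 x (X :&: Y).
by rewrite sizeH -/D /=; case: (_ \in _); lia.
Qed.

Lemma long_arc : (exists x y, [/\ x \in X, y \in Y & x != y]) ->
  exists x y, [/\ x \in X, y \in Y, x != y &
    long_upath e [set z in H] x y (minn (size H) (#|X| + #|Y| - 1))].
Proof.
move=> [x0 [y0 [x0X y0Y n0]]].
have [j0 [s0 [r0 E0]]] := arc_between (subsetP sX x0 x0X) (subsetP sY y0 y0Y) n0.
have size_gt1 : 1 < size H by rewrite -(size_rot j0) E0 /= size_cat /= addnS.
suff [j [x [s [y [r [E jxy le_s]]]]]] : exists j x s y r, [/\ rot j H = x :: s ++ y :: r,
    joins x y & minn (size H) (#|X| + #|Y| - 1) <= size H - size s].
  have nxy : x != y.
    have : uniq (rot j H) by rewrite rot_uniq.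
    by rewrite E; apply: contraTneq => ->; rewrite /= mem_cat mem_head orbT.
  have L := long_upathW (subxx _) le_s (long_upath_arc E).
  case/orP: jxy => /andP[xXY yXY]; first by exists x, y; split=> //; apply: long_upath_sym.
  by exists y, x; split; rewrite // eq_sym.
have [/hasP[z zH jz]|none] := boolP (has (fun z => joins z (next H z)) H).
  have [i [r E]] := rot_to_next size_gt1 uH zH.
  by exists i, z, [::], (next H z), r; rewrite subn0 geq_minl.
have j0xy : joins x0 y0 by rewrite /joins x0X y0Y.
have [j [x [s [y [r [E jxy free_s]]]]]] := tight_arc E0 j0xy.
exists j, x, s, y, r; split=> //; apply: leq_trans (geq_minr _ _) _.
by apply: card_tight_arc E free_s _ => z; apply: (hasPn none).
Qed.

End TwoSets.
End Arcs.

Section Branches.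
Variables (T : finType) (e : rel T).
Hypothesis es : symmetric e.
Variables (C H : seq T) (I : {set T}) (br : T -> {set T}).
Implicit Types (a u v z : T) (s rest : seq T).

Let nbrsC u := nbrs e [set z in C] (br u).

Definition branches := {in I, forall u, [/\ connected_on e (br u), u \in br u,
  br u :&: [set z in H] \subset [set u] & br u \subset ~: [set z in C]]} /\ disjoint_on I br.

Definition attached a := [set u in I | a \in nbrsC u].

Lemma attachedP a u : reflect (u \in I /\ a \in nbrsC u) (u \in attached a).
Proof. by rewrite [u \in attached a]inE; apply: andP. Qed.

Lemma sum_card_attached :
  uniq C -> \sum_(a <- C) #|attached a| = \sum_(u in I) #|nbrsC u|.
Proof.
move=> uC; rewrite big_uniq //=.
under eq_bigr => a _ do rewrite -sum1dep_card big_mkcondr /=.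
rewrite exchange_big /=; apply: eq_bigr => u uI; rewrite -big_mkcondr /= sum1dep_card.
apply: eq_card => a; rewrite inE; apply/andP/idP => [[]//|aN]; split=> //.
by have /nbrsP[] := aN; rewrite inE.
Qed.

Hypotheses (lC : longest_cycle_in e setT C) (cH : cycle_seq e H).
Hypotheses (sIH : I \subset H) (sHC : [set z in H] \subset ~: [set z in C]).
Hypothesis brs : branches.

Lemma attached_segment_bound j a s rest : rot j C = (a :: s) ++ rest ->
  attached a != set0 -> attached (head a rest) != set0 ->
  #|attached a| + #|attached (head a rest)| <= (size s).+1 \/ size H < (size s).+1.
Proof.
move=> E; set a' := head a rest; have [brP brD] := brs.
have sH b : attached b \subset H by apply/subsetP => u /attachedP[/(subsetP sIH)].
have [/existsP[x /existsP[y /and3P[xa ya' nxy]]]|none] :=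
    boolP [exists x, exists y, [&& x \in attached a, y \in attached a' & x != y]].
  move=> a0 a'0; have H_gt1 : 1 < size H.
    have := subsetP (sH a') y ya'; have := subsetP (sH a) x xa.
    case: (H) => [|h [|h' H']] //=; rewrite !inE => /eqP xh /eqP yh.
    by rewrite xh yh eqxx in nxy.
  have [|u [v [/attachedP[uI ua] /attachedP[vI va'] nuv L]]] :=
      long_arc es (cycle_seq_uniq cH) (cycle_seq_cycle H_gt1 cH) (sH a) (sH a').
    by exists x, y.
  have [cu uu uH uC] := brP u uI; have [cv vv vH vC] := brP v vI.
  have : minn (size H) (#|attached a| + #|attached a'| - 1) <= size s.
    apply: (longest_cycle_gap_via es lC E cu cv uu vv uH vH) L _ ua va'.
    - exact: (disjoint_onI brD uI vI nuv).
    - exact: subsetT.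
    - by rewrite !subUset uC sHC vC.
    - by rewrite leq_min (ltnW H_gt1) subn_gt0 (@leq_add 1 1) ?card_gt0.
  by rewrite geq_min leq_subLR => /orP[]; [right | left].
case/set0Pn=> u ua /set0Pn[v va']; left.
have same x y : x \in attached a -> y \in attached a' -> x = y.
  move=> xa ya'; apply/eqP; apply: contraNT none => nxy.
  by apply/existsP; exists x; apply/existsP; exists y; rewrite xa ya'.
have card_a : #|attached a| <= 1.
  by apply/card_le1_eqP => x y /same xa /same ya; rewrite (xa v) // (ya v).
have card_a' : #|attached a'| <= 1.
  by apply/card_le1_eqP => x y xa' ya'; rewrite -(same u x) // -(same u y).
suff s_gt0 : 0 < size s by apply: leq_trans (leq_add card_a card_a') _.
have Euv := same u v ua va'; subst v.
have /attachedP[uI /nbrsP[_ [z zu eza]]] := ua.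
have /attachedP[_ /nbrsP[_ [z' z'u ez'a]]] := va'.
have [cu _ _ uC] := brP u uI.
by apply: longest_cycle_gap lC E (subsetT _) uC (connected_on_upath cu zu z'u) _ ez'a; rewrite es.
Qed.

Lemma branch_bound R : 2 * #|I| <= R -> size H < R ->
  2 * (size H).+1 * \sum_(u in I) #|nbrsC u| <= R * size C.
Proof.
move=> IR HR; have [cC _ _] := lC; pose w a := (size H).+1 * #|attached a|.
rewrite -(sum_card_attached (cycle_seq_uniq cC)).
have -> : 2 * (size H).+1 * \sum_(a <- C) #|attached a| =
          2 * \sum_(a <- C | attached a != set0) w a.
  rewrite -mulnA -big_distrr /=; congr (_ * (_ * _)).
  rewrite [RHS]big_mkcond /=; apply: eq_bigr => a _.
  by case: eqVneq => [->|//]; rewrite cards0.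
apply: cyclic_sum_gap_le => j a s rest E a0 _ a'0; rewrite /w -mulnDr.
have [short|long] := attached_segment_bound E a0 a'0; first exact: leq_mul HR short.
rewrite mulnC; apply: leq_mul long; apply: leq_trans IR; rewrite mul2n -addnn.
by apply: leq_add; apply: subset_leq_card; apply/subsetP => u /attachedP[].
Qed.

End Branches.

(** * Rerouting a longest path *)

Section Reroute.
Variables (T : finType) (e : rel T) (W : {set T}) (x : T) (p : seq T).
Hypotheses (es : symmetric e) (longest_p : longest_upath e W x p (last x p)).
Implicit Types (c u z : T) (m q : seq T).

Let up : upath e W x p (last x p). Proof. by case: longest_p. Qed.

Lemma no_longer_splice p1 m m' c p2 : p = p1 ++ m ++ c :: p2 ->
  size m < size m' -> uniq m' -> all [in W] m' ->
  {in m', forall z, z \notin m -> z \notin x :: p} ->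
  path e (last x p1) (m' ++ c :: p2) -> False.
Proof.
move=> Ep sz um' m'W new pm'; have /and4P[pp uxp pW _] := up.
have : size (p1 ++ m' ++ c :: p2) <= size p.
  case: longest_p => _; apply; apply/and4P; split.
  - by rewrite cat_path pm' andbT; move: pp; rewrite Ep cat_path => /andP[].
  - move: uxp; rewrite Ep -!cat_cons 2!cat_uniq => /and3P[up1 fresh1 /and3P[_ fresh2 up2]].
    rewrite 2!cat_uniq up1 um' up2 andbT !andTb; apply/andP; split; last first.
      apply/hasPn => z zp2; apply/negP => zm'; have := new z zm' (hasPn fresh2 z zp2).
      by rewrite Ep in_cons !mem_cat zp2 !orbT.
    apply/hasPn => z; rewrite mem_cat => /orP[zm'|zp2]; last first.
      by apply: (hasPn fresh1); rewrite mem_cat zp2 orbT.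
    have [zm|/(new z zm')] := boolP (z \in m); first by apply: (hasPn fresh1); rewrite mem_cat zm.
    by rewrite Ep -cat_cons mem_cat negb_or => /andP[].
  - by move: pW; rewrite Ep -!cat_cons !all_cat m'W => /and3P[-> _ ->].
  - by rewrite Ep !last_cat.
by rewrite Ep !size_cat leq_add2l leq_add2r leqNgt sz.
Qed.

Lemma notin_belast_last : last x p \notin belast x p.
Proof. by have /and4P[_ + _ _] := up; rewrite lastI rcons_uniq => /andP[]. Qed.

Lemma split_before_next z : z \in belast x p ->
  exists p1 p2, p = p1 ++ next (x :: p) z :: p2 /\ last x p1 = z.
Proof.
move=> zb; have /and4P[_ uxp _ _] := up.
have := mem_belast zb; case/splitPl Ep: {2}p / => [p1 p2 lz]; case: p2 Ep => [|c p2] Ep.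
  by have := notin_belast_last; rewrite {1}Ep cats0 lz zb.
by exists p1, p2; split=> //; rewrite Ep -lz next_split // -Ep.
Qed.

Definition in_order z z' := exists p1 m p2,
  [/\ p = p1 ++ (next (x :: p) z :: m) ++ next (x :: p) z' :: p2, last x p1 = z &
      last (next (x :: p) z) m = z'].

Lemma in_order_total z z' : z \in belast x p -> z' \in belast x p -> z != z' ->
  in_order z z' \/ in_order z' z.
Proof.
move=> zb z'b nzz'; have /and4P[_ uxp _ _] := up.
have [p1 [p2 [Ep lz]]] := split_before_next zb.
have : z' \in (x :: p1) ++ next (x :: p) z :: p2 by rewrite cat_cons -Ep; apply: mem_belast.
rewrite mem_cat => /orP[z'p1|z'p2].
  right; case/splitPl: z'p1 Ep lz => q1 [|c q2] lz' Ep lz.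
    by move: lz; rewrite cats0 lz' => E; rewrite E eqxx in nzz'.
  have Ec : next (x :: p) z' = c.
    by move: uxp; rewrite Ep -lz' -catA cat_cons; apply: next_split.
  by exists q1, q2, p2; rewrite Ec; split=> //; [rewrite {1}Ep -catA | rewrite -lz last_cat].
left; case/splitPl: z'p2 Ep => q1 [|c q2] lz' Ep.
  by have := notin_belast_last; rewrite {1}Ep last_cat /= cats0 lz' z'b.
have lq1 : last x (p1 ++ next (x :: p) z :: q1) = z' by rewrite last_cat.
have Ec : next (x :: p) z' = c.
  rewrite -lq1; move: uxp; rewrite {1 2}Ep -cat_cons catA; exact: next_split.
by exists p1, q1, q2; rewrite Ec.
Qed.

Section Detour.
Variable u : T.
Hypotheses (uW : u \in W) (u_off : u \notin x :: p).

Let u_notin_p q1 q q2 : p = q1 ++ q ++ q2 -> u \notin q.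
Proof. by move=> Ep; apply: contra u_off => uq; rewrite Ep in_cons !mem_cat uq !orbT. Qed.

Lemma no_insertion z : z \in belast x p -> e z u -> e u (next (x :: p) z) -> False.
Proof.
move=> zb ezu eun; have [p1 [p2 [Ep lz]]] := split_before_next zb.
apply: (@no_longer_splice p1 [::] [:: u] _ p2 Ep) => //=; rewrite ?uW //.
  by move=> t; rewrite inE => /eqP->.
have /and4P[pp _ _ _] := up; rewrite Ep cat_path /= in pp.
by rewrite lz ezu eun; case/and3P: pp.
Qed.

Let rev_cons_last b m : rev (b :: m) = last b m :: rev (belast b m).
Proof. by rewrite lastI rev_rcons. Qed.

Lemma no_next_edge z z' : z \in belast x p -> z' \in belast x p -> z != z' ->
  e z u -> e z' u -> ~~ e (next (x :: p) z) (next (x :: p) z').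
Proof.
suff ordered t t' : in_order t t' -> e t u -> e t' u -> ~~ e (next (x :: p) t) (next (x :: p) t').
  move=> zb z'b nzz' ezu ez'u; have [o|o] := in_order_total zb z'b nzz'; first exact: ordered.
  by rewrite es ordered.
move=> [p1 [m [p2 [Ep lt lt']]]] etu et'u; apply/negP => enn.
set b := next _ t in Ep lt' enn *; set c := next _ t' in Ep enn.
have um := u_notin_p Ep; have /and4P[pp uxp pW _] := up.
apply: (@no_longer_splice p1 (b :: m) (u :: rev (b :: m)) c p2 Ep).
- by rewrite /= size_rev.
- rewrite cons_uniq rev_uniq mem_rev um.
  by move: uxp; rewrite Ep -cat_cons !cat_uniq => /and3P[_ _ /and3P[]].
- by move: pW; rewrite Ep -cat_cons !all_cat /= all_rev uW => /and3P[].
- by move=> y; rewrite inE mem_rev => /orP[/eqP->//|->].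
have last_u : last t (u :: rev (b :: m)) = b by rewrite /= rev_cons last_rcons.
rewrite Ep !cat_path /= in pp; case/and3P: pp => _ /andP[_ pm] /andP[_ pp2].
by rewrite lt cat_path last_u /= etu rev_cons_last /= {1}lt' es et'u rev_path_sym // pm enn.
Qed.

Lemma no_edge_of_next z z' : z \in belast x p -> z' \in belast x p -> z != z' ->
  e (next (x :: p) z) u -> e (next (x :: p) z') u -> ~~ e z z'.
Proof.
suff ordered t t' : in_order t t' ->
    e (next (x :: p) t) u -> e (next (x :: p) t') u -> ~~ e t t'.
  move=> zb z'b nzz' enu en'u; have [o|o] := in_order_total zb z'b nzz'; first exact: ordered.
  by rewrite es ordered.
move=> [p1 [m [p2 [Ep lt lt']]]]; set b := next _ t in Ep lt' *; set c := next _ t' in Ep *.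
move=> ebu ecu; apply/negP => ett'.
have um := u_notin_p Ep; have /and4P[pp uxp pW _] := up.
apply: (@no_longer_splice p1 (b :: m) (rcons (rev (b :: m)) u) c p2 Ep).
- by rewrite size_rcons size_rev.
- rewrite rcons_uniq rev_uniq mem_rev um.
  by move: uxp; rewrite Ep -cat_cons !cat_uniq => /and3P[_ _ /and3P[]].
- by move: pW; rewrite Ep -cat_cons !all_cat all_rcons all_rev uW => /and3P[].
- by move=> y; rewrite mem_rcons inE mem_rev => /orP[/eqP->//|->].
have last_b : last t (rev (b :: m)) = b by rewrite rev_cons last_rcons.
rewrite Ep !cat_path /= in pp; case/and3P: pp => _ /andP[_ pm] /andP[_ pp2].
rewrite lt cat_path last_rcons rcons_path last_b ebu andbT /= [e u c]es ecu pp2 andbT.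
by rewrite rev_cons_last /= lt' ett' -lt' rev_path_sym // pm.
Qed.

End Detour.
End Reroute.
(* Consecutive vertices of p outside S have disjoint neighbourhoods off p, and a common neighbour
   off p of two vertices forbids an edge between their successors, so card_pairs_le bounds the
   number of such consecutive pairs by the number of points of S off p. *)
Section ShortLongestPath.
Variables (T : finType) (e : rel T).
Hypotheses (es : symmetric e) (ei : irreflexive e).
Variables (W S : {set T}) (x : T) (p : seq T) (lam : nat).
Hypothesis longest_p : longest_upath e W x p (last x p).

Let P := [set z in x :: p].
Let Z := S :\: P.
Let K := W :\: S.

Hypotheses (sWPS : W :\: P \subset S) (sSW : S \subset W).
Hypothesis deg : {in K, forall k, lam <= #|nbhd e W k|}.
Hypotheses (short_p : size p < lam) (card_S2 : 2 * #|S| <= lam) (card_S : #|S| <= size p).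

Let succ := next (x :: p).
Let off z := nbhd e Z z.

Let up : upath e W x p (last x p). Proof. by case: longest_p. Qed.
Let uxp : uniq (x :: p). Proof. by have /and4P[] := up. Qed.

Definition kernel_pairs := [set z in belast x p | (z \in K) && (succ z \in K)].

Lemma card_path_set : #|P| = (size p).+1. Proof. exact: card_set_seq. Qed.

Lemma kernel_on_path : K \subset P.
Proof.
apply/subsetP => z /setDP[zW zS]; apply: contraNT zS => zP.
by apply: (subsetP sWPS); rewrite inE zP.
Qed.

Lemma offP z u : u \in off z -> [/\ u \in W, u \notin x :: p & e z u].
Proof.
rewrite inE => /andP[/setDP[uS uP] ezu]; split=> //; first exact: (subsetP sSW).
by rewrite inE in uP.
Qed.

Lemma off_sub z : off z \subset Z.
Proof. by apply/subsetP => u; rewrite inE => /andP[]. Qed.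

Lemma belast_path_set z : z \in belast x p -> (z \in P) && (succ z \in P).
Proof. by move=> /mem_belast zp; rewrite !in_set /succ mem_next zp. Qed.

Lemma kernel_pairsP z :
  z \in kernel_pairs -> [/\ z \in belast x p, z \in K & succ z \in K].
Proof. by rewrite inE => /and3P[]. Qed.

Lemma succ_inj : injective succ. Proof. exact: can_inj (prev_next uxp). Qed.

Lemma degree_split z : z \in K -> lam <= #|nbhd e P z| + #|off z|.
Proof.
move=> zK; apply: leq_trans (deg zK) (leq_trans (subset_leq_card _) (cardsU_le _ _)).
apply/subsetP => w; rewrite in_nbhd => /andP[wW ezw].
rewrite in_setU !in_nbhd ezw !andbT in_setD.
by case: (boolP (w \in P)) => //= wP; apply: (subsetP sWPS); rewrite in_setD wP.
Qed.

Lemma degree_room z (D : {set T}) :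
  z \in K -> D \subset P -> nbhd e P z :&: D = set0 -> #|D| <= #|off z|.
Proof.
move=> zK sDP disj; have : #|nbhd e P z| + #|D| <= #|P|.
  rewrite -cardsU_disjoint //; apply: subset_leq_card; rewrite subUset sDP andbT.
  by apply/subsetP => w; rewrite inE => /andP[].
rewrite card_path_set => le_P; rewrite -(leq_add2l #|nbhd e P z|).
exact: leq_trans le_P (leq_trans short_p (degree_split zK)).
Qed.

Lemma off_ge z : z \in K -> lam - size p <= #|off z|.
Proof.
move=> zK; rewrite leq_subLR; apply: leq_trans (degree_split zK) _; rewrite leq_add2r.
rewrite -ltnS -card_path_set; apply: proper_card; apply/properP; split.
  by apply/subsetP => w; rewrite inE => /andP[].
by exists z; [apply: (subsetP kernel_on_path) | rewrite inE ei andbF].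
Qed.

Lemma card_kernel_pairs_ge : size p <= #|kernel_pairs| + 2 * #|S :&: P|.
Proof.
pose E := [set z in belast x p]; pose V := [set z in E | succ z \in S :&: P].
have <- : #|E| = size p.
  by rewrite card_set_seq ?size_belast //; move: uxp; rewrite lastI rcons_uniq => /andP[].
have kernel_or_S z : z \in P -> (z \in K) || (z \in S :&: P).
  by move=> zP; rewrite in_setI zP andbT in_setD (subsetP (upath_set_sub up)) // andbT orNb.
have sub : E \subset kernel_pairs :|: (S :&: P) :|: V.
  apply/subsetP => z; rewrite inE => zE; have /andP[zP szP] := belast_path_set zE.
  rewrite !in_setU [z \in kernel_pairs]inE [z \in V]inE [z \in E]inE zE /=.
  by have := kernel_or_S z zP; have := kernel_or_S _ szP; do 4! case: (_ \in _).
have card_V : #|V| <= #|S :&: P|.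
  rewrite -(card_imset (mem V) succ_inj).
  by apply: subset_leq_card; apply/subsetP => _ /imsetP[z + ->]; rewrite inE => /andP[].
apply: leq_trans (subset_leq_card sub) (leq_trans (cardsU_le _ _) _).
by rewrite mul2n -addnn addnA; apply: leq_add card_V; apply: cardsU_le.
Qed.

Lemma off_multiplicity i u : i \in kernel_pairs -> u \in off i ->
  #|[set j in kernel_pairs | u \in off j]| <= #|off (succ i)|.
Proof.
move=> /kernel_pairsP[ib iK siK] /offP[uW u_off eiu].
rewrite -(card_imset _ succ_inj); apply: degree_room => //.
  apply/subsetP => _ /imsetP[j + ->]; rewrite inE => /andP[/kernel_pairsP[jb _ _] _].
  by case/andP: (belast_path_set jb).
apply/setP => v; rewrite in_set0 in_setI; apply/negP => /andP[+ /imsetP[j + Ev]].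
rewrite in_nbhd => /andP[_ esv]; rewrite inE => /andP[/kernel_pairsP[jb _ _] /offP[_ _ eju]].
have [ij|nij] := eqVneq i j; first by rewrite Ev ij ei in esv.
by have /negP := no_next_edge es longest_p uW u_off ib jb nij eiu eju; rewrite -/succ -Ev.
Qed.

Lemma off_succ_multiplicity i u : i \in kernel_pairs -> u \in off (succ i) ->
  #|[set j in kernel_pairs | u \in off (succ j)]| <= #|off i|.
Proof.
move=> /kernel_pairsP[ib iK siK] /offP[uW u_off esiu]; apply: degree_room => //.
  apply/subsetP => j; rewrite inE => /andP[/kernel_pairsP[jb _ _] _].
  by case/andP: (belast_path_set jb).
apply/setP => j; rewrite in_set0 in_setI; apply/negP => /andP[].
rewrite in_nbhd => /andP[_ eij]; rewrite inE => /andP[/kernel_pairsP[jb _ _] /offP[_ _ esju]].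
have [ij|nij] := eqVneq i j; first by rewrite ij ei in eij.
by have /negP := no_edge_of_next es longest_p uW u_off ib jb nij esiu esju.
Qed.

Lemma off_succ_disjoint i : i \in kernel_pairs -> off i :&: off (succ i) = set0.
Proof.
move=> /kernel_pairsP[ib _ _]; apply/setP => u; rewrite in_set0 in_setI.
apply/negP => /andP[/offP[uW u_off eiu] /offP[_ _ esu]].
by apply: (no_insertion longest_p uW u_off ib); rewrite // es.
Qed.

Lemma card_kernel_pairs_le : #|kernel_pairs| <= #|Z|.
Proof.
have off_neq0 z : z \in K -> off z != set0.
  by move=> /off_ge le_off; rewrite -card_gt0; apply: leq_trans le_off; rewrite subn_gt0.
apply: (@card_pairs_le _ _ kernel_pairs Z off (off \o succ)) => [i|i u|i u] /=.
- by move=> /kernel_pairsP[_ iK siK]; split; rewrite ?off_sub ?off_neq0.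
- exact: off_multiplicity.
- exact: off_succ_multiplicity.
Qed.

Theorem no_short_longest_upath : False.
Proof.
have card_S_split : #|S| = #|S :&: P| + #|Z| by rewrite /Z -(cardsID P S).
have [k kK] : exists k, k \in K.
  have [k kP kS] : exists2 k, k \in P & k \notin S.
    apply/subsetPn; apply: contraL card_S => /subset_leq_card.
    by rewrite card_path_set -ltnNge.
  by exists k; rewrite inE kS (subsetP (upath_set_sub up)).
have Z_ge : lam - size p <= #|Z|.
  exact: leq_trans (off_ge kK) (subset_leq_card (off_sub k)).
have pairs_ge := card_kernel_pairs_ge; have pairs_le := card_kernel_pairs_le.
have [i i_pair] : exists i, i \in kernel_pairs.
  by apply/set0Pn; rewrite -card_gt0; move: short_p card_S2; lia.
have [_ iK siK] := kernel_pairsP i_pair.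
have : #|off i| + #|off (succ i)| <= #|Z|.
  by rewrite -cardsU_disjoint ?off_succ_disjoint // subset_leq_card // subUset !off_sub.
have := off_ge iK; have := off_ge siK; move: short_p card_S2; lia.
Qed.

End ShortLongestPath.

(** * Longest paths inside a set with small boundary *)

Lemma lex_min_set (T : finType) (Q : pred {set T}) (m : {set T} -> nat) (W0 : {set T}) : Q W0 ->
  exists W, [/\ Q W, m W <= m W0 & forall W', Q W' -> #|W'| < #|W| -> m W < m W'].
Proof.
move=> QW0; case: (arg_minnP m QW0) => W1 QW1 min_m.
pose Qm W := Q W && (m W == m W1); have QmW1 : Qm W1 by rewrite /Qm QW1 eqxx.
case: (arg_minnP (fun W : {set T} => #|W|) QmW1) => W /andP[QW /eqP mW] min_card.
exists W; split; rewrite ?mW ?min_m // => W' QW' lt_card.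
rewrite ltnNge; apply: contraL lt_card => le_m; rewrite -leqNgt; apply: min_card.
by rewrite /Qm QW' eqn_leq le_m min_m.
Qed.

Section Boundary.
Variables (T : finType) (e : rel T) (B high : {set T}).
Hypothesis es : symmetric e.
Implicit Types (I W : {set T}) (w z : T).

Definition boundary W := [set w in W | (w \notin high) || [exists z in B :\: W, e w z]].

Lemma boundaryP W w :
  reflect (w \in W /\ (w \notin high \/ exists2 z, z \in B :\: W & e w z)) (w \in boundary W).
Proof.
rewrite inE; apply: (iffP andP) => [[wW /orP h]|[wW h]]; split=> //.
  by case: h => [|/exists_inP]; [left|right].
by case: h => [->//|/exists_inP ->]; rewrite orbT.
Qed.

Lemma boundary_sub W : boundary W \subset W.
Proof. by apply/subsetP => w /boundaryP[]. Qed.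

Lemma notin_boundary W w :
  w \in W :\: boundary W -> w \in high /\ forall z, z \in B -> e w z -> z \in W.
Proof.
case/setDP=> wW wS; split=> [|z zB ewz]; apply: contraNT wS => h; apply/boundaryP; split=> //.
  by left.
by right; exists z; rewrite // inE h.
Qed.

Lemma boundaryD_sub W I :
  boundary (W :\: I) \subset (boundary W :\: I) :|: (nbrs e (W :\: I) I :\: boundary W).
Proof.
apply/subsetP => w /boundaryP[wWI h]; have /setDP[wW wI] := wWI.
rewrite in_setU !in_setD wI /=; case: (boolP (w \in boundary W)) => //= wS.
apply/nbrsP; split=> //; case: h => [whigh|[z /setDP[zB]]].
  by case/boundaryP: wS; split=> //; left.
rewrite in_setD negb_and negbK => /orP[zI|zW] ewz; first by exists z; rewrite // es.
by case/boundaryP: wS; split=> //; right; exists z; rewrite // inE zW.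
Qed.

(* Minimality of the boundary of W is used only in this form: a set removed from W has many
   neighbours off the boundary. *)
Lemma boundary_trade W I : #|boundary W| < #|boundary (W :\: I)| ->
  #|boundary W :&: I| < #|nbrs e (W :\: I) I :\: boundary W|.
Proof.
move=> lt; have := leq_trans (subset_leq_card (boundaryD_sub W I)) (cardsU_le _ _).
by move/(leq_trans lt); rewrite -[X in X < _](cardsID I) addnC ltn_add2l.
Qed.

End Boundary.

Section Detours.
Variables (T : finType) (e : rel T).
Hypothesis es : symmetric e.
Implicit Types (A N W X : {set T}) (f n x z : T) (k lam : nat) (p : seq T).

Definition detour W x p n n' k := exists z z',
  [/\ e n z, long_upath e (W :\: [set t in x :: p]) z z' k & e z' n'].

Definition detour_fan W x p f N k :=
  [/\ f \in x :: p, {in N, forall n, (n \in x :: p) && (n != f)}, N != set0,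
      {in N, forall n, detour W x p n f k} &
      {in f |: N &, forall n n', n != n' -> detour W x p n n' 1}].

Definition fan_free W x p lam := forall f N, ~ detour_fan W x p f N (lam - 2 * #|N|).

Lemma detour_sym W x p n n' k : detour W x p n n' k -> detour W x p n' n k.
Proof.
move=> [z [z' [enz L ez'n']]]; exists z', z.
by split; [rewrite es | apply: long_upath_sym | rewrite es].
Qed.

Lemma detourW W W' x p n n' k k' :
  W \subset W' -> k' <= k -> detour W x p n n' k -> detour W' x p n n' k'.
Proof.
move=> sW le_k [z [z' [enz L ez'n']]]; exists z, z'; split=> //.
by apply: long_upathW L => //; apply: setSD.
Qed.

Lemma detour_fanS W W' x p f N k :
  W \subset W' -> detour_fan W x p f N k -> detour_fan W' x p f N k.
Proof.
move=> sW [fP sN N0 fan pairs]; split=> // [n nN|n n' nN n'N nn'].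
  exact: detourW sW (leqnn k) (fan n nN).
exact: detourW sW (leqnn 1) (pairs n n' nN n'N nn').
Qed.

Lemma fan_freeS W W' x p lam : W \subset W' -> fan_free W' x p lam -> fan_free W x p lam.
Proof. by move=> sW free f N /(detour_fanS sW); apply: free. Qed.

Lemma detour_fan_mem W x p f N k n :
  detour_fan W x p f N k -> n \in f |: N -> n \in x :: p.
Proof. by move=> [fp sN _ _ _] /setU1P[->|/sN/andP[]]. Qed.

Lemma card_detour_fan W x p f N k : detour_fan W x p f N k -> #|f |: N| = #|N|.+1.
Proof.
move=> [_ sN _ _ _]; rewrite cardsU1; case: (boolP (f \in N)) => // /sN.
by rewrite eqxx andbF.
Qed.

Lemma connected_detour W x p X n n' : connected_on e X -> X \subset W :\: [set t in x :: p] ->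
  (exists2 z, z \in X & e n z) -> (exists2 z, z \in X & e n' z) -> detour W x p n n' 1.
Proof.
move=> cX sX [z zX enz] [z' z'X en'z']; exists z, z'; split=> //; last by rewrite es.
exact: long_upathW sX (leqnn 1) (connected_on_upath cX zX z'X).
Qed.

Lemma long_upath_drop_end A x y k : long_upath e (y |: A) x y k.+1 -> x != y ->
  exists2 z, long_upath e (A :\ y) x z k & e z y.
Proof.
move=> [q /and4P[pq uq qA lq] sq] nxy.
case: (lastP q) pq uq qA lq sq => [_ _ _ /= /eqP E|r z]; first by rewrite E eqxx in nxy.
rewrite last_rcons rcons_path -rcons_cons rcons_uniq all_rcons size_rcons.
move=> /andP[pr ez] /andP[zr ur] /andP[_ rA] /eqP Ez sr; subst z.
exists (last x r) => //; exists r => //; apply/and4P; split=> //.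
apply/allP => z zr'; have := allP rA z zr'; rewrite in_setD1 in_setU1.
by case: eqVneq => [zy|//]; rewrite -zy zr' in zr.
Qed.

End Detours.

Definition pendant_free (T : finType) (e : rel T) (B high W P : {set T}) :=
  forall I b, lobe e B b I -> I \subset W :\: P -> I \subset high -> b \in W ->
    ~ exists2 a, a \in I & e b a.

Section Pouches.
Variables (T : finType) (e : rel T).
Hypotheses (es : symmetric e) (ei : irreflexive e).
Variables (B high W : {set T}) (lam : nat) (x : T) (p : seq T).
Implicit Types (I J X : {set T}) (a b c f n v w z : T).

Let P := [set z in x :: p].
Let S := boundary e B high W.
Let K := W :\: S.

Hypothesis high_deg : {in high, forall v, lam <= #|nbhd e B v|}.
Hypotheses (sWB : W \subset B) (sPW : P \subset W).
Hypotheses (no_pendant : pendant_free e B high W P) (no_fan : fan_free e W x p lam).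
Hypothesis trade : forall I, I \subset W :\: P -> I != set0 ->
  #|S :&: I| < #|nbrs e (W :\: I) I :\: S|.

Lemma interior_degree k : k \in K -> lam <= #|nbhd e W k|.
Proof.
move=> /notin_boundary[k_high kW]; apply: leq_trans (high_deg k_high) _.
apply: subset_leq_card; apply/subsetP => w; rewrite !in_nbhd => /andP[wB ekw].
by rewrite ekw kW.
Qed.

Lemma no_closed_piece X b : connected_on e X -> X \subset W :\: P -> S :&: X = set0 ->
  b \in W :\: X -> (exists2 a, a \in X & e b a) -> nbrs e (W :\: X) X \subset [set b] -> False.
Proof.
move=> cX sX SX /setDP[bW bX] b_att sub_b.
have sXK : X \subset K.
  apply/subsetP => z zX; have /setDP[zW _] := subsetP sX z zX.
  by rewrite in_setD zW andbT; apply/negP => zS; have := in_set0 z; rewrite -SX in_setI zS zX.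
apply: (no_pendant (I := X) (b := b)) => //; last first.
  by apply/subsetP => z /(subsetP sXK)/notin_boundary[].
apply/lobeP; split=> // [|a w aX wB eaw].
  apply/subsetP => z zX; rewrite in_setD1; apply/andP; split.
    by apply: contraNneq bX => <-.
  by have /setDP[zW _] := subsetP sX z zX; apply: (subsetP sWB).
have [_ aW] := notin_boundary (subsetP sXK a aX).
rewrite in_setU1 -in_set1; case: (boolP (w \in X)) => wX; rewrite ?orbT // orbF.
apply: (subsetP sub_b); apply/nbrsP.
by rewrite in_setD wX aW //; split=> //; exists a.
Qed.

Definition off_path_component I b := component e (W :\: P :\: I) b.

Definition pouch b I := [/\ I \subset W :\: P, connected_on e I, I :&: K != set0,
  b \in W :\: I & [/\ exists2 a, a \in I & e b a, nbrs e (W :\: I) I \subset b |: P &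
    b \in P \/ nbrs e P (off_path_component I b) != set0]].

Section MinimalPouch.
Variables (b : T) (I : {set T}).
Hypotheses (pouchI : pouch b I) (minI : forall v J, pouch v J -> #|I| <= #|J|).

Definition pouch_feet := (nbrs e (W :\: I) I :&: P) :\ b.

Let sI : I \subset W :\: P. Proof. by case: pouchI. Qed.
Let cI : connected_on e I. Proof. by case: pouchI. Qed.
Let bWI : b \in W :\: I. Proof. by case: pouchI. Qed.
Let bI : b \notin I. Proof. by case/setDP: bWI. Qed.
Let b_att : exists2 a, a \in I & e b a. Proof. by case: pouchI => _ _ _ _ []. Qed.

Let cbI : connected_on e (b |: I).
Proof. by have [a aI eba] := b_att; apply: connected_onU1 eba. Qed.

Lemma pouch_feetP n : reflect [/\ n \in P, n != b & exists2 a, a \in I & e n a] (n \in pouch_feet).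
Proof.
rewrite in_setD1 in_setI; apply: (iffP and3P) => [[nb /nbrsP[_ [a aI ean]] nP]|[nP nb [a aI ena]]].
  by split=> //; exists a; rewrite // es.
split=> //; apply/nbrsP; split; last by exists a; rewrite // es.
rewrite in_setD (subsetP sPW) // andbT; apply/negP => /(subsetP sI)/setDP[_].
by rewrite nP.
Qed.

Lemma pouch_nbrs_feet : nbrs e (W :\: I) I \subset b |: pouch_feet.
Proof.
case: pouchI => _ _ _ _ [_ /subsetP sub _]; apply/subsetP => w wN.
have := sub w wN; rewrite !in_setU1 in_setD1 in_setI wN /=.
by case: eqVneq.
Qed.

Lemma card_boundary_pouch : #|S :&: I| <= #|pouch_feet|.
Proof.
have I0 : I != set0 by have [a aI _] := b_att; apply/set0Pn; exists a.
rewrite -ltnS; apply: leq_trans (trade sI I0) _.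
apply: leq_trans (subset_leq_card (subset_trans (subsetDl _ S) pouch_nbrs_feet)) _.
exact: cardsU1_le.
Qed.

Lemma pouch_feet_neq0 : pouch_feet != set0.
Proof.
apply/eqP => feet0; apply: (no_closed_piece cI sI _ bWI b_att).
  by apply/eqP; rewrite -cards_eq0 -leqn0 -(cards0 T) -feet0 card_boundary_pouch.
by have := pouch_nbrs_feet; rewrite feet0 setU0.
Qed.

Lemma pouch_degree v : v \in I :&: K ->
  lam - #|pouch_feet| - #|S :&: I| <= #|nbhd e (b |: ((b |: I) :&: K)) v|.
Proof.
case/setIP=> vI vK; set Y := nbhd e _ v.
have sub : nbhd e W v \subset Y :|: (S :&: I) :|: pouch_feet.
  apply/subsetP => w; rewrite in_nbhd !in_setU => /andP[wW evw].
  have [wb|wb] := eqVneq w b; first by rewrite in_nbhd evw wb setU11.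
  case: (boolP (w \in I)) => wI; last first.
    have : w \in nbrs e (W :\: I) I by apply/nbrsP; rewrite in_setD wI; split=> //; exists v.
    by move=> /(subsetP pouch_nbrs_feet); rewrite in_setU1 (negbTE wb) /= => ->; rewrite orbT.
  case: (boolP (w \in S)) => wS; first by rewrite [w \in _ :&: _]in_setI wS wI orbT.
  by rewrite in_nbhd evw !(in_setU1, in_setI) wI /K in_setD wS wW !orbT.
rewrite -subnDA leq_subLR -addnA addnC [_ + #|Y|]addnC.
apply: leq_trans (interior_degree vK) (leq_trans (subset_leq_card sub) _).
by apply: leq_trans (cardsU_le _ _) _; rewrite leq_add2r cardsU_le.
Qed.

Lemma pouch_lobe_marked n v J : n \in pouch_feet -> v \in b |: I -> lobe e (b |: I) v J ->
  b \notin J -> J :&: K != set0 -> J :&: nbhd e I n != set0.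
Proof.
case/pouch_feetP=> nP nb [a aI ena] vbI lJ bJ JK; apply/negP => /eqP no_mark.
have /lobeP[sJ cJ closedJ] := lJ.
have sJI : J \subset I.
  apply/subsetP => z zJ; have := subsetP sJ z zJ; rewrite in_setD1 in_setU1 => /andP[_].
  by case/orP=> // /eqP zb; rewrite -zb zJ in bJ.
have aJ : a \notin J.
  by apply/negP => aJ; have := in_set0 a; rewrite -no_mark in_setI aJ in_nbhd aI ena.
have /set0Pn[z /setIP[zJ _]] := JK.
have vI : v \in I.
  move: vbI; rewrite in_setU1 => /orP[/eqP vb|//]; case/negP: aJ.
  have cza := connected_onP _ _ cI z a (subsetP sJI z zJ) aI.
  apply: (connect_rel_on_closed _ zJ cza) => w t wJ tI ewt.
  have := closedJ w t wJ (setU1r b tI) ewt; rewrite vb in_setU1 => /orP[/eqP tb|//].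
  by case/negP: bI; rewrite -tb.
have : #|I| <= #|J|; last first.
  rewrite leqNgt proper_card //; apply/properP; split=> //.
  by exists v; rewrite // (lobe_notin lJ).
apply: (minI (v := v)); split=> //.
- exact: subset_trans sJI sI.
- by rewrite in_setD (lobe_notin lJ); have /setDP[] := subsetP sI v vI.
split; first exact: lobe_attached vbI lJ zJ.
  apply/subsetP => w /nbrsP[/setDP[wW wJ] [a' a'J ea'w]]; rewrite in_setU1.
  case: (boolP (w \in b |: I)) => wbI.
    by have := closedJ a' w a'J wbI ea'w; rewrite in_setU1 (negbTE wJ) orbF => ->.
  move: wbI; rewrite in_setU1 negb_or => /andP[wb wI].
  have : w \in nbrs e (W :\: I) I.
    by apply/nbrsP; rewrite in_setD wI; split=> //; exists a' => //; apply: (subsetP sJI).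
  move=> /(subsetP pouch_nbrs_feet); rewrite in_setU1 (negbTE wb) /= => /pouch_feetP[-> _ _].
  by rewrite orbT.
right; apply/set0Pn; exists n; apply/nbrsP; split=> //; exists a; last by rewrite es.
have aD : a \in W :\: P :\: J by rewrite in_setD aJ (subsetP sI).
have lJI : lobe e I v J.
  apply/lobeP; split=> // [|w t wJ tI]; last exact: closedJ wJ (setU1r b tI).
  apply/subsetP => w wJ; rewrite in_setD1 (subsetP sJI) // andbT.
  by apply: contraTneq wJ => ->; apply: lobe_notin lJ.
rewrite inE aD; have [q uq _] := lobe_avoiding_path cI vI aI lJI aJ.
by apply: connect_rel_onS (upath_connect uq); apply: setSD.
Qed.

Lemma pouch_long_upath n : n \in pouch_feet -> exists m, [/\ m \in I, e n m &
  long_upath e (b |: I) m b (lam - #|pouch_feet| - #|S :&: I|).+1].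
Proof.
move=> n_foot; have IK : exists2 k, k \in (b |: I) :&: K & k != b.
  case: pouchI => _ _ /set0Pn[k /setIP[kI kK]] _ _; exists k; last by apply: contraNneq bI => <-.
  by rewrite in_setI kK in_setU1 kI orbT.
have [|v J vbI lJ bJ JK|m /[1!in_nbhd] /andP[mI enm] L] :=
    rooted_long_upath (M := nbhd e I n) (d := lam - #|pouch_feet| - #|S :&: I|)
      es ei (setU11 b I) cbI IK.
- move=> u /setIP[]; rewrite in_setU1 => /orP[/eqP->|uI] uK ub; first by rewrite eqxx in ub.
  by apply: pouch_degree; rewrite in_setI uI.
- exact: pouch_lobe_marked n_foot vbI lJ bJ JK.
- by exists m.
Qed.

Let foot_on_path n : n \in pouch_feet -> n \in x :: p.
Proof. by case/pouch_feetP; rewrite inE. Qed.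

Lemma no_pouch_on_path : b \in P -> False.
Proof.
rewrite inE => bP; apply: (no_fan (f := b) (N := pouch_feet)); split=> //.
- by move=> n n_foot; rewrite foot_on_path //=; case/pouch_feetP: n_foot.
- exact: pouch_feet_neq0.
- move=> n n_foot; have [m [mI enm L]] := pouch_long_upath n_foot.
  have mb : m != b by apply: contraNneq bI => <-.
  have [z Lz ezb] := long_upath_drop_end L mb; exists m, z; split=> //; apply: long_upathW Lz.
    exact: subset_trans (subsetDl _ _) sI.
  by rewrite -subnDA leq_sub2l // mul2n -addnn leq_add2l card_boundary_pouch.
- have att n : n \in b |: pouch_feet -> exists2 z, z \in I & e n z.
    by rewrite in_setU1 => /orP[/eqP->|/pouch_feetP[]].
  by move=> n n' /att n_att /att n'_att _; apply: connected_detour cI sI n_att n'_att.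
Qed.

Section OffPath.
Hypothesis bP : b \notin P.

Let Q := off_path_component I b.
Let X := I :|: Q.

Let bQ : b \in Q.
Proof. by apply: mem_component; move: bWI; rewrite !in_setD bP => /andP[->]. Qed.

Let cQ : connected_on e Q.
Proof. by apply: component_connected => //; move: bWI; rewrite !in_setD bP => /andP[->]. Qed.

Let sQ z : z \in Q -> [/\ z \in W, z \notin P & z \notin I].
Proof. by move=> /(subsetP (component_sub _ _ _))/setDP[/setDP[]]. Qed.

Let XE : X = (b |: I) :|: Q.
Proof. by apply/setP => z; rewrite !in_setU in_set1; case: eqVneq => [->|//]; rewrite bQ orbT. Qed.

Let cX : connected_on e X. Proof. by rewrite XE; apply: connected_onU cbI cQ (setU11 _ _) bQ. Qed.

Let sX : X \subset W :\: P.
Proof. by rewrite subUset sI; apply/subsetP => z /sQ[zW zP _]; rewrite in_setD zP. Qed.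

Lemma foot_detour n f c : n \in pouch_feet -> c \in Q -> e c f ->
  detour e W x p n f (lam - #|pouch_feet| - #|S :&: I|).+1.
Proof.
move=> n_foot cQ' ecf; have [m [mI enm L]] := pouch_long_upath n_foot.
have meet_b : (b |: I) :&: Q \subset [set b].
  by apply/subsetP => z /setIP[/setU1P[->|zI] /sQ[_ _]]; rewrite ?set11 ?zI.
have L' := long_upath_join L (connected_on_upath cQ bQ cQ') meet_b isT.
by exists m, c; split=> //; apply: long_upathW L'; rewrite ?addn1 // -XE.
Qed.

Lemma foot_pair_detour (N : {set T}) f c : N \subset pouch_feet -> c \in Q -> e c f ->
  {in f |: N &, forall n n', n != n' -> detour e W x p n n' 1}.
Proof.
move=> sN cQ' ecf; have att n : n \in f |: N -> exists2 z, z \in X & e n z.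
  rewrite in_setU1 => /orP[/eqP->|/(subsetP sN)/pouch_feetP[_ _ [z zI enz]]].
    by exists c; rewrite 1?es // in_setU cQ' orbT.
  by exists z; rewrite // in_setU zI.
by move=> n n' /att n_att /att n'_att _; apply: connected_detour cX sX n_att n'_att.
Qed.

Lemma off_path_nbrs_feet : nbrs e P Q \subset pouch_feet.
Proof.
apply/subsetP => f /nbrsP[fP [c cQ' ecf]]; apply: contraT => f_foot; exfalso.
apply: (no_fan (f := f) (N := pouch_feet)); split.
- by rewrite inE in fP.
- by move=> n n_foot; rewrite foot_on_path //=; apply: contraNneq f_foot => <-.
- exact: pouch_feet_neq0.
- move=> n n_foot; apply: detourW (subxx W) _ (foot_detour n_foot cQ' ecf).
  by rewrite leqW // -subnDA leq_sub2l // mul2n -addnn leq_add2l card_boundary_pouch.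
- exact: foot_pair_detour cQ' ecf.
Qed.

Lemma pouch_component_nbrs_feet : nbrs e (W :\: X) X \subset pouch_feet.
Proof.
apply/subsetP => w /nbrsP[/setDP[wW]]; rewrite in_setU negb_or => /andP[wI wQ] [a].
rewrite in_setU => /orP[aI|aQ] eaw.
  have : w \in nbrs e (W :\: I) I by apply/nbrsP; rewrite in_setD wI; split=> //; exists a.
  move=> /(subsetP pouch_nbrs_feet); rewrite in_setU1 => /orP[/eqP wb|//].
  by rewrite wb bQ in wQ.
case: (boolP (w \in P)) => wP.
  by apply: (subsetP off_path_nbrs_feet); apply/nbrsP; split=> //; exists a.
by case/negP: wQ; apply: (component_closed aQ _ eaw); rewrite !in_setD wI wP.
Qed.

Lemma card_boundary_off_path : #|S :&: X| < #|pouch_feet|.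
Proof.
have X0 : X != set0 by apply/set0Pn; exists b; rewrite in_setU bQ orbT.
apply: leq_trans (trade sX X0) (subset_leq_card _).
exact: subset_trans (subsetDl _ _) pouch_component_nbrs_feet.
Qed.

Lemma no_pouch_off_path : False.
Proof.
have /set0Pn[f fN] : nbrs e P Q != set0.
  by case: pouchI => _ _ _ _ [_ _ []] // /(negP bP).
have f_foot := subsetP off_path_nbrs_feet f fN; have /nbrsP[fP [c cQ' ecf]] := fN.
have card_feet : #|pouch_feet| = #|pouch_feet :\ f|.+1 by rewrite (cardsD1 f) f_foot.
have [feet1|feet1] := eqVneq (pouch_feet :\ f) set0.
  have boundary0 : S :&: X = set0.
    apply/eqP; rewrite -cards_eq0 -leqn0 -ltnS (leq_trans card_boundary_off_path) //.
    by rewrite card_feet feet1 cards0.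
  apply: (no_closed_piece cX sX boundary0 (b := f)).
  - by rewrite in_setD (subsetP sPW) // andbT; apply/negP => /(subsetP sX)/setDP[_]; rewrite fP.
  - by exists c; rewrite 1?es // in_setU cQ' orbT.
  - by apply: subset_trans pouch_component_nbrs_feet _; rewrite -setD_eq0 feet1.
apply: (no_fan (f := f) (N := pouch_feet :\ f)); split.
- by rewrite inE in fP.
- by move=> n /setD1P[-> n_foot]; rewrite foot_on_path.
- exact: feet1.
- move=> n /setD1P[_ n_foot]; apply: detourW (subxx W) _ (foot_detour n_foot cQ' ecf).
  have le_SI : #|S :&: I| <= #|pouch_feet :\ f|.
    rewrite -ltnS -card_feet; apply: leq_ltn_trans card_boundary_off_path.
    exact/subset_leq_card/setIS/subsetUl.
  apply: leq_trans (leqSpred _) _; rewrite ltnS -subnS -subnDA leq_sub2l //.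
  by rewrite card_feet addSn mul2n -addnn ltnS leq_add2l.
- by apply: foot_pair_detour cQ' ecf; apply: subsetDl.
Qed.

End OffPath.
End MinimalPouch.
Lemma no_pouch b I : ~ pouch b I.
Proof.
have [k] := ubnP #|I|; elim: k b I => // k IH b I le_k pouchI.
have minI v J : pouch v J -> #|I| <= #|J|.
  by move=> pouchJ; rewrite leqNgt; apply/negP => lt; apply: IH (leq_trans lt le_k) pouchJ.
have [bP|bP] := boolP (b \in P); first exact: no_pouch_on_path pouchI minI bP.
exact: no_pouch_off_path pouchI minI bP.
Qed.

Lemma off_path_sub_boundary : W :\: P \subset S.
Proof.
apply/subsetP => v vD; apply: contraT => vS; exfalso.
pose Q := component e (W :\: P) v; have vQ : v \in Q := mem_component e vD.
have sQ : Q \subset W :\: P := component_sub e _ _.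
have sub_P : nbrs e (W :\: Q) Q \subset P.
  apply/subsetP => w /nbrsP[/setDP[wW wQ] [a aQ eaw]]; apply: contraNT wQ => wP.
  by apply: (component_closed aQ _ eaw); rewrite in_setD wP.
have Q0 : Q != set0 by apply/set0Pn; exists v.
have /card_gt0P[b /setDP[bN _]] := leq_ltn_trans (leq0n _) (trade sQ Q0).
have /nbrsP[bWQ [a aQ eab]] := bN; apply: (@no_pouch b Q); split=> //.
- exact: component_connected.
- by apply/set0Pn; exists v; rewrite in_setI vQ in_setD vS; case/setDP: vD.
- split; last by left; apply: (subsetP sub_P).
    by exists a; rewrite // es.
  exact: subset_trans sub_P (subsetUr _ _).
Qed.

End Pouches.

Section NoLongestPath.
Variables (T : finType) (e : rel T).
Hypotheses (es : symmetric e) (ei : irreflexive e).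
Implicit Types (B high I N W : {set T}) (a b f x : T) (p : seq T).

Theorem no_longest_upath B high W lam x p (P := [set z in x :: p]) :
  W \subset B -> {in high, forall v, lam <= #|nbhd e B v|} ->
  longest_upath e W x p (last x p) -> size p < lam ->
  2 * #|boundary e B high W| <= lam -> #|boundary e B high W| <= size p ->
  pendant_free e B high W P -> fan_free e W x p lam -> False.
Proof.
move=> sWB high_deg longest_pW short_p bd_lam bd_p no_pendant no_fan.
have sPW : P \subset W by case: longest_pW => /upath_set_sub.
have [W' [/andP[sPW' sW'] bdW' minW']] := @lex_min_set T
  (fun W' => (P \subset W') && (W' \subset W)) (fun W' => #|boundary e B high W'|) W
  (introT andP (conj sPW (subxx _))).
have sW'B := subset_trans sW' sWB; set S := boundary e B high W'.
have trade I : I \subset W' :\: P -> I != set0 -> #|S :&: I| < #|nbrs e (W' :\: I) I :\: S|.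
  move=> sI /set0Pn[i iI]; apply: boundary_trade => //; apply: minW'.
    rewrite (subset_trans (subsetDl _ _) sW') andbT; apply/subsetP => z zP.
    rewrite in_setD (subsetP sPW') // andbT; apply/negP => /(subsetP sI).
    by rewrite in_setD zP.
  apply: proper_card; apply/properP; split; first exact: subsetDl.
  by have /setDP[iW' _] := subsetP sI i iI; exists i; rewrite // in_setD iI.
have longest_p := longest_upath_sub sW' sPW' longest_pW.
apply: (no_short_longest_upath es ei longest_p (S := S)) short_p _ _.
- apply: (off_path_sub_boundary es ei high_deg sW'B sPW' _ (fan_freeS sW' no_fan) trade).
  move=> I b lI sI Ihigh bW'; apply: no_pendant lI _ Ihigh (subsetP sW' b bW').
  exact: subset_trans sI (setSD _ sW').
- exact: boundary_sub.
- by move=> k; apply: interior_degree.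
- by apply: leq_trans bd_lam; rewrite leq_mul2l.
- exact: leq_trans bdW' bd_p.
Qed.

End NoLongestPath.

(** * Fans of detours and pendant sets *)

Lemma split_index (T : eqType) (s : seq T) n n' :
  uniq s -> n \in s -> n' \in s -> index n s < index n' s ->
  exists l m r, [/\ s = l ++ n :: m ++ n' :: r, index n s = size l &
                    index n' s = size l + (size m).+1].
Proof.
move=> us ns; case/splitPr: ns us => l t; rewrite cat_uniq /= negb_or.
move=> /and3P[_ /andP[nl /hasPn tl] /andP[nt _]] n's.
have index_n : index n (l ++ n :: t) = size l by rewrite index_cat (negbTE nl) /= eqxx addn0.
rewrite index_n => lt.
have n'l : n' \notin l.
  by apply: contraL lt => n'l; rewrite -leqNgt index_cat n'l ltnW // index_mem.
have n'n : n != n' by apply: contraTneq lt => <-; rewrite index_n ltnn.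
move: n's; rewrite mem_cat (negbTE n'l) in_cons eq_sym (negbTE n'n) /= => n't.
exists l, (take (index n' t) t), (drop (index n' t).+1 t); split=> //.
  by rewrite -{2}(nth_index n n't) -drop_nth ?index_mem // cat_take_drop.
by rewrite index_cat (negbTE n'l) /= (negbTE n'n) size_takel // ltnW // index_mem.
Qed.

Lemma index_neq (T : eqType) (s : seq T) n n' :
  n \in s -> n != n' -> index n s != index n' s.
Proof.
move=> ns; apply: contraNneq => E.
by rewrite -(nth_index n ns) E nth_index // -index_mem -E index_mem.
Qed.

Section PathFans.
Variables (T : finType) (e : rel T) (W : {set T}) (x : T) (p : seq T).
Hypotheses (es : symmetric e) (longest_p : longest_upath e W x p (last x p)).
Implicit Types (f n : T) (N : {set T}).

Let pos z := index z (x :: p).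

Lemma path_detour_gap n n' k : n \in x :: p -> n' \in x :: p -> pos n < pos n' ->
  detour e W x p n n' k -> pos n + maxn k 1 < pos n'.
Proof.
move=> np n'p lt [z [z' [enz /long_upath_max1[q /and4P[pq uq qD /eqP lq] sq] ez'n']]].
have [/and4P[pp uxp _ _] _] := longest_p.
have [l [m [r [E posn posn']]]] := split_index uxp np n'p lt.
rewrite /pos posn posn' ltn_add2l ltnS; apply: leq_trans sq _; rewrite ltnNge; apply/negP => le_m.
have [p1 [Ep lp1]] : exists p1, p = p1 ++ m ++ n' :: r /\ last x p1 = n.
  case: l E {posn posn'} => [|y l] [-> ->]; first by exists [::].
  by exists (rcons l n); rewrite last_rcons cat_rcons.
apply: (no_longer_splice longest_p Ep (m' := z :: q)) => //.
- by apply/allP => t /(allP qD)/setDP[].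
- by move=> t /(allP qD)/setDP[_ tP] _; rewrite inE in tP.
rewrite lp1 /= enz cat_path pq lq /= ez'n' /=.
by move: pp; rewrite Ep !cat_path /= => /and4P[].
Qed.

Lemma path_fan_free lam : (size p).+1 < lam -> fan_free e W x p lam.
Proof.
move=> short_p f N fan_fN; have [fP sN N0 fan pairs] := fan_fN; set d := lam - _ in fan.
have on_path n := detour_fan_mem (n := n) fan_fN.
have pos_le n : n \in f |: N -> pos n <= size p by move=> /on_path; rewrite -index_mem ltnS.
have sp : spaced (f |: N) pos.
  move=> n n' nN n'N nn'; rewrite leq_eqVlt (negbTE (index_neq (on_path n nN) nn')) /= => lt.
  have := path_detour_gap (on_path n nN) (on_path n' n'N) lt (pairs n n' nN n'N nn').
  by rewrite maxnn addn1.
have fN : f \in f |: N := setU11 f N.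
have sNfN n : n \in N -> n \in f |: N by move=> nN; apply: setU1r.
pose Nr := [set n in N | pos f < pos n]; pose Nl := [set n in N | pos n < pos f].
have sNr : Nr \subset f |: N by apply/subsetP => n; rewrite inE => /andP[/sNfN].
have sNl : Nl \subset f |: N by apply/subsetP => n; rewrite inE => /andP[/sNfN].
have right_range n : n \in Nr -> pos f + (maxn d 1).+1 <= pos n <= size p.
  rewrite inE => /andP[nN lt]; rewrite pos_le ?sNfN // andbT addnS.
  exact: path_detour_gap fP (on_path n (sNfN n nN)) lt (detour_sym es (fan n nN)).
have left_range n : n \in Nl -> 0 <= pos n <= pos f - (maxn d 1).+1.
  rewrite inE => /andP[nN lt]; have := path_detour_gap (on_path n (sNfN n nN)) fP lt (fan n nN).
  by rewrite -addnS => le_f; rewrite leq_subRL ?(leq_trans (leq_addl _ _) le_f) // addnC.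
have card_Nr := card_spaced_le (spacedS sNr sp) right_range.
have card_Nl := card_spaced_le (spacedS sNl sp) left_range.
have card_all : 2 * #|f |: N| <= (size p).+2 - 0 by apply: card_spaced_le sp _ => n /pos_le.
have card_N : #|N| <= #|Nl| + #|Nr|.
  apply: leq_trans (cardsU_le _ _); apply: subset_leq_card; apply/subsetP => n nN.
  rewrite in_setU !inE nN /=; have /andP[np nf] := sN n nN.
  by case: ltngtP (index_neq np nf).
have right_room : 0 < #|Nr| -> pos f + (maxn d 1).+1 <= size p.
  by move=> /card_gt0P[n /right_range/andP[]]; apply: leq_trans.
have left_room : 0 < #|Nl| -> (maxn d 1).+1 <= pos f.
  move=> /card_gt0P[n]; rewrite inE => /andP[nN lt].
  have := path_detour_gap (on_path n (sNfN n nN)) fP lt (fan n nN).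
  by apply: leq_trans; rewrite ltnS leq_addl.
have N1 : 0 < #|N| by rewrite card_gt0.
have pos_f := pos_le f fN; rewrite (card_detour_fan fan_fN) in card_all.
move: card_Nr card_Nl card_N right_room left_room N1 pos_f card_all short_p; rewrite /d.
by move: #|Nr| #|Nl| #|N| (pos f) (size p); clear; lia.
Qed.

End PathFans.

Section CycleFans.
Variables (T : finType) (e : rel T) (B W : {set T}) (x : T) (p : seq T).
Hypotheses (es : symmetric e) (sWB : W \subset B).
Implicit Types (f n : T) (N : {set T}) (H : seq T).

Lemma arc_detour_gap H j a b s rest k : longest_cycle_in e B H -> H =i x :: p ->
  rot j H = (a :: s) ++ b :: rest -> detour e W x p a b k -> maxn k 1 <= size s.
Proof.
move=> lH EH E [z [z' [eaz /long_upath_max1 L ez'b]]].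
apply: (longest_cycle_gap lH E _ _ L eaz ez'b).
  exact: subset_trans (subsetDl _ _) sWB.
by apply/subsetP => w /setDP[_]; rewrite in_setC !in_set EH.
Qed.

Lemma cycle_detour_gap H n n' k : longest_cycle_in e B H -> H =i x :: p ->
  n \in H -> n' \in H -> index n H < index n' H -> detour e W x p n n' k ->
  index n H + maxn k 1 < index n' H /\ index n' H + maxn k 1 < size H + index n H.
Proof.
move=> lH EH nH n'H lt det; have [cH _ _] := lH.
have [l [m [r [E posn posn']]]] := split_index (cycle_seq_uniq cH) nH n'H lt.
have [i Ei] := @rot_cat_swap _ H l (n :: m ++ n' :: r) 0 (etrans (rot0 H) E).
have gap_m := arc_detour_gap (s := m) (rest := r ++ l) lH EH (etrans Ei _) det.
have [j Ej] := @rot_cat_swap _ H (l ++ n :: m) (n' :: r) 0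
  (etrans (rot0 H) (etrans E (catA l (n :: m) _))).
have gap_r := arc_detour_gap (s := r ++ l) (rest := m) lH EH (etrans Ej _) (detour_sym es det).
have sizeH : size H = size l + (size m + (size r).+1).+1 by rewrite E size_cat /= size_cat.
have {}gap_m := gap_m (esym (catA (n :: m) _ _)); rewrite size_cat in gap_r.
have {}gap_r := gap_r (catA (n' :: r) _ _).
rewrite posn posn' sizeH; move: gap_m gap_r.
by move: (size l) (size m) (size r); clear; lia.
Qed.

Lemma cycle_fan_free : longest_cycle_in e B (x :: p) -> fan_free e W x p (size p).+1.
Proof.
move=> lP f N fan_fN; have [fP sN N0 fan pairs] := fan_fN; set d := _ - _ in fan.
have [r H' EH] := rot_to fP; set H := f :: H' in EH.
have memH : H =i x :: p by move=> z; rewrite -EH mem_rot.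
have sizeH : size H = (size p).+1 by rewrite -EH size_rot.
have lH : longest_cycle_in e B H.
  have [/and3P[_ uP cP] sPB maxP] := lP; split=> [|z|]; rewrite ?sizeH //.
    by rewrite /cycle_seq sizeH -EH rot_uniq uP rot_cycle.
  by rewrite memH; apply: sPB.
pose pos z := index z H.
have on_cycle n : n \in f |: N -> n \in H by rewrite memH; apply: detour_fan_mem fan_fN.
have pos_lt n : n \in f |: N -> pos n < (size p).+1 by move=> /on_cycle; rewrite -index_mem sizeH.
have gap n n' k : n \in f |: N -> n' \in f |: N -> pos n < pos n' -> detour e W x p n n' k ->
    pos n + maxn k 1 < pos n' /\ pos n' + maxn k 1 < size H + pos n.
  by move=> /on_cycle nH /on_cycle n'H; apply: cycle_detour_gap.
have sp : spaced (f |: N) pos.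
  move=> n n' nN n'N nn'; rewrite leq_eqVlt (negbTE (index_neq (on_cycle n nN) nn')) /= => lt.
  by have [] := gap n n' 1 nN n'N lt (pairs n n' nN n'N nn'); rewrite maxnn addn1.
have fN : f \in f |: N := setU11 f N.
have sNfN n : n \in N -> n \in f |: N by move=> nN; apply: setU1r.
have pos_f : pos f = 0 by rewrite /pos /H /= eqxx.
have range n : n \in N -> (maxn d 1).+1 <= pos n <= (size p).+1 - (maxn d 1).+1.
  move=> nN; have pos_n : pos f < pos n.
    by have /andP[_ nf] := sN n nN; rewrite pos_f lt0n -pos_f index_neq // on_cycle ?sNfN.
  have := gap f n d fN (sNfN n nN) pos_n (detour_sym es (fan n nN)).
  by rewrite pos_f sizeH addn0 add0n; clear; lia.
have card_N := card_spaced_le (spacedS (subsetUr [set f] N) sp) range.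
have card_all : 2 * #|f |: N| <= ((size p).+1 - (maxn d 1).+1).+2 - 0.
  by apply: card_spaced_le sp _ => n /setU1P[->|/range/andP[]]; rewrite ?pos_f.
have N1 : 0 < #|N| by rewrite card_gt0.
have room : (maxn d 1).+1 <= (size p).+1 - (maxn d 1).+1.
  by have /card_gt0P[n /range/andP[]] := N1; apply: leq_trans.
rewrite (card_detour_fan fan_fN) in card_all; move: card_N card_all room N1; rewrite /d.
by move: #|N| (size p); clear; lia.
Qed.

End CycleFans.

Section PendantSets.
Variables (T : finType) (e : rel T).
Hypotheses (es : symmetric e) (ei : irreflexive e).
Implicit Types (B I J : {set T}) (a b v : T) (d : nat) (q : seq T).

(* A lobe avoiding the neighbours of b would be a smaller set of the same kind, attached at its cut
   vertex; otherwise the neighbours of b are the marks of rooted_long_upath. *)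
Lemma pendant_long_cycle B d I b : lobe e B b I -> (exists2 a, a \in I & e b a) ->
  {in I, forall v, d <= #|nbhd e B v|} ->
  exists q, [/\ cycle_seq e q, {subset q <= b |: I} & d < size q].
Proof.
have [k] := ubnP #|I|; elim: k I b => // k IH I b le_k lI [a aI eba] deg.
have /lobeP[_ cI closedI] := lI; have bI := lobe_notin lI.
have cbI : connected_on e (b |: I) by apply: connected_onU1 eba.
have setIbI : (b |: I) :&: I = I by apply/setIidPr/subsetUr.
have [/existsP[v /existsP[J /and5P[vbI lJ bJ J0 /eqP unmarked]]]|marked] :=
    boolP [exists v, exists J : {set T}, [&& v \in b |: I, lobe e (b |: I) v J, b \notin J,
      J :&: I != set0 & J :&: nbhd e I b == set0]].
  have /lobeP[sJ _ _] := lJ; have /set0Pn[z /setIP[zJ _]] := J0.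
  have sJI : J \subset I.
    apply/subsetP => w wJ; have := subsetP sJ w wJ; rewrite in_setD1 in_setU1 => /andP[_].
    by case/orP=> // /eqP wb; rewrite -wb wJ in bJ.
  have v_att := lobe_attached es cbI vbI lJ zJ.
  have vI : v \in I.
    move: vbI; rewrite in_setU1 => /orP[/eqP vb|//]; have [w wJ evw] := v_att.
    by have := in_set0 w; rewrite -unmarked in_setI wJ in_nbhd (subsetP sJI) // -vb evw.
  have lt : #|J| < #|I|.
    by rewrite proper_card //; apply/properP; split=> //; exists v; rewrite ?(lobe_notin lJ).
  have [|q [cq sq lq]] := IH J v (leq_trans lt le_k) (lobe_trans lI lJ bJ) v_att.
    by move=> w /(subsetP sJI); apply: deg.
  exists q; split=> // w /sq/setU1P[->|/(subsetP sJI)]; rewrite in_setU1 ?vI ?orbT // => ->.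
  by rewrite orbT.
have [||v J vbI lJ bJ J0|m /[1!in_nbhd] /andP[mI ebm] [q uq sq]] :=
    rooted_long_upath (K := I) (M := nbhd e I b) (d := d) es ei (setU11 b I) cbI.
- by exists a; rewrite ?setIbI //; apply: contraNneq bI => <-.
- rewrite setIbI => v vI _; apply: leq_trans (deg v vI) (subset_leq_card _).
  apply/subsetP => w; rewrite !in_nbhd => /andP[wB evw].
  by rewrite evw (closedI v).
- apply: contraNneq marked => unmarked; apply/existsP; exists v; apply/existsP; exists J.
  by rewrite vbI lJ bJ J0 unmarked /=.
have [cq sub_q] := upath_cycle_seq uq ebm.
by exists (m :: q).
Qed.

End PendantSets.

(** * Biconnected sets and blocks *)

Section Separators.
Variables (T : finType) (e : rel T).
Implicit Types (A D S W X high : {set T}).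

(* W consists of what is reachable from X before crossing S, together with S itself. *)
Lemma separator_boundary A high D X S : X \subset D ->
  separates (rel_on e D) X (boundary e A high D) S ->
  exists W, [/\ X \subset W, W \subset D & boundary e A high W \subset S].
Proof.
move=> sXD sepS.
pose Z := [set w in D :\: S | [exists a in X :\: S, connect (rel_on e (D :\: S)) a w]].
have Z_closed w z : w \in Z -> z \in D -> e w z -> z \notin S -> z \in Z.
  rewrite inE => /andP[wD /exists_inP[a aX caw]] zD ewz zS.
  have zDS : z \in D :\: S by rewrite in_setD zS.
  rewrite inE zDS; apply/exists_inP; exists a => //; apply: connect_trans caw (connect1 _).
  by rewrite /rel_on wD zDS ewz.
have sZ z : z \in Z -> z \in D :\: S by rewrite inE => /andP[].
exists (X :|: Z :|: (S :&: D)); set W := _ :|: _.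
have W_Z w : w \in W -> w \notin S -> w \in Z.
  rewrite !in_setU in_setI => /orP[/orP[wX|//]|/andP[-> //]] wS.
  have wDS : w \in D :\: S by rewrite in_setD wS (subsetP sXD).
  by rewrite inE wDS; apply/exists_inP; exists w; rewrite ?in_setD ?wS.
split; first by rewrite /W -setUA subsetUl.
  by rewrite !subUset sXD subsetIr andbT; apply/subsetP => z /sZ/setDP[].
apply/subsetP => w /boundaryP[wW w_bd]; apply: contraT => wS; have wZ := W_Z w wW wS.
have /setDP[wD _] := sZ w wZ.
have w_int : w \notin boundary e A high D.
  apply/negP => w_bdD; move: wZ; rewrite inE => /andP[_ /exists_inP[a /setDP[aX aS] caw]].
  have /forall_inP/(_ a aX)/forall_inP/(_ w w_bdD)/negP := sepS; apply.
  rewrite aS wS /=; move: caw; apply: connect_sub => s t /and3P[/setDP[sD sS] /setDP[tD tS] est].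
  by apply: connect1; rewrite /rel_on sD tD est !in_setC sS tS.
case/boundaryP: w_int; split=> //; case: w_bd => [|[z /setDP[zA zW] ewz]]; first by left.
right; exists z => //; rewrite in_setD zA andbT; apply: contra zW => zD.
rewrite /W !in_setU in_setI zD andbT; case: (boolP (z \in S)) => [|zS]; first by rewrite orbT.
by rewrite (Z_closed w z wZ zD ewz zS) orbT.
Qed.

End Separators.

Section Biconnected.
Variables (T : finType) (e : rel T).
Hypothesis es : symmetric e.
Implicit Types (A B D I W X Y high : {set T}) (a b r s t v w z : T).

Definition biconnected A := forall w, A :\ w != set0 /\ connected_on e (A :\ w).

Lemma cycle_biconnected c : 1 < size c -> cycle_seq e c -> biconnected [set z in c].
Proof.
move=> c1 cc w; have uc := cycle_seq_uniq cc; have cyc := cycle_seq_cycle c1 cc; split.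
  rewrite -card_gt0; have := cardsD1 w [set z in c]; rewrite card_set_seq //.
  by move: c1; case: (_ \in _); clear; lia.
have [wc|wc] := boolP (w \in c); last first.
  have -> : [set z in c] :\ w = [set z in c].
    by apply/setP => z; rewrite in_setD1; case: eqVneq => //= ->; rewrite inE (negbTE wc).
  case: (c) c1 cyc => //= a q _; rewrite rcons_path => /andP[pq _]; exact: connected_on_path.
have [i t E] := rot_to wc; have ut : uniq (w :: t) by rewrite -E rot_uniq.
have -> : [set z in c] :\ w = [set z in t].
  apply/setP => z; rewrite in_setD1 !in_set -(mem_rot i) E in_cons.
  by case: eqVneq => //= ->; case/andP: ut => /negbTE->.
have : cycle e (w :: t) by rewrite -E rot_cycle.
have : 0 < size t by rewrite -ltnS -[(size t).+1]/(size (w :: t)) -E size_rot.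
case: t {E ut} => // a t _ /=; rewrite rcons_path => /and3P[_ pt _]; exact: connected_on_path.
Qed.

(* A' is w together with the component of A :\ w that contains X. *)
Lemma biconnected_shrink X A w : biconnected X -> X \subset A -> ~~ connected_on e (A :\ w) ->
  exists A', [/\ X \subset A', A' \subset A, #|A'| < #|A|, w \notin A :\: A' &
    forall r k, r \in A :\: A' -> k \in A' -> e r k -> k = w].
Proof.
move=> bX sXA disc; have [/set0Pn[y yX] cX] := bX w.
have sub : X :\ w \subset A :\ w by apply: setSD.
have yA := subsetP sub y yX.
pose K := component e (A :\ w) y; have sK : K \subset A :\ w by apply: component_sub.
pose A' := K :|: (A :&: [set w]).
have sA' : A' \subset A by rewrite subUset subsetIl andbT; apply: subset_trans sK (subsetDl _ _).
exists A'; split=> //.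
- apply/subsetP => z zX; rewrite in_setU in_setI in_set1 (subsetP sXA) //=.
  have [->|zw] := eqVneq z w; rewrite ?orbT // orbF.
  have zXw : z \in X :\ w by rewrite in_setD1 zw.
  by rewrite inE (subsetP sub _ zXw); apply: connect_rel_onS sub _; apply: (connected_onP _ _ cX).
- rewrite ltnNge; apply: contra disc => le_A.
  have EA : A' = A by apply/eqP; rewrite eqEcard sA' le_A.
  suff -> : A :\ w = K by apply: component_connected.
  apply/eqP; rewrite eqEsubset sK andbT; apply/subsetP => z /setD1P[zw].
  by rewrite -{1}EA in_setU in_setI in_set1 (negbTE zw) andbF orbF.
- by apply/negP => /setDP[wA]; rewrite in_setU in_setI wA set11 orbT.
- move=> r k /setDP[rA rA'] kA' erk; apply: contraNeq rA' => kw.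
  have kK : k \in K by move: kA'; rewrite in_setU in_setI in_set1 (negbTE kw) andbF orbF.
  rewrite in_setU in_setI in_set1 rA /=; have [->|rw] := eqVneq r w; rewrite ?orbT // orbF.
  by apply: (component_closed kK); rewrite ?in_setD1 ?rw // es.
Qed.

Lemma connect_first_exit A A' z t : z \in A -> connect (rel_on e A') z t ->
  (t \in A /\ connect (rel_on e A) z t) \/
  exists y r, [/\ y \in A, connect (rel_on e A) z y, r \in A' :\: A & e y r].
Proof.
move=> zA /connectP[q pq ->]; elim: q z zA pq => [|b q IH] z zA /=; first by left; rewrite connect0.
move=> /andP[/and3P[_ bA' ezb] pq]; case: (boolP (b \in A)) => bA; last first.
  by right; exists z, b; rewrite connect0 in_setD bA.
have czb : connect (rel_on e A) z b by apply: connect1; rewrite /rel_on zA bA.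
case: (IH b bA pq) => [[tA cbt]|[y [r [yA cby rD eyr]]]]; [left|right].
  by split=> //; apply: connect_trans czb cbt.
by exists y, r; split=> //; apply: connect_trans czb cby.
Qed.

Definition single_foot B D := [forall z in B :\: D, #|nbrs e D (component e (B :\: D) z)| <= 1].

Lemma single_footP B D : reflect
  (forall z z' w w', z \in B :\: D -> connect (rel_on e (B :\: D)) z z' -> w \in D -> w' \in D ->
     e z w -> e z' w' -> w = w')
  (single_foot B D).
Proof.
apply: (iffP forall_inP) => [foot z z' w w' zD czz' wD w'D ezw ez'w'|foot z zD].
  apply: (card_le1_eqP (foot z zD)); apply/nbrsP; split=> //.
    by exists z' => //; rewrite inE czz' (connect_rel_on_mem czz').
  by exists z => //; apply: mem_component.
apply/card_le1_eqP => w w' /nbrsP[wD [y /[1!inE] /andP[yD czy] eyw]].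
move=> /nbrsP[w'D [y' /[1!inE] /andP[y'D czy'] ey'w']].
apply: (foot y' y w' w) => //; apply: connect_trans czy.
by rewrite connect_rel_on_sym.
Qed.

Lemma single_foot_shrink B D D' w : D \subset B -> D' \subset D -> single_foot B D ->
  (forall r k, r \in D :\: D' -> k \in D' -> e r k -> k = w) -> single_foot B D'.
Proof.
move=> sDB sD' /single_footP foot cut; apply/single_footP.
have stay z z' v : z \in B :\: D -> connect (rel_on e (B :\: D')) z z' -> v \in D' -> e z v ->
    z' \in B :\: D /\ connect (rel_on e (B :\: D)) z z'.
  move=> zD c vD' ezv; case: (connect_first_exit zD c) => // -[y [r [yD cy rD eyr]]].
  have /setDP[rD0 rD'] : r \in D :\: D'.
    move: rD; rewrite !in_setD negb_and negbK.
    by case/andP=> [/orP[->|/negbTE->] /andP[->]]; rewrite ?andbF.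
  have E := foot z y v r zD cy (subsetP sD' v vD') rD0 ezv eyr.
  by rewrite -E vD' in rD'.
have foot_w z v : z \in B :\: D' -> z \notin B :\: D -> v \in D' -> e z v -> v = w.
  move=> /setDP[zB zD']; rewrite in_setD zB andbT negbK => zD vD' ezv.
  by apply: (cut z v) => //; rewrite in_setD zD'.
move=> z z' v v' zD' c vD' v'D' ezv ez'v'.
case: (boolP (z \in B :\: D)) => zD.
  have [z'D c'] := stay z z' v zD c vD' ezv.
  by apply: (foot z z') => //; apply: (subsetP sD').
case: (boolP (z' \in B :\: D)) => z'D.
  have c' : connect (rel_on e (B :\: D')) z' z by rewrite connect_rel_on_sym.
  by have [zD0 _] := stay z' z v' z'D c' v'D' ez'v'; rewrite zD0 in zD.
by rewrite (foot_w z v) // (foot_w z' v') //; apply: connect_rel_on_mem c zD'.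
Qed.

Lemma block_exists B X : biconnected X -> X \subset B ->
  exists D, [/\ X \subset D, D \subset B, single_foot B D & biconnected D].
Proof.
move=> bX sXB.
have goodB : [&& X \subset B, B \subset B & single_foot B B].
  by rewrite sXB subxx; apply/single_footP => z z' w w'; rewrite setDv in_set0.
have [D [/and3P[sXD sDB footD] _ minD]] :=
  lex_min_set (Q := fun D => [&& X \subset D, D \subset B & single_foot B D]) (fun _ => 0) goodB.
exists D; split=> // w; split.
  by have [X0 _] := bX w; apply: contra X0 => /eqP D0; rewrite -subset0 -D0 setSD.
apply: contraT => /(biconnected_shrink bX sXD)[D' [sXD' sD' lt_D _ cut]].
have := minD D'; rewrite sXD' (subset_trans sD' sDB) (single_foot_shrink sDB sD' footD cut).
by move=> /(_ isT lt_D).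
Qed.

(* Cutting W at w would trade a boundary vertex behind w for w itself. *)
Lemma min_boundary_biconnected B high X D W : biconnected X -> X \subset W -> W \subset D ->
  D \subset B -> biconnected D ->
  (forall W', (X \subset W') && (W' \subset D) -> #|W'| < #|W| ->
     #|boundary e B high W| < #|boundary e B high W'|) ->
  biconnected W.
Proof.
move=> bX sXW sWD sDB bD minW w; split.
  by have [X0 _] := bX w; apply: contra X0 => /eqP W0; rewrite -subset0 -W0 setSD.
apply: contraT => /(biconnected_shrink bX sXW)[W' [sXW' sW' lt_W wW' cut]].
have := minW W'; rewrite sXW' (subset_trans sW' sWD) => /(_ isT lt_W); rewrite ltnNge => /negP[].
have [s sR s_bd] : exists2 s, s \in W :\: W' & s \in boundary e B high W.
  have [/exists_inP//|none] := boolP [exists s in W :\: W', s \in boundary e B high W].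
  have [r rR] : exists r, r \in W :\: W'.
    by apply/set0Pn; rewrite setD_eq0; apply: contraL lt_W => /subset_leq_card; rewrite leqNgt.
  have [/set0Pn[t /setD1P[tw tX]] _] := bX w; have [_ /connected_onP cD] := bD w.
  have tR : t \in W :\: W'.
    apply: (connect_rel_on_closed _ rR (cD r t _ _)); last first.
    - by rewrite in_setD1 tw (subsetP sWD) // (subsetP sXW).
    - rewrite in_setD1 (subsetP sWD) ?andbT; first by apply: contraNneq wW' => <-.
      by case/setDP: rR.
    move=> a b aR /setD1P[bw bD'] eab; have /setDP[aW _] := aR.
    case: (boolP (b \in W)) => bW.
      rewrite in_setD bW andbT; apply/negP => bW'.
      by rewrite (cut a b aR bW' eab) eqxx in bw.
    case/negP: none; apply/exists_inP; exists a => //; apply/boundaryP; split=> //.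
    by right; exists b => //; rewrite in_setD bW (subsetP sDB).
  by move: tR; rewrite in_setD (subsetP sXW').
have sub : boundary e B high W' \subset w |: (boundary e B high W :\ s).
  apply/subsetP => v /boundaryP[vW' v_bd]; rewrite in_setU1; have [//|vw] := eqVneq v w.
  have vs : v != s by apply: contraTneq vW' => ->; case/setDP: sR.
  rewrite in_setD1 vs /=; apply/boundaryP; split; first exact: (subsetP sW').
  case: v_bd => [|[z /setDP[zB zW'] evz]]; [by left|right; exists z => //].
  rewrite in_setD zB andbT; apply/negP => zW; have ezv : e z v by rewrite es.
  by rewrite (cut z v _ vW' ezv) ?eqxx // in_setD zW' in vw.
rewrite [X in _ <= X](cardsD1 s) s_bd add1n.
exact: leq_trans (subset_leq_card sub) (cardsU1_le _ _).
Qed.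

Lemma biconnected_separator A X Y S : biconnected A -> X \subset A -> Y \subset A ->
  1 < #|X| -> 1 < #|Y| -> separates (rel_on e A) X Y S -> 1 < #|S|.
Proof.
move=> bA sXA sYA X1 Y1 sepS; rewrite ltnNge; apply/negP => S1.
have [w Sw] : exists w, S \subset [set w].
  have [->|/set0Pn[w wS]] := eqVneq S set0.
    by have /card_gt0P[w _] := ltnW X1; exists w; apply: sub0set.
  by exists w; apply/subsetP => z zS; rewrite in_set1 (card_le1_eqP S1 z w).
have avoid_w (Z : {set T}) : 1 < #|Z| -> exists2 z, z \in Z & z != w.
  move=> Z1; have /card_gt0P[z /setD1P[zw zZ]] : 0 < #|Z :\ w|; last by exists z.
  by move: Z1; rewrite (cardsD1 w Z); case: (_ \in _) => // /ltnW.
have notS z : z != w -> z \notin S by apply: contra => /(subsetP Sw); rewrite in_set1.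
have [x xX xw] := avoid_w X X1; have [y yY yw] := avoid_w Y Y1.
have /forall_inP/(_ x xX)/forall_inP/(_ y yY)/negP := sepS; apply; rewrite !notS //=.
have [_ /connected_onP cA] := bA w; have := cA x y.
rewrite !in_setD1 xw yw (subsetP sXA) // (subsetP sYA) // => /(_ isT isT).
apply: connect_sub => s t /and3P[/setD1P[sw sA] /setD1P[tw tA] est].
by apply: connect1; rewrite /rel_on sA tA est !in_setC !notS.
Qed.

Lemma biconnected_lobe_sub B W b I a : biconnected W -> W \subset B -> lobe e B b I ->
  I \subset W -> a \in I -> W :\ b \subset I.
Proof.
move=> bW sWB lI sIW aI; have /lobeP[_ _ closedI] := lI; have bI := lobe_notin lI.
apply/subsetP => t tWb; have [_ /connected_onP cW] := bW b.
apply: (connect_rel_on_closed _ aI (cW a t _ tWb)).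
  move=> z w zI /setD1P[wb wW] ezw.
  by have := closedI z w zI (subsetP sWB w wW) ezw; rewrite in_setU1 (negbTE wb).
by rewrite in_setD1 (subsetP sIW) // andbT; apply: contraNneq bI => <-.
Qed.

Lemma path_rel_on_set A x q : x \in A -> path (rel_on e A) x q ->
  connected_on e [set z in x :: q] /\ [set z in x :: q] \subset A.
Proof.
move=> xA /(rel_on_path xA)[pq qA]; split; first exact: connected_on_path.
by apply/subsetP => z; rewrite inE => /(allP qA).
Qed.

Lemma biconnected_half_cycle A c a b : biconnected A -> 1 < size c -> cycle_seq e c ->
  [set z in c] \subset A -> a \in A -> b \in A -> a != b ->
  long_upath e A a b (size c)./2.+1.
Proof.
move=> bA c1 cc scA aA bA' nab; have uc := cycle_seq_uniq cc.
have sabA : [set a; b] \subset A by rewrite subUset !sub1set aA.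
have card_ab : #|[set a; b]| = 2 by rewrite cards2 nab.
have [[U [g [cU linkage_g]]]|[S sepS]] :=
    menger_crossing (rel_on e A) [set a; b] [set z in c] 2; last first.
  rewrite ltnNge (biconnected_separator bA sabA scA _ _ sepS) ?card_ab //.
  by rewrite card_set_seq.
have [sU gP dU] := linkage_g.
have EU : U = [set a; b] by apply/eqP; rewrite eqEcard sU cU card_ab.
have pathP y : y \in [set a; b] -> [/\ connected_on e [set z in y :: g y],
    [set z in y :: g y] \subset A, last y (g y) \in c &
    [set z in y :: g y] :&: [set z in c] \subset [set last y (g y)]].
  move=> yab; have yU : y \in U by rewrite EU.
  have [pg _ lc _ _] := gP y yU; have [_ meet_c] := crossing_linkage_meet linkage_g yU.
  have [cg sg] := path_rel_on_set (subsetP sabA y yab) pg.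
  by split=> //; rewrite inE in lc.
have [ca sa la meet_a] := pathP a (set21 a b); have [cb sb lb meet_b] := pathP b (set22 a b).
have disj z : z \in a :: g a -> z \in b :: g b -> False.
  move=> za zb; case/eqP: nab; apply: (dU a b z) => //; rewrite EU; [exact: set21 | exact: set22].
have nlast : last a (g a) != last b (g b).
  by apply/eqP => E; apply: (disj (last a (g a))); rewrite ?mem_last // E mem_last.
have mem_last_set y : last y (g y) \in [set z in y :: g y] by rewrite inE mem_last.
have mem_head_set y : y \in [set z in y :: g y] by rewrite inE mem_head.
have to_b := long_upath_join (connected_on_upath ca (mem_head_set a) (mem_last_set a))
  (long_upath_half es uc (cycle_seq_cycle c1 cc) la lb nlast) meet_a isT.
have meet : ([set z in a :: g a] :|: [set z in c]) :&: [set z in b :: g b]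
    \subset [set last b (g b)].
  rewrite setIUl subUset [[set z in c] :&: _]setIC meet_b andbT.
  by apply/subsetP => z /setIP[]; rewrite !in_set => /disj zb /zb.
have whole := long_upath_join to_b
  (connected_on_upath cb (mem_last_set b) (mem_head_set b)) meet isT.
by apply: long_upathW whole; rewrite ?addn1 // !subUset sa scA sb.
Qed.

End Biconnected.

(** * The order of a graph with a long cycle off a longest cycle *)

Lemma order_bound_small_cycle lam mu h c n : mu <= h -> h <= lam ->
  h.+1 * (lam + mu - h) <= c -> c + h <= n -> mu.+1 * lam.+1 <= n.+1.
Proof.
move=> /subnKC + /subnKC; move: (h - mu) (lam - h) => i j <- <-.
have -> : mu + i + j + mu - (mu + i) = mu + j by lia.
nia.
Qed.

Lemma order_bound_large_cycle lam mu h n : 0 < lam -> 0 < mu -> lam < h ->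
  lam./2.+1 * (2 * mu - (lam < 2)) + h <= n -> mu.+1 * lam.+1 <= n.+1.
Proof.
move=> lam1 mu1 lam_h; have [lam2|lam2] := ltnP lam 2.
  have El : lam = 1 by lia.
  by move: lam_h; rewrite El /=; lia.
have := odd_double_half lam; move: (lam./2) => k; case: (odd lam) => Elam le_n; nia.
Qed.

Definition k_connected_rel (T : finType) (e : rel T) k :=
  forall (S : {set T}) a b, #|S| < k -> a \notin S -> b \notin S -> connect (rel_on e (~: S)) a b.

Section OffCycle.
Variables (T : finType) (e : rel T).
Hypotheses (es : symmetric e) (ei : irreflexive e).
Implicit Types (D I S U W X : {set T}) (a b u v w z : T) (q : seq T).

Lemma longest_cycle_upath B W x p : longest_cycle_in e B (x :: p) ->
  [set z in x :: p] \subset W -> W \subset B -> longest_upath e W x p (last x p).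
Proof.
move=> [cH _ maxH] /subsetP sHW sWB; have uH := cycle_seq_uniq cH.
have closed : 0 < size p -> path e x p && e (last x p) x.
  by move=> p0; have := cycle_seq_cycle (c := x :: p) p0 cH; rewrite /= rcons_path.
split=> [|q uq].
  apply/and4P; split=> //; last by apply/allP => z zH; apply: sHW; rewrite inE.
  by case: (posnP (size p)) => [/size0nil->//|/closed/andP[]].
case: (posnP (size q)) => [->//|q0]; rewrite -ltnS; case: (posnP (size p)) => [/size0nil p0|p0].
  case/and4P: uq => _ uxq _; rewrite p0 /=; case: q q0 uxq => // a q _ /= /andP[].
  by move=> xq _ /eqP lq; rewrite -lq mem_last in xq.
have /andP[_ elx] := closed p0; have [cq sq] := upath_cycle_seq uq elx.
by apply: maxH cq _ => z /sq/(subsetP sWB).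
Qed.

Variables (C : seq T) (lam mu : nat) (x : T) (p : seq T).

Let Cs := [set z in C].
Let B := ~: Cs.
Let H := x :: p.
Let Hs := [set z in H].
Let h := size H.

Hypotheses (lC : longest_cycle_in e setT C) (lH : longest_cycle_in e B H).
Hypothesis deg : forall v, lam + mu <= #|[set w | e v w]|.+1.
Hypothesis mu_le_h : mu <= h.

Let cH : cycle_seq e H. Proof. by case: lH. Qed.
Let sHB : Hs \subset B.
Proof. by case: lH => _ sHB _; apply/subsetP => z; rewrite inE => /sHB. Qed.

Lemma card_cycle_off : #|Hs| = h. Proof. exact/card_set_seq/(cycle_seq_uniq cH). Qed.

Lemma card_longest_cycle : #|Cs| = size C.
Proof. by case: lC => /cycle_seq_uniq/card_set_seq. Qed.

Lemma card_vertices_ge X : X \subset B -> size C + #|X| <= #|T|.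
Proof. by move=> sX; rewrite -card_longest_cycle -(cardsC Cs) leq_add2l subset_leq_card. Qed.

Definition high_vertices k := [set v | k <= #|nbhd e B v|].

Lemma high_vertices_degree k : {in high_vertices k, forall v, k <= #|nbhd e B v|}.
Proof. by move=> v; rewrite inE. Qed.

Lemma low_vertex_nbhd k v : v \notin high_vertices k -> lam + mu - k <= #|nbhd e Cs v|.
Proof.
rewrite inE -ltnNge => low; rewrite leq_subLR; apply: leq_trans (deg v) _.
suff split_nbhd : #|[set w | e v w]| <= #|nbhd e B v| + #|nbhd e Cs v|.
  by apply: leq_trans (_ : _ <= (#|nbhd e B v| + #|nbhd e Cs v|).+1) _;
    rewrite // -addSn leq_add2r.
apply: leq_trans (subset_leq_card _) (cardsU_le _ _); apply/subsetP => w; rewrite inE => evw.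
by rewrite in_setU !in_nbhd evw in_setC; case: (w \in Cs).
Qed.

Lemma branch_nbrs v X : v \in X -> #|nbhd e Cs v| <= #|nbrs e Cs X|.
Proof. by move=> vX; rewrite -nbrs1; apply/subset_leq_card/nbrsS; rewrite sub1set. Qed.

Lemma crossing_linkage_branch D Y U g u : Hs \subset D ->
  crossing_linkage (rel_on e D) Hs Y U g -> u \in U ->
  [/\ connected_on e [set z in u :: g u], [set z in u :: g u] \subset D &
      [set z in u :: g u] :&: Hs = [set u]].
Proof.
move=> sHD linkage_g uU; have [sU gP _] := linkage_g; have [pg _ _ _ _] := gP u uU.
have [cg sg] := path_rel_on_set es (subsetP sHD u (subsetP sU u uU)) pg.
by split=> //; have [] := crossing_linkage_meet linkage_g uU.
Qed.

Section SmallCycle.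
Hypothesis h_le_lam : h <= lam.

Lemma small_cycle_linked U g :
  crossing_linkage (rel_on e B) Hs (boundary e B (high_vertices h) B) U g -> #|U| = h./2.+1 ->
  mu.+1 * lam.+1 <= #|T|.+1.
Proof.
move=> linkage_g cU; have [sU gP dU] := linkage_g; pose br u := [set z in u :: g u].
have brs : branches e C H U br.
  split; last exact: disjoint_on_set_seq dU.
  move=> u uU; have [cg sg meet_H] := crossing_linkage_branch sHB linkage_g uU.
  by split; rewrite ?meet_H // inE mem_head.
have sUH : U \subset H by apply/subsetP => u /(subsetP sU); rewrite inE.
have bound := branch_bound es lC cH sUH sHB brs (R := 2 * h./2.+1).
rewrite cU in bound; have {}bound := bound (leqnn _) _.
have attached_ge u : u \in U -> lam + mu - h <= #|nbrs e Cs (br u)|.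
  move=> uU; have [_ _ l_bd _ _] := gP u uU.
  have low_end : last u (g u) \notin high_vertices h.
    by case/boundaryP: l_bd => _ [//|[z]]; rewrite setDv in_set0.
  have end_br : last u (g u) \in br u by rewrite inE mem_last.
  exact: leq_trans (low_vertex_nbhd low_end) (branch_nbrs end_br).
have sum_ge : h./2.+1 * (lam + mu - h) <= \sum_(u in U) #|nbrs e Cs (br u)|.
  by rewrite -cU -sum_nat_const; apply: leq_sum.
apply: (order_bound_small_cycle mu_le_h h_le_lam (c := size C)); last first.
  by have := card_vertices_ge sHB; rewrite card_cycle_off.
rewrite -(leq_pmul2l (_ : 0 < 2 * h./2.+1)) //; apply: leq_trans (bound _); last first.
  by rewrite -/h; clear; lia.
by rewrite -!mulnA leq_mul2l /= mulnCA leq_mul2l sum_ge.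
Qed.

Lemma small_cycle_confined S : separates (rel_on e B) Hs (boundary e B (high_vertices h) B) S ->
  #|S| <= h./2 -> False.
Proof.
move=> sepS cS; have [W [sHW sWB sbS]] := separator_boundary sHB sepS.
have bd_le : #|boundary e B (high_vertices h) W| <= h./2 := leq_trans (subset_leq_card sbS) cS.
have h1 : h = (size p).+1 by [].
apply: (no_longest_upath es ei sWB (@high_vertices_degree h) (longest_cycle_upath lH sHW sWB)).
- by rewrite h1.
- by move: bd_le; clear; lia.
- by move: bd_le; rewrite h1; clear; lia.
- move=> I b lI sI high_I bW b_att.
  have deg_I v : v \in I -> h <= #|nbhd e B v| by move/(subsetP high_I)/high_vertices_degree.
  have [q [cq sq]] := pendant_long_cycle es ei lI b_att deg_I.
  rewrite ltnNge => /negP[]; case: lH => _ _; apply=> // z /sq/setU1P[->|zI].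
    exact: (subsetP sWB).
  by have /setDP[zW _] := subsetP sI z zI; apply: (subsetP sWB).
- exact: (cycle_fan_free es sWB lH).
Qed.

Lemma order_bound_of_small_cycle : mu.+1 * lam.+1 <= #|T|.+1.
Proof.
have [[U [g [cU linkage_g]]]|[S sepS cS]] :=
    menger_crossing (rel_on e B) Hs (boundary e B (high_vertices h) B) h./2.+1.
  exact: small_cycle_linked linkage_g cU.
by case: (small_cycle_confined sepS cS).
Qed.

End SmallCycle.

Section LargeCycle.
Hypotheses (lam_gt0 : 0 < lam) (mu_gt0 : 0 < mu) (lam_lt_h : lam < h).
Hypothesis mu_connected : k_connected_rel e mu.

Let h_gt1 : 1 < h. Proof. exact: leq_ltn_trans lam_lt_h. Qed.

Let H_biconnected : biconnected e Hs. Proof. exact: (cycle_biconnected es h_gt1 cH). Qed.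

Lemma size_longest_cycle_ge : h <= size C.
Proof. by case: lC => _ _; apply=> // z; rewrite in_setT. Qed.

Section Pods.
Variable D : {set T}.
Hypotheses (sHD : Hs \subset D) (sDB : D \subset B) (footD : single_foot e B D).

(* With a, the neighbours on C of a component of B \ D attached at a separate it from the rest of H,
   so connectivity bounds their number from below. *)
Lemma component_nbrs z a (Q := component e (B :\: D) z) : z \in B :\: D -> a \in D -> e z a ->
  mu <= #|nbrs e Cs Q|.+1 /\ lam + mu <= #|nbrs e Cs Q| + #|Q| + 1.
Proof.
move=> zD aD eza; have zQ : z \in Q by apply: mem_component.
have Q_nbrs b w : b \in Q -> e b w -> [|| w \in nbrs e Cs Q, w == a | w \in Q].
  move=> bQ ebw; case: (boolP (w \in Cs)) => wC.
    by apply/orP; left; apply/nbrsP; split=> //; exists b.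
  have wB : w \in B by rewrite in_setC.
  apply/orP; right; case: (boolP (w \in D)) => wD.
    have czb : connect (rel_on e (B :\: D)) z b by move: bQ; rewrite inE => /andP[].
    by rewrite (single_footP es _ _ footD z b a w) ?eqxx.
  by rewrite (component_closed bQ _ ebw) ?orbT // in_setD wD.
split.
  apply: leq_trans (cardsU1_le a _); rewrite leqNgt; apply/negP => lt.
  have [/set0Pn[t /setD1P[ta tH]] _] := H_biconnected a; have tD := subsetP sHD t tH.
  have notin_cut v : v \in B -> v != a -> v \notin a |: nbrs e Cs Q.
    move=> vB va; rewrite in_setU1 (negbTE va); apply: contraTN vB => /nbrsP[vC _].
    by rewrite in_setC vC.
  have /setDP[zB znD] := zD; have za : z != a by apply: contraNneq znD => ->.
  have := mu_connected lt (notin_cut z zB za) (notin_cut t (subsetP sDB t tD) ta) => czt.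
  have : t \in Q.
    apply: (connect_rel_on_closed _ zQ czt) => b w bQ; rewrite in_setC in_setU1 negb_or.
    by move=> /andP[wa wN] /(Q_nbrs b w bQ); rewrite (negbTE wa) (negbTE wN).
  by move=> /(subsetP (component_sub _ _ _)); rewrite in_setD tD.
have sub : [set w | e z w] \subset (a |: nbrs e Cs Q) :|: (Q :\ z).
  apply/subsetP => w; rewrite inE => ezw; have := Q_nbrs z w zQ ezw.
  rewrite in_setU in_setU1 in_setD1.
  have -> : w != z by apply: contraTneq ezw => ->; rewrite ei.
  by case/or3P=> ->; rewrite ?orbT.
rewrite (cardsD1 z Q) zQ; apply: leq_trans (deg z) _.
rewrite addn1 ltnS addnCA add1n -addSn; apply: leq_trans (subset_leq_card sub) _.
by apply: leq_trans (cardsU_le _ _) _; rewrite leq_add2r cardsU1_le.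
Qed.

Definition pod v := if v \in high_vertices lam then
  if [pick z in B :\: D | e z v] is Some z then component e (B :\: D) z else set0 else set0.

Lemma pod_sub v : pod v \subset B :\: D.
Proof.
rewrite /pod; case: ifP => _; rewrite ?sub0set //.
by case: pickP => [z _|_]; [apply: component_sub | apply: sub0set].
Qed.

Lemma podP v : v \in boundary e B (high_vertices lam) D ->
  (pod v = set0 /\ mu <= #|nbhd e Cs v|) \/
  exists z, [/\ z \in B :\: D, e z v & pod v = component e (B :\: D) z].
Proof.
move=> /boundaryP[vD v_bd]; rewrite /pod; case: ifP => [v_high|/negbT v_low]; last first.
  by left; split=> //; have := low_vertex_nbhd v_low; rewrite addKn.
right; case: pickP => [z /andP[zD ezv]|none]; first by exists z.
case: v_bd => [|[z zD evz]]; first by rewrite v_high.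
by have := none z; rewrite zD es evz.
Qed.

Lemma pod_nbrs_ge v X : v \in boundary e B (high_vertices lam) D -> v \in X -> pod v \subset X ->
  2 * mu - (lam < 2) <= 2 * #|nbrs e Cs X| + #|pod v|.
Proof.
move=> v_bd vX sX; have le_X := subset_leq_card (nbrsS e Cs sX).
have [[E mu_le]|[z [zD ezv E]]] := podP v_bd.
  have := leq_trans mu_le (branch_nbrs vX); clear; lia.
have vD : v \in D by case/boundaryP: v_bd.
have [mu_le degQ] := component_nbrs zD vD ezv; rewrite -E in mu_le degQ.
by move: le_X mu_le degQ lam_gt0; clear; lia.
Qed.

Lemma pod_inj u v t :
  u \in boundary e B (high_vertices lam) D -> v \in boundary e B (high_vertices lam) D ->
  t \in pod u -> t \in pod v -> u = v.
Proof.
move=> u_bd v_bd; have [uD vD] : u \in D /\ v \in D.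
  by split; [case/boundaryP: u_bd | case/boundaryP: v_bd].
have [[-> _]|[z [zD ezu ->]]] := podP u_bd; first by rewrite in_set0.
have [[-> _]|[z' [z'D ez'v ->]]] := podP v_bd; first by rewrite in_set0.
rewrite ![t \in component _ _ _]inE => /andP[_ czt] /andP[_ cz't].
apply: (single_footP es _ _ footD z z') => //; apply: connect_trans czt _.
by rewrite connect_rel_on_sym.
Qed.

Section Linked.
Variables (U : {set T}) (g : T -> seq T).
Hypothesis linkage_g : crossing_linkage (rel_on e D) Hs (boundary e B (high_vertices lam) D) U g.
Hypothesis card_U : #|U| = lam./2.+1.

Let ends u := last u (g u).
Let trunk u := [set z in u :: g u].
Let br u := trunk u :|: pod (ends u).

Let ends_bd u : u \in U -> ends u \in boundary e B (high_vertices lam) D.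
Proof. by case: linkage_g => _ gP _ /gP[]. Qed.

Let ends_trunk u : ends u \in trunk u. Proof. by rewrite inE mem_last. Qed.

Let trunk_sub u : u \in U -> trunk u \subset D.
Proof. by move=> uU; have [] := crossing_linkage_branch sHD linkage_g uU. Qed.

Let dU : disjoint_on U trunk.
Proof. by case: linkage_g => _ _ /disjoint_on_set_seq. Qed.

Lemma disjoint_pods : disjoint_on U (fun u => pod (ends u)).
Proof.
move=> u v t uU vU tu tv; have E := pod_inj (ends_bd uU) (ends_bd vU) tu tv.
by apply: (dU uU vU (ends_trunk u)); rewrite E ends_trunk.
Qed.

Lemma trunk_pod_branches : branches e C H U br.
Proof.
have D_pod t v : t \in D -> t \in pod v = false.
  by move=> tD; apply: contraTF tD => /(subsetP (pod_sub v))/setDP[].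
split=> [u uU|u v t uU vU]; last first.
  rewrite !in_setU => /orP[tu|tu] /orP[tv|tv].
  - exact: dU uU vU tu tv.
  - by rewrite D_pod ?(subsetP (trunk_sub uU)) in tv.
  - by rewrite D_pod ?(subsetP (trunk_sub vU)) in tu.
  - exact: disjoint_pods uU vU tu tv.
have [ct st meet_H] := crossing_linkage_branch sHD linkage_g uU; split.
- have [[E _]|[z [zD ez E]]] := podP (ends_bd uU); first by rewrite /br E setU0.
  have -> : br u = trunk u :|: (ends u |: pod (ends u)).
    by apply/setP => t; rewrite !in_setU in_set1; case: eqVneq => [->|//]; rewrite ends_trunk.
  apply: (connected_onU es ct _ (ends_trunk u) (setU11 _ _)).
  apply: (connected_onU1 es (y := z)); rewrite ?E ?mem_component 1?es //.
  exact: component_connected.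
- by rewrite in_setU inE mem_head.
- apply/subsetP => t /setIP[/setUP[tu|tu] tH]; first by rewrite -meet_H in_setI tH tu.
  by rewrite D_pod ?(subsetP sHD) in tu.
- rewrite subUset (subset_trans st sDB).
  exact: subset_trans (pod_sub _) (subsetDl _ _).
Qed.

Lemma large_cycle_linked : mu.+1 * lam.+1 <= #|T|.+1.
Proof.
apply: (order_bound_large_cycle lam_gt0 mu_gt0 lam_lt_h); have [sU _ _] := linkage_g.
have sUH : U \subset H by apply/subsetP => u /(subsetP sU); rewrite inE.
have card_N : 2 * \sum_(u in U) #|nbrs e Cs (br u)| <= size C.
  have := branch_bound es lC cH sUH sHB trunk_pod_branches (R := h.+1).
  rewrite -mulnA mulnCA leq_pmul2l //; apply=> //.
  by rewrite card_U; move: lam_lt_h; clear; lia.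
have weight : lam./2.+1 * (2 * mu - (lam < 2)) <=
    2 * \sum_(u in U) #|nbrs e Cs (br u)| + \sum_(u in U) #|pod (ends u)|.
  rewrite -card_U -sum_nat_const big_distrr /= -big_split /=; apply: leq_sum => u uU.
  apply: pod_nbrs_ge (ends_bd uU) _ (subsetUr _ _).
  by rewrite in_setU ends_trunk.
have s_pods : \bigcup_(u in U) pod (ends u) \subset B :\: D.
  by apply/bigcupsP => u _; apply: pod_sub.
have disj : Hs :&: \bigcup_(u in U) pod (ends u) = set0.
  apply/eqP; rewrite -subset0; apply/subsetP => z /setIP[/(subsetP sHD) zD /(subsetP s_pods)].
  by rewrite in_setD zD.
have : size C + #|Hs :|: \bigcup_(u in U) pod (ends u)| <= #|T|.
  by apply: card_vertices_ge; rewrite subUset sHB; apply: subset_trans s_pods (subsetDl _ _).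
rewrite cardsU_disjoint // card_cycle_off (card_bigcup_disjoint_on disjoint_pods) => card_T.
by rewrite (leq_trans _ card_T) // addnCA [_ + h]addnC leq_add2l (leq_trans weight) // leq_add2r.
Qed.

End Linked.
End Pods.

Lemma menger_to_cycle W : mu <= #|W| -> exists U g, #|U| = mu /\ crossing_linkage e Cs W U g.
Proof.
move=> mu_W; have [//|[S sepS S_lt]] := menger_crossing e Cs W mu.
have avoid_S X : mu <= #|X| -> exists2 z, z \in X & z \notin S.
  move=> muX; apply/subsetPn; apply: contraL S_lt => /subset_leq_card X_le.
  by rewrite -leqNgt (leq_trans muX).
have [|a aC aS] := avoid_S Cs.
  by rewrite card_longest_cycle (leq_trans mu_le_h) ?size_longest_cycle_ge.
have [b bW bS] := avoid_S W mu_W.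
have /forall_inP/(_ a aC)/forall_inP/(_ b bW)/negP := sepS; case.
by rewrite aS bS mu_connected.
Qed.

Section Connections.
Variables (W : {set T}) (U : {set T}) (g : T -> seq T).
Hypotheses (sWB : W \subset B) (mu_gt1 : 1 < mu).
Hypothesis joined : {in W &, forall a b, a != b -> long_upath e W a b lam}.
Hypotheses (linkage_g : crossing_linkage e Cs W U g) (card_U : #|U| = mu).

Let br u := [set z in g u].

Lemma connection_branch u : u \in U -> [/\ connected_on e (br u), last u (g u) \in br u,
  u \in nbrs e Cs (br u), br u :&: W \subset [set last u (g u)] & br u \subset B].
Proof.
move=> uU; have [sU gP _] := linkage_g; have [pg _ lW gC _] := gP u uU.
have uC := subsetP sU u uU; have [_ meet_W] := crossing_linkage_meet linkage_g uU.
have sub_g : br u \subset [set z in u :: g u].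
  by apply/subsetP => z; rewrite !in_set in_cons orbC => ->.
have sgB : br u \subset B by apply/subsetP => z; rewrite in_set in_setC => /gC.
have meet_br : br u :&: W \subset [set last u (g u)] by apply: subset_trans (setSI W sub_g) meet_W.
move: pg lW meet_br sgB; rewrite /br; case: (g u) => [_ uW _ _|z q /= /andP[euz pq] lW meet_br sgB].
  by have := subsetP sWB u uW; rewrite in_setC uC.
split=> //; first exact: connected_on_path.
  by rewrite in_set mem_last.
by apply/nbrsP; split=> //; exists z; rewrite ?in_set ?mem_head // es.
Qed.

Lemma connection_gap j a s rest : rot j C = (a :: s) ++ rest -> a \in U ->
  all (predC [in U]) s -> head a rest \in U -> lam <= size s.
Proof.
have [sU gP dU] := linkage_g; move=> E aU /allP no_U; set a' := head a rest => a'U.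
have uC : uniq (rot j C) by rewrite rot_uniq; case: lC => /cycle_seq_uniq.
have naa' : a != a'.
  rewrite /a'; case: rest @a' a'U E => [|b rest] _ _ E /=; last first.
    by move: uC; rewrite E; apply: contraTneq => ->; rewrite /= mem_cat mem_head orbT.
  have : U \subset [set a].
    apply/subsetP => u uU; rewrite in_set1; have := subsetP sU u uU.
    rewrite in_set -(mem_rot j) E cats0 in_cons => /orP[//|us].
    by have := no_U u us; rewrite /= uU.
  by move/subset_leq_card; rewrite card_U cards1 leqNgt mu_gt1.
have [ca la a_att meet_a sa] := connection_branch aU.
have [ca' la' a'_att meet_a' sa'] := connection_branch a'U.
have [[_ _ lW _ _] [_ _ l'W _ _]] := (gP a aU, gP a' a'U).
have disj z : z \in br a -> z \in br a' -> False.
  rewrite !in_set => za za'; case/eqP: naa'.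
  by apply: (dU a a' z); rewrite ?in_cons ?za ?za' ?orbT.
have nll' : last a (g a) != last a' (g a').
  by apply/eqP => El; apply: (disj (last a (g a))); rewrite // El.
apply: (longest_cycle_gap_via es lC E ca ca' la la' meet_a meet_a' _ _ _
          (joined lW l'W nll')) => //.
- by apply/setP => z; rewrite in_setI in_set0; apply/andP => -[/disj].
- by rewrite !subUset sa sWB sa'.
Qed.

(* Consecutive ends on C of the mu disjoint connections to W are more than lam apart. *)
Lemma connected_long_cycle : mu * lam.+1 <= size C.
Proof.
have uC : uniq C by case: lC => /cycle_seq_uniq.
suff : 2 * \sum_(a <- C | a \in U) lam.+1 <= 2 * size C.
  rewrite leq_pmul2l // big_const_seq iter_addn_0 mulnC -size_filter -card_U.
  rewrite -(card_uniqP (filter_uniq _ uC)); congr (_ * _ <= _); apply: eq_card => a.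
  have [sU _ _] := linkage_g; rewrite mem_filter; case: (boolP (a \in U)) => // /(subsetP sU).
  by rewrite in_set => ->.
apply: cyclic_sum_gap_le => j a s rest E aU no_U a'U.
by rewrite addnn -mul2n leq_pmul2l // ltnS; apply: connection_gap E aU no_U a'U.
Qed.

End Connections.

Lemma biconnected_joined W : Hs \subset W -> W \subset B -> biconnected e W ->
  #|boundary e B (high_vertices lam) W| <= lam./2 ->
  {in W &, forall a b, a != b -> long_upath e W a b lam}.
Proof.
move=> sHW sWB bW bd_le a b aW bW' nab.
have [q0 uq0 q0_ge] := biconnected_half_cycle es bW h_gt1 cH sHW aW bW' nab.
have [q longest_q] := longest_upath_exists aW (upath_connect uq0).
have [uq max_q] := longest_q; have /and4P[_ _ qW /eqP lq] := uq.
have [lam_q|short_q] := leqP lam (size q).+1; first by exists q.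
exfalso; rewrite -lq in longest_q.
apply: (no_longest_upath es ei sWB (@high_vertices_degree lam) longest_q).
- exact: ltnW.
- by move: bd_le; clear; lia.
- by have := max_q q0 uq0; move: bd_le q0_ge lam_lt_h; clear; lia.
- move=> I c lI sI _ _ [i iI _].
  have [t tq tc] : exists2 t, t \in a :: q & t != c.
    have [ac|ac] := eqVneq a c; last by exists a; rewrite ?mem_head.
    by exists b; [rewrite -lq mem_last | rewrite -ac eq_sym].
  have tWc : t \in W :\ c by rewrite in_setD1 tc (allP qW).
  have /subsetP/(_ t tWc) := biconnected_lobe_sub bW sWB lI (subset_trans sI (subsetDl _ _)) iI.
  by move=> /(subsetP sI)/setDP[_]; rewrite inE tq.
- exact: (path_fan_free es longest_q short_q).
Qed.

Lemma large_cycle_confined D S : Hs \subset D -> D \subset B -> biconnected e D ->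
  separates (rel_on e D) Hs (boundary e B (high_vertices lam) D) S -> #|S| <= lam./2 ->
  mu.+1 * lam.+1 <= #|T|.+1.
Proof.
move=> sHD sDB bD sepS cS; have [W1 [sHW1 sW1D bdW1]] := separator_boundary sHD sepS.
have [W [/andP[sHW sWD] bdW minW]] := lex_min_set
  (Q := fun W => (Hs \subset W) && (W \subset D)) (fun W => #|boundary e B (high_vertices lam) W|)
  (introT andP (conj sHW1 sW1D)).
have sWB := subset_trans sWD sDB.
have bW := min_boundary_biconnected es H_biconnected sHW sWD sDB bD minW.
have {bdW} bd_le : #|boundary e B (high_vertices lam) W| <= lam./2.
  exact: leq_trans bdW (leq_trans (subset_leq_card bdW1) cS).
have joined := biconnected_joined sHW sWB bW bd_le.
have h_le_W : h <= #|W| by rewrite -card_cycle_off subset_leq_card.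
have card_T := card_vertices_ge sHB; rewrite card_cycle_off in card_T.
have [mu_gt1|mu_le1] := ltnP 1 mu; last first.
  by move: mu_le1 mu_gt0 lam_lt_h size_longest_cycle_ge card_T; clear; nia.
have [U [g [cU linkage_g]]] := menger_to_cycle (leq_trans mu_le_h h_le_W).
have := connected_long_cycle sWB mu_gt1 joined linkage_g cU.
by move: lam_lt_h card_T; clear; nia.
Qed.

Lemma order_bound_of_large_cycle : mu.+1 * lam.+1 <= #|T|.+1.
Proof.
have [D [sHD sDB foot_D bD]] := block_exists es H_biconnected sHB.
have [[U [g [cU linkage_g]]]|[S sepS cS]] :=
    menger_crossing (rel_on e D) Hs (boundary e B (high_vertices lam) D) lam./2.+1.
  exact: (large_cycle_linked sHD sDB foot_D linkage_g cU).
exact: large_cycle_confined sHD sDB bD sepS cS.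
Qed.

End LargeCycle.
End OffCycle.

Lemma order_bound (T : finType) (e : rel T) (C H : seq T) (lam mu : nat) :
  symmetric e -> irreflexive e -> 0 < lam -> 0 < mu -> mu <= size H ->
  longest_cycle_in e setT C -> longest_cycle_in e (~: [set z in C]) H ->
  (forall v, lam + mu <= #|[set w | e v w]|.+1) ->
  k_connected_rel e mu -> mu.+1 * lam.+1 <= #|T|.+1.
Proof.
move=> es ei lam_gt0 mu_gt0; case: H => [|x p] mu_le lC lH deg mu_connected.
  by case: lH => /and3P[].
have [h_le|h_gt] := leqP (size (x :: p)) lam.
  exact: (order_bound_of_small_cycle es ei lC lH deg mu_le h_le).
exact: (order_bound_of_large_cycle es ei lC lH deg mu_le lam_gt0 mu_gt0 h_gt mu_connected).
Qed.

(** * Graphs *)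

Import Order.TTheory GRing.Theory Num.Theory.

Section Graphs.
Variable G : sgraph.
Implicit Types (v : G) (c : seq G).

Lemma min_degree_le v : min_degree G <= degree v.
Proof. by rewrite /min_degree -minEnat -leEnat bigmin_le_cond. Qed.

Lemma circumference_max c : is_cycle c -> size c <= circumference G.
Proof.
move=> cc; have c_lt : size c < #|G|.+1.
  by have /and3P[_ /card_uniqP <- _] := cc; rewrite ltnS max_card.
rewrite /circumference -[size c]/(nat_of_ord (Ordinal c_lt)); apply: leq_bigmax_cond.
by apply/existsP; exists (in_tuple c).
Qed.

Lemma circumference_attained :
  0 < circumference G -> exists2 c : seq G, is_cycle c & size c = circumference G.
Proof.
move=> circ_gt0; pose P (k : 'I_#|G|.+1) := [exists t : k.-tuple G, is_cycle t].
have [k Pk|none] := pickP P; last by rewrite /circumference big_pred0 in circ_gt0.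
have P_gt0 : 0 < #|P| by apply/card_gt0P; exists k.
have [j /existsP[t ct] Ej] := eq_bigmax_cond val P_gt0.
by exists t; rewrite ?size_tuple.
Qed.

Lemma k_connected_adj k : k_connected k G -> k_connected_rel (@adj G) k.
Proof.
move=> [_ conn] S a b S_lt; rewrite -!in_setC => aS bS.
have /connectP[q pq Eb] := conn S S_lt (Sub a aS) (Sub b bS).
have -> : b = last a (map val q) by rewrite -[a]/(val (Sub a aS : del_vertices S)) last_map -Eb.
apply/connectP; exists (map val q) => //.
rewrite -[a]/(val (Sub a aS : del_vertices S)) path_map; apply: sub_path pq => z z' ezz'.
by apply/and3P; split; [apply: valP | apply: valP | apply: ezz'].
Qed.

End Graphs.

Section VertexDeletion.
Variables (G : sgraph) (S : {set G}).

Lemma is_cycle_map_val (d : seq (del_vertices S)) : is_cycle (map val d) = is_cycle d.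
Proof. by rewrite /is_cycle size_map map_inj_uniq ?cycle_map //; apply: val_inj. Qed.

Lemma map_val_lift (c : seq G) :
  {subset c <= ~: S} -> exists d : seq (del_vertices S), map val d = c.
Proof.
move=> sc; exists (pmap insub c); rewrite (pmap_filter (insubK _)); apply/all_filterP/allP => z zc.
by rewrite isSome_insub sc.
Qed.

Lemma longest_cycle_off : 0 < circumference (del_vertices S) ->
  exists2 c : seq G, longest_cycle_in (@adj G) (~: S) c & size c = circumference (del_vertices S).
Proof.
move=> /circumference_attained[d cd sd]; exists (map val d); last by rewrite size_map.
split=> [|z /mapP[y _ ->]|c cc /map_val_lift[d' Ed']]; first by rewrite -is_cycle_map_val in cd.
  exact: valP.
rewrite -Ed' !size_map sd; apply: (@circumference_max (del_vertices S)).
by rewrite -is_cycle_map_val Ed'.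
Qed.

End VertexDeletion.

Lemma nat_order_bound (n delta lambda : nat) : lambda <= delta ->
  ((n + 2)%:R / (lambda + 1)%:R + lambda%:R - 2%:R <= delta%:R :> rat)%R ->
  n + 2 <= (delta - lambda + 1).+1 * lambda.+1.
Proof.
move=> le_delta bound; set mu := delta - lambda + 1.
have sum_mu : (mu + 1 + lambda = delta + 2)%N by rewrite /mu; lia.
have : ((n + 2)%:R / (lambda + 1)%:R <= (mu + 1)%:R :> rat)%R.
  by rewrite -(lerD2r lambda%:R) -natrD sum_mu [X in (_ <= X)%R]natrD -lerBlDr.
by rewrite ler_pdivrMr ?ltr0n ?addn1 // -natrM ler_nat.
Qed.

Theorem theorem3 (G : sgraph) (lambda : nat) (C : seq G)
  (hlambda : 1 <= lambda <= min_degree G)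
  (hconn : k_connected (min_degree G - lambda + 1) G)
  (hC : longest_cycle C)
  (hdelta : ((#|G| + 2)%:R / (lambda + 1)%:R + lambda%:R - 2%:R
               <= (min_degree G)%:R :> rat)%R) :
  c_bar C <= min_degree G - lambda.
Proof.
have [lambda_gt0 le_delta] := andP hlambda.
have order_lt := nat_order_bound le_delta hdelta.
rewrite leqNgt; apply/negP => cbar_gt.
have [H longest_H size_H] := longest_cycle_off (leq_ltn_trans (leq0n _) cbar_gt).
have longest_C : longest_cycle_in (@adj G) setT C.
  by have [cC maxC] := hC; split=> // [z|d cd _]; [rewrite in_setT | apply: maxC].
have deg (v : G) : lambda + (min_degree G - lambda + 1) <= #|[set w | adj v w]|.+1.
  by rewrite addn1 addnS subnKC // ltnS; apply: min_degree_le.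
suff order_ge : (min_degree G - lambda + 1).+1 * lambda.+1 <= #|G|.+1.
  by have := leq_trans order_lt order_ge; rewrite addn2 ltnn.
apply: (order_bound (@adj_sym G) (@adj_irrefl G) lambda_gt0 _ _ longest_C longest_H deg).
- by rewrite addn1.
- by rewrite size_H addn1.
- exact: k_connected_adj hconn.
Qed.
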